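(* Let $\sigma_1,\sigma_2,\sigma_3$ be the Pauli matrices and, for $\varphi\in H^1(\mathbb{R}^3,\mathbb{C}^2)$, let $(\sigma\cdot\nabla)\varphi=\sum_{k=1}^3\sigma_k\,\partial_k\varphi$. Then the following Hardy-type inequalities hold for all $\varphi\in H^1(\mathbb{R}^3,\mathbb{C}^2)$. (a) For every $\nu\in(0,1)$, $$\int_{\mathbb{R}^3}\left(\frac{|(\sigma\cdot\nabla)\varphi|^2}{1+\frac{\nu}{|x|}+\sqrt{1-\nu^2}}+\bigl(1-\sqrt{1-\nu^2}\bigr)|\varphi|^2\right)dx\;\geq\;\nu\int_{\mathbb{R}^3}\frac{|\varphi|^2}{|x|}\,dx .$$ (b) $$\int_{\mathbb{R}^3}\left(\frac{|(\sigma\cdot\nabla)\varphi|^2}{1+\frac{1}{|x|}}+|\varphi|^2\right)dx\;\geq\;\int_{\mathbb{R}^3}\frac{|\varphi|^2}{|x|}\,dx .$$ (c) $$\int_{\mathbb{R}^3}|x|\,|(\sigma\cdot\nabla)\varphi|^2\,dx\;\geq\;\int_{\mathbb{R}^3}\frac{|\varphi|^2}{|x|}\,dx ,$$ where the left-hand side of (c) is allowed to be $+\infty$.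
   Context: The Pauli matrices are $$\sigma_1=\begin{pmatrix}0&1\\1&0\end{pmatrix},\quad \sigma_2=\begin{pmatrix}0&-i\\ i&0\end{pmatrix},\quad \sigma_3=\begin{pmatrix}1&0\\0&-1\end{pmatrix}.$$ $|\cdot|$ denotes the Euclidean norm on $\mathbb{R}^3$ and the canonical Hermitian norm on $\mathbb{C}^2$. $H^1(\mathbb{R}^3,\mathbb{C}^2)$ is the usual Sobolev space of $\mathbb{C}^2$-valued square-integrable functions with square-integrable weak gradient. *)

(* Defs.v *)
From HB Require Import structures.
From mathcomp Require Import all_boot all_order all_algebra.
From mathcomp Require Import all_classical all_reals all_analysis.
From mathcomp Require Import complex.

Set Implicit Arguments.
Unset Strict Implicit.
Unset Printing Implicit Defensive.
Import Order.TTheory GRing.Theory Num.Theory.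
Import numFieldNormedType.Exports.
Local Open Scope classical_set_scope.
Local Open Scope ring_scope.
Local Open Scope complex_scope.

(* R^3 carries the product topology and vector space structure; the library's
   norm on it is the sup norm, enorm below is the Euclidean one. mR3 is the same
   type, seen with the product of the Borel sigma-algebras on which the
   library's lebesgue_measure is defined. *)
Notation R3 R := (R * R * R)%type.
Notation mR3 R := (measurableTypeR R * measurableTypeR R * measurableTypeR R)%type.
Notation spinor R := 'cV[R[i]]_2.

Section Space.
Variable R : realType.

Definition lebesgue3 : set (mR3 R) -> \bar R :=
  ((@lebesgue_measure R \x @lebesgue_measure R) \x @lebesgue_measure R)%E.

HB.instance Definition _ := Measure.on lebesgue3.

Definition enorm (x : R3 R) : R :=
  Num.sqrt (x.1.1 ^+ 2 + x.1.2 ^+ 2 + x.2 ^+ 2).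

Definition basis3 (k : 'I_3) : R3 R :=
  ((k == 0 :> nat)%:R, (k == 1 :> nat)%:R, (k == 2 :> nat)%:R).

Definition partial (k : 'I_3) (f : R3 R -> R) : R3 R -> R :=
  fun x => 'D_(basis3 k) f x.

(* partials [:: k1; ...; kn] f is the iterated partial derivative
   d_k1 (... (d_kn f)). *)
Definition partials (s : seq 'I_3) (f : R3 R -> R) : R3 R -> R :=
  foldr partial f s.

(* The library's derive is total, hence the derivability requirement. *)
Definition smooth (f : R3 R -> R) : Prop :=
  forall s : seq 'I_3, continuous (partials s f) /\
    forall (k : 'I_3) (x : R3 R), derivable (partials s f) x (basis3 k).

Definition test_function (f : R3 R -> R) : Prop :=
  smooth f /\ compact (closure [set x | f x != 0]).

End Space.

Section Spinor.
Variable R : realType.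

Definition mx2 (a b c d : R[i]) : 'M[R[i]]_2 :=
  \matrix_(i < 2, j < 2)
    (if i == 0 then if j == 0 then a else b else if j == 0 then c else d).

(* Indices start at 0: pauli k is the matrix usually written sigma_(k+1). *)
Definition pauli (k : 'I_3) : 'M[R[i]]_2 :=
  match val k with
  | 0%N => mx2 0 1 1 0
  | 1%N => mx2 0 (- 'i%C) 'i%C 0
  | _ => mx2 1 0 0 (-1)
  end.

(* The canonical Hermitian norm on C^2, as a real number. *)
Definition hnorm (v : spinor R) : R :=
  Num.sqrt (\sum_(i < 2) (complex.Re (v i 0) ^+ 2 + complex.Im (v i 0) ^+ 2)).

Definition measurable_spinor (phi : R3 R -> spinor R) : Prop :=
  forall i : 'I_2,
    measurable_fun [set: mR3 R] (fun x => complex.Re (phi x i 0)) /\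
    measurable_fun [set: mR3 R] (fun x => complex.Im (phi x i 0)).

Definition square_integrable (phi : R3 R -> spinor R) : Prop :=
  measurable_spinor phi /\
  (\int[@lebesgue3 R]_x (hnorm (phi x) ^+ 2)%:E < +oo)%E.

Definition weak_partial_real (k : 'I_3) (f g : R3 R -> R) : Prop :=
  forall psi : R3 R -> R, test_function psi ->
    (\int[@lebesgue3 R]_x (f x * partial k psi x)%:E =
     - \int[@lebesgue3 R]_x (g x * psi x)%:E)%E.

(* Integrals are real-valued in the library, so d_k phi = g is tested, against
   real test functions, on the real and imaginary part of each component. *)
Definition weak_partial (k : 'I_3) (phi g : R3 R -> spinor R) : Prop :=
  forall i : 'I_2,
    weak_partial_real k (fun x => complex.Re (phi x i 0))
                        (fun x => complex.Re (g x i 0)) /\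
    weak_partial_real k (fun x => complex.Im (phi x i 0))
                        (fun x => complex.Im (g x i 0)).

Definition L2_weak_gradient (phi : R3 R -> spinor R)
    (dphi : 'I_3 -> R3 R -> spinor R) : Prop :=
  forall k : 'I_3, square_integrable (dphi k) /\ weak_partial k phi (dphi k).

Definition H1 (phi : R3 R -> spinor R) : Prop :=
  square_integrable phi /\ exists dphi, L2_weak_gradient phi dphi.

(* (sigma . grad) phi, where dphi is the weak gradient of phi. *)
Definition sigma_grad (dphi : 'I_3 -> R3 R -> spinor R) : R3 R -> spinor R :=
  fun x => \sum_(k < 3) pauli k *m dphi k x.

End Spinor.

(* Main.v *)
(* With w = r / (alpha r + nu), all three inequalities are instances of
     (2 beta - beta^2 nu) int |phi|^2 / r
       <= int w |sigma . grad phi|^2 + beta^2 alpha int |phi|^2: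
   (a) is alpha = 1 + sqrt (1 - nu^2), beta = nu / alpha; (b) is
   alpha = beta = nu = 1; (c) is beta = nu = 1, alpha -> 0.

   For smooth phi and r regularized to rho = sqrt (r^2 + d^2),
   |sigma . grad phi|^2 - |grad phi|^2 is a combination of Jacobians of pairs of
   real components of phi. Contracting these Jacobians with the derivative
   matrix of the vector field w(rho) x, instead of with w(rho) times the
   identity, gives a divergence; the difference involves only the tangential
   derivatives x /\ grad phi, which |grad phi|^2 controls because
   w' <= w / rho. What remains is the radial derivative, and completing the
   square w |d_r phi + (beta / w) phi|^2 >= 0 together with
   int 2 phi . d_r phi = - int |phi|^2 div (x / rho) yields the inequality.

   A general phi is mollified: Jensen's inequality and the Lipschitz continuity
   of w bound the right-hand side, while Fatou's lemma, applied along
   almost-everywhere convergent mollifications in one coordinate at a time,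
   handles the left-hand side. *)
From HB Require Import structures.
Require Import Defs.
From mathcomp Require Import all_boot all_order all_algebra.
From mathcomp Require Import all_classical all_reals all_analysis.
From mathcomp Require Import measurable_realfun complex ring lra.

Set Implicit Arguments.
Unset Strict Implicit.
Unset Printing Implicit Defensive.
Import Order.TTheory GRing.Theory Num.Theory.
Import numFieldNormedType.Exports.
Local Open Scope classical_set_scope.
Local Open Scope ring_scope.

(** * The pointwise inequality *)

Section Algebra.
Variable R : realFieldType.
Implicit Types (x : 'I_3 -> R) (u : 'I_4 -> R) (a : 'I_4 -> 'I_3 -> R).

(** The value of [beta] is dictated by the case of equality. With s = sqrt (1 - nu^2), in (a) beta /
    w = nu + (1 - s) / r, and the functions annihilated by d_r + beta / w are the multiples of r^(s
    - 1) exp (- nu r), the radial profile of the Dirac-Coulomb ground state.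

    No cut-off at infinity is needed. A mollified H^1 function and its derivatives are in L^2, and
    alpha, d > 0 keep the coefficients bounded, so every divergence is a sum of integrable
    derivatives along lines, which integrate to 0. The price is that (c), where alpha vanishes, is
    reached only as a limit.

    The two sides pass to the limit differently because of their weights. The singular weight 1 / r
    stands on the side where semicontinuity is enough. The weight w is Lipschitz uniformly in alpha,
    so moving it across a mollifier of width d costs a multiple of d times the integral of |sigma .
    grad phi|^2, which is finite. Mollifying one coordinate at a time makes the differentiation
    theorem on the line sufficient for almost everywhere convergence. *)

Definition sum3 (f : 'I_3 -> R) : R := f 0 + f 1 + f 2.
Definition sum4 (f : 'I_4 -> R) : R := f 0 + f 1 + f 2 + f 3.

(* The real components of sigma . grad phi when phi = (u0 + i u1, u2 + i u3)
   and a p k = d_k (u p). *)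
Definition dirac_op a (p : 'I_4) : R :=
  match val p with
  | 0 => a 2 0 + a 3 1 + a 0 2
  | 1 => a 3 0 - a 2 1 + a 1 2
  | 2 => a 0 0 - a 1 1 - a 2 2
  | _ => a 1 0 + a 0 1 - a 3 2
  end.

Definition cross3 (v w : 'I_3 -> R) (l : 'I_3) : R :=
  match val l with
  | 0 => v 1 * w 2 - v 2 * w 1
  | 1 => v 2 * w 0 - v 0 * w 2
  | _ => v 0 * w 1 - v 1 * w 0
  end.

(* Row c of curl a is the vector field by which |dirac_op a|^2 differs from
   |a|^2: see dirac_op_sqr. *)
Definition curl a (c l : 'I_3) : R :=
  2 * match val c with
  | 0 => cross3 (a 3) (a 0) l + cross3 (a 1) (a 2) l
  | 1 => cross3 (a 0) (a 2) l + cross3 (a 1) (a 3) l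
  | _ => cross3 (a 2) (a 3) l - cross3 (a 0) (a 1) l
  end.

Definition nsq3 x := sum3 (fun k => x k ^+ 2).

(** Since sigma_j sigma_k = delta_jk + i epsilon_jkl sigma_l, the cross terms in the square are
    cross products of gradients of real components. These integrate to 0, which is why the two
    energies can be compared. *)
Lemma dirac_op_sqr a :
  sum4 (fun p => dirac_op a p ^+ 2) =
  sum4 (fun p => nsq3 (a p)) + sum3 (fun c => curl a c c).
Proof. rewrite /sum4 /nsq3 /sum3 /dirac_op /curl /cross3 /=; ring. Qed.

Lemma nsq3_cross x y :
  nsq3 (cross3 x y) = nsq3 x * nsq3 y - sum3 (fun k => x k * y k) ^+ 2.
Proof. rewrite /nsq3 /sum3 /cross3 /=; ring. Qed.

(* The pointwise form of |sigma . L phi|^2 <= 2 |L phi|^2, L = x /\ grad: as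
   x . L = 0, only two of the Pauli matrices matter. *)
Lemma curl_radial_le x a :
  sum3 (fun c => sum3 (fun l => x c * x l * curl a c l)) <=
  sum4 (fun p => nsq3 (cross3 x (a p))).
Proof.
have [x0|x0] := eqVneq (nsq3 x) 0.
  have xk k : x k = 0.
    have k3 : [|| k == 0, k == 1 | k == 2] by case: k => [[|[|[|]]]].
    move: x0; rewrite /nsq3 /sum3 => /eqP.
    rewrite paddr_eq0 ?addr_ge0 ?sqr_ge0// paddr_eq0 ?sqr_ge0//.
    rewrite !sqrf_eq0 => /andP[/andP[/eqP h0 /eqP h1] /eqP h2].
    by case/or3P: k3 => /eqP ->.
  by rewrite /nsq3 /sum4 /sum3 /cross3 /= !xk !mul0r !addr0 subrr expr0n /= !addr0.
have xp : 0 < nsq3 x by rewrite lt_neqAle eq_sym x0 /nsq3/sum3 !addr_ge0 ?sqr_ge0.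
(* [b] is i (sigma . x) applied to each column of [a]. On vectors orthogonal to x, the cross product
   with x and i (sigma . x) both square to - |x|^2. The defect in the inequality measures how far
   the two actions differ on the tangential derivatives, hence is a sum of squares. *)
pose b (p : 'I_4) (l : 'I_3) := match val p with
  | 0 => x 1 * a 2 l - x 2 * a 1 l - x 0 * a 3 l
  | 1 => x 2 * a 0 l + x 1 * a 3 l + x 0 * a 2 l
  | 2 => x 2 * a 3 l - x 1 * a 0 l - x 0 * a 1 l
  | _ => x 0 * a 0 l - x 1 * a 1 l - x 2 * a 2 l
  end.
rewrite -subr_ge0 -(pmulr_rge0 _ xp).
have -> : nsq3 x * (sum4 (fun p => nsq3 (cross3 x (a p))) -
   sum3 (fun c => sum3 (fun l => x c * x l * curl a c l))) =
  2^-1 * sum4 (fun p => nsq3 (cross3 x (fun l => cross3 x (a p) l - b p l))).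
  rewrite /nsq3 /sum4 /sum3 /cross3 /curl /cross3 /b /=; by field.
by apply: mulr_ge0; rewrite ?invr_ge0// /sum4 /nsq3 /sum3 !addr_ge0 ?sqr_ge0.
Qed.

Lemma sqr_completion (w c s u : R) : 0 < w ->
  0 <= w * s ^+ 2 + 2 * c * u * s + c ^+ 2 / w * u ^+ 2.
Proof.
move=> w0.
have -> : w * s ^+ 2 + 2 * c * u * s + c ^+ 2 / w * u ^+ 2 =
  w * (s + c * u / w) ^+ 2 by field; rewrite gt_eqF.
by rewrite mulr_ge0 ?sqr_ge0// ltW.
Qed.

(* With w = rho / (alpha rho + nu) and g = w' / rho, the matrix
   w delta + g x x^T below is the Jacobian of the vector field w x. *)
Lemma pointwise_hardy x u a (rho alpha nu beta w g : R) :
  w = rho / (alpha * rho + nu) -> g = nu / (rho * (alpha * rho + nu) ^+ 2) ->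
  0 < rho -> 0 < alpha -> 0 < nu -> nsq3 x <= rho ^+ 2 ->
  0 <= w * sum4 (fun p => dirac_op a p ^+ 2)
     + beta ^+ 2 * (alpha + nu / rho) * sum4 (fun p => u p ^+ 2)
     + 2 * beta / rho * sum4 (fun p => u p * sum3 (fun k => x k * a p k))
     - sum3 (fun c => sum3 (fun l =>
         (w * (c == l)%:R + g * x c * x l) * curl a c l)).
Proof.
move=> Ew Eg rho0 al0 nu0 xrho.
have den0 : 0 < alpha * rho + nu by rewrite addr_gt0// mulr_gt0.
have w0 : 0 < w by rewrite Ew divr_gt0.
have g0 : 0 <= g by rewrite Eg divr_ge0 ?mulr_ge0 ?sqr_ge0// ltW.
pose s p := sum3 (fun k => x k * a p k).
pose T := sum4 (fun p => nsq3 (cross3 x (a p))).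
have T0 : 0 <= T by rewrite /T /sum4 /nsq3 /sum3 !addr_ge0 ?sqr_ge0.
have gw : g <= w / rho ^+ 2.
  have -> : w / rho ^+ 2 = (alpha * rho + nu) / (rho * (alpha * rho + nu) ^+ 2).
    by rewrite Ew; field; rewrite ?gt_eqF.
  rewrite Eg ler_pM2r ?invr_gt0 ?mulr_gt0 ?exprn_gt0// lerDr.
  by rewrite mulr_ge0// ltW.
(* By [nsq3_cross], the tangential part is at most rho^2 |grad|^2 minus the squares of the radial
   sums [s p]. The [g] term thus uses up the tangential share of w |grad|^2 and leaves w (s /
   rho)^2, which enters the completed square [Hp] with [s p / rho] as radial derivative. *)
have gT : g * sum3 (fun c => sum3 (fun l => x c * x l * curl a c l)) <=
    w * sum4 (fun p => nsq3 (a p)) - w / rho ^+ 2 * sum4 (fun p => s p ^+ 2).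
  apply: (@le_trans _ _ (g * T)); first by rewrite ler_wpM2l// curl_radial_le.
  apply: (@le_trans _ _ (w / rho ^+ 2 * T)); first by rewrite ler_wpM2r.
  have : w / rho ^+ 2 * T <= w / rho ^+ 2 *
      (rho ^+ 2 * sum4 (fun p => nsq3 (a p)) - sum4 (fun p => s p ^+ 2)).
    rewrite ler_wpM2l ?divr_ge0 ?sqr_ge0 ?(ltW w0)//.
    have H p : nsq3 (cross3 x (a p)) <= rho ^+ 2 * nsq3 (a p) - s p ^+ 2.
      rewrite nsq3_cross lerB// ler_wpM2r//.
      by rewrite /nsq3 /sum3 !addr_ge0 ?sqr_ge0.
    have := H 0; have := H 1; have := H 2; have := H 3.
    rewrite /T /sum4; lra.
  move=> /le_trans; apply.
  by rewrite mulrBr mulrA divfK// expf_neq0// gt_eqF.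
have Dw : w * sum4 (fun p => dirac_op a p ^+ 2) - sum3 (fun c => sum3 (fun l =>
      (w * (c == l)%:R + g * x c * x l) * curl a c l)) =
   w * sum4 (fun p => nsq3 (a p)) -
   g * sum3 (fun c => sum3 (fun l => x c * x l * curl a c l)).
  rewrite dirac_op_sqr /sum3 /=; ring.
have Hw : beta ^+ 2 * (alpha + nu / rho) = beta ^+ 2 / w.
  by rewrite Ew; field; rewrite ?gt_eqF.
have Hp p : 0 <= w / rho ^+ 2 * s p ^+ 2 + 2 * beta / rho * (u p * s p)
             + beta ^+ 2 / w * u p ^+ 2.
  have := @sqr_completion w beta (s p / rho) (u p) w0.
  congr (0 <= _); field; rewrite ?gt_eqF//.
have := Hp 0; have := Hp 1; have := Hp 2; have := Hp 3.
move: gT Dw Hw; rewrite /sum4 -/(s 0) -/(s 1) -/(s 2) -/(s 3).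
set SS := sum3 (fun c => sum3 _).
move=> gT Dw ->.
lra.
Qed.

End Algebra.

(** * Smooth functions and mollifiers *)

Section Calculus.
Variables (R : realType) (V : normedModType R).
Implicit Types (f g : V -> R) (x v : V).

(** Restricting to a line turns directional derivatives into derivatives in one variable. The chain
    rule below then requires of [f] only derivability along [v], not differentiability. *)
Lemma is_derive_line f x v (df : R) :
  is_derive x v f df <-> is_derive (0 : R) 1 (fun h : R => f (h *: v + x)) df.
Proof.
have E : 'D_1 (fun h : R => f (h *: v + x)) (0 : R) = 'D_v f x.
  rewrite /derive; set g1 := fun h => h^-1 *: _; set g2 := fun h => h^-1 *: _.
  suff -> : g1 = g2 by [].
  by apply/funext => h; rewrite /g1 /g2 /= addr0 scale0r add0r [_%:A]mulr1.
split=> -[fx fE].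
  by apply: DeriveDef; [exact: (derivable1P f x v).1|rewrite E].
by apply: DeriveDef; [exact: (derivable1P f x v).2|rewrite -E].
Qed.

Lemma is_derive_mul f g x v (df dg : R) :
  is_derive x v f df -> is_derive x v g dg ->
  is_derive x v (fun y => f y * g y) (df * g x + f x * dg).
Proof.
move=> fx gx; have -> : df * g x + f x * dg = f x *: dg + g x *: df.
  by rewrite /GRing.scale /= addrC (mulrC (g x)).
exact: (is_deriveM fx gx).
Qed.

Lemma is_derive_add f g x v (df dg : R) :
  is_derive x v f df -> is_derive x v g dg ->
  is_derive x v (fun y => f y + g y) (df + dg).
Proof. by move=> fx gx; exact: is_deriveD. Qed.

Lemma is_derive_sub f g x v (df dg : R) :
  is_derive x v f df -> is_derive x v g dg ->
  is_derive x v (fun y => f y - g y) (df - dg).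
Proof. by move=> fx gx; exact: is_deriveB. Qed.

Lemma is_derive_const (c : R) x v : is_derive x v (fun=> c : R) 0.
Proof. exact: is_derive_cst. Qed.

Lemma is_derive_scale (c : R) f x v (df : R) :
  is_derive x v f df -> is_derive x v (fun y => c * f y) (c * df).
Proof. by move=> fx; exact: (is_deriveZ c fx). Qed.

Lemma is_derive_comp (h : R -> R) f x v (dh df : R) :
  is_derive (f x) 1 h dh -> is_derive x v f df ->
  is_derive x v (fun y => h (f y)) (dh * df).
Proof.
move=> hx /is_derive_line fx; apply/is_derive_line.
apply: (@is_derive1_comp _ h (fun t : R => f (t *: v + x))) => //.
by rewrite scale0r add0r.
Qed.

Lemma is_derive_inv f x v (df : R) : f x != 0 ->
  is_derive x v f df -> is_derive x v (fun y => (f y)^-1) (- df / f x ^+ 2).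
Proof.
move=> fx0 fx; apply: is_derive_eq.
  apply: (@is_derive_comp (fun t => t^-1)) fx.
  exact: (@is_deriveV _ (fun t : R => t) (f x) 1 1 fx0 (is_derive_id _ _)).
by rewrite /GRing.scale /= mulr1 mulrC mulNr mulrN.
Qed.

Lemma is_derive_expn n f x v (df : R) :
  is_derive x v f df ->
  is_derive x v (fun y => f y ^+ n) (n%:R * f x ^+ n.-1 * df).
Proof.
move=> fx; have := is_deriveX n fx.
rewrite /GRing.scale /= (_ : f ^+ n = fun y => f y ^+ n)//.
by apply/funext => y; elim: n => [|n IH]; rewrite ?expr0// !exprS -IH.
Qed.

End Calculus.

Section Flat.
Variable R : realType.

(** The factor t^-n makes the family stable under differentiation up to linear combinations, see
    [is_derive_flat]. Smoothness of exp (-1/t) at 0 then follows from first derivatives alone. *)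
Definition flat (n : nat) (t : R) : R :=
  if 0 < t then t^-1 ^+ n * expR (- t^-1) else 0.

Lemma flat_ge0 n t : 0 <= flat n t.
Proof.
rewrite /flat; case: ifP => // t0.
by rewrite mulr_ge0 ?expR_ge0// exprn_ge0// invr_ge0 ltW.
Qed.

(** This is y^(n+2) <= (n+2)! exp y at y = 1/t. A quadratic bound makes the difference quotient at 0
    tend to 0. *)
Lemma flat_le n t : flat n t <= (n.+2)`!%:R * t ^+ 2.
Proof.
rewrite /flat; case: ifPn => [t0|_]; last by rewrite mulr_ge0 ?sqr_ge0.
have ti0 : 0 <= t^-1 by rewrite invr_ge0 ltW.
have H : t^-1 ^+ n.+2 / (n.+2)`!%:R <= expR t^-1.
  by apply: le_trans (expR_ge1Dxn n.+1 ti0); rewrite lerDr.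
rewrite expRN ler_pdivrMr ?expR_gt0//.
have f0 : 0 < (n.+2)`!%:R :> R by rewrite ltr0n fact_gt0.
rewrite ler_pdivrMr// in H.
apply: (@le_trans _ _ (t ^+ 2 * (t^-1 ^+ n.+2))).
  by rewrite -(addn2 n) exprD mulrCA -exprMn divff ?gt_eqF// expr1n mulr1.
apply: (le_trans (ler_wpM2l (sqr_ge0 t) H)).
have -> : t ^+ 2 * (expR t^-1 * (n.+2)`!%:R) = (n.+2)`!%:R * t ^+ 2 * expR t^-1.
  ring.
by [].
Qed.

Lemma is_derive_flat n (t : R) :
  is_derive t 1 (flat n) (flat n.+2 t - n%:R * flat n.+1 t).
Proof.
have [t0|t0|t0] := ltgtP t 0.
- apply: (@near_eq_is_derive _ _ _ (fun=> 0)); last first.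
    rewrite /flat ltNge (ltW t0) /= mulr0 subrr.
    exact: is_derive_cst.
  near=> z; rewrite /flat ltNge.
  by rewrite (_ : z <= 0)//; apply: ltW; near: z; exact: lt_nbhsl.
- have tn0 : t != 0 by rewrite gt_eqF.
  have dV := @is_derive_inv R R^o (fun z : R => z) t 1 1 tn0 (is_derive_id _ _).
  have dX := is_derive_expn n dV.
  have dE := @is_derive_comp R R^o expR _ _ _ _ _ (is_derive_expR _)
    (@is_derive_scale R R^o (-1) _ _ _ _ dV).
  have dP := is_derive_mul dX dE.
  have -> : flat n.+2 t - n%:R * flat n.+1 t =
      n%:R * t^-1 ^+ n.-1 * (- 1 / t ^+ 2) * expR (-1 * t^-1) +
      t^-1 ^+ n * (expR (-1 * t^-1) * (-1 * (- 1 / t ^+ 2))).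
    rewrite /flat t0 /= !mulN1r.
    case: n {dX dE dP} => [|n]; first by rewrite !mul0r !expr0 /=; field.
    by rewrite /= !exprS; field.
  apply: near_eq_is_derive dP; near=> z; rewrite /flat mulN1r.
  by rewrite (_ : 0 < z)//; near: z; exact: lt_nbhsr.
- rewrite t0 {t0 t}.
  have -> : flat n.+2 0 - n%:R * flat n.+1 0 = 0 by rewrite /flat ltxx mulr0 subrr.
  have C0 : 0 < (n.+2)`!%:R :> R by rewrite ltr0n fact_gt0.
  have cv : h^-1 *: ((flat n \o shift 0) (h *: 1) - flat n 0) @[h --> 0^'] --> (0 : R).
    apply/cvgrPdist_le => e e0.
    near=> h.
    rewrite sub0r normrN /= addr0 [_%:A]mulr1 {2}/flat ltxx subr0.
    have h0 : h != 0 by near: h; exact: nbhs_dnbhs_neq.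
    rewrite normrM normfV ler_pdivrMl ?normr_gt0//.
    rewrite ger0_norm ?flat_ge0//.
    apply: (le_trans (flat_le _ _)).
    rewrite -real_normK ?num_real// expr2 mulrA mulrC ler_wpM2l//.
    rewrite -ler_pdivlMl//; near: h; apply: dnbhs0_le.
    by rewrite mulr_gt0// invr_gt0.
  apply: DeriveDef; first by apply/cvg_ex; exists 0.
  exact/cvg_lim.
Unshelve. all: by end_near.
Qed.

End Flat.

Section SmoothFunctions.
Variable R : realType.
Implicit Types f g : R -> R.

Definition cinf f := forall n (x : R), derivable (derive1n n f) x 1.

Definition ccinf f :=
  cinf f /\ exists M : R, forall x, M <= `|x| -> f x = 0.

Lemma cinf_closed (P : (R -> R) -> Prop) f :
  (forall g, P g -> exists2 h, P h & forall x : R, is_derive x 1 g (h x)) ->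
  P f -> cinf f.
Proof.
move=> PD Pf n x; suff [h Ph hd] : exists2 g, P g & g = derive1n n f.
  by have [k _ /(_ x) []] := PD h Ph; rewrite hd.
elim: n => [|n [g Pg gE]]; first by exists f.
have [h Ph hd] := PD g Pg; exists h => //.
rewrite derive1nS -gE; apply/funext => y; rewrite derive1E.
by have [_ ->] := hd y.
Qed.

Lemma cinf_is_derive f (x : R) : cinf f -> is_derive x 1 f (derive1 f x).
Proof. by move=> /(_ 0 x) fx; rewrite derive1E; exact/derivableP. Qed.

Lemma cinf_continuous f : cinf f -> continuous f.
Proof. by move=> /(_ 0) cf x; exact/differentiable_continuous/derivable1_diffP. Qed.

Lemma ccinf_derive1 f : ccinf f -> ccinf (derive1 f).
Proof.
move=> [cf [M f0]]; split; first by move=> n x; rewrite -derive1Sn.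
(* The extra 1 leaves a whole neighbourhood of [x] on which [f] vanishes. *)
exists (M + 1) => x Mx; rewrite derive1E.
have : 'D_1 (cst (0 : R)) x = 'D_1 f x.
  apply: near_eq_derive; near=> y; rewrite f0//.
  have xy : `|x - y| <= 1.
    by near: y; apply: cvgr_dist_le; [exact: cvg_id|].
  rewrite -(lerD2r 1) (le_trans Mx)// -{1}(subrK y x) (le_trans (ler_normD _ _))//.
  by rewrite addrC lerD2l.
by move=> <-; rewrite derive_cst.
Unshelve. all: by end_near.
Qed.

Lemma ccinf_bounded f : ccinf f -> exists2 B : R, 0 < B & forall x, `|f x| <= B.
Proof.
move=> [cf [M f0]].
have [M0|M0] := ltP M 0.
  by exists 1 => // x; rewrite f0 ?normr0// (le_trans (ltW M0)).
have MM : - M <= M by rewrite ge0_cp.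
have cfM : {within `[- M, M], continuous (fun x => `|f x|)}.
  apply: continuous_subspaceT => x.
  by apply: continuous_comp; [exact: cinf_continuous|exact: norm_continuous].
have [c _ Hc] := EVT_max MM cfM.
exists (`|f c| + 1); first by rewrite ltr_wpDl.
move=> x; have [xM|xM] := leP M `|x|; first by rewrite f0// normr0 addr_ge0.
rewrite (le_trans (Hc x _)) ?lerDl// in_itv /=.
by rewrite -ler_norml ltW.
Qed.

Lemma derive1n_reflect f (s : R) n : cinf f ->
  derive1n n (fun y => f (s - y)) = (fun y => (-1) ^+ n * derive1n n f (s - y)).
Proof.
move=> cf; elim: n => [|n IH]; first by apply/funext => y; rewrite expr0 mul1r.
rewrite derive1nS IH; apply/funext => y; rewrite derive1E.
have cfn : cinf (derive1n n f) by move=> m x; rewrite /derive1n -iterD; exact: (cf _ x).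
have ds : is_derive y 1 (fun t : R => s - t) (0 - 1).
  exact: (@is_derive_sub R R^o (fun=> s) (fun t => t) y 1 0 1
    (is_derive_cst _ _ _) (is_derive_id _ _)).
have dc := @is_derive_comp R R^o (derive1n n f) (fun t : R => s - t) _ _ _ _
   (cinf_is_derive (s - y) cfn) ds.
have [_ ->] := is_derive_scale ((-1) ^+ n) dc.
by rewrite sub0r mulrN1 mulrN exprS mulN1r mulNr.
Qed.

Lemma ccinf_reflect f (s : R) : ccinf f -> ccinf (fun y => f (s - y)).
Proof.
move=> [cf [M f0]]; split; last first.
  exists (M + `|s|) => y My; apply: f0.
  by rewrite distrC (le_trans _ (lerB_dist _ _))// lerBrDr.
move=> n x; rewrite derive1n_reflect//.
have cfn : cinf (derive1n n f) by move=> m y; rewrite /derive1n -iterD; exact: (cf _ y).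
have ds : is_derive x 1 (fun t : R => s - t) (0 - 1).
  exact: (@is_derive_sub R R^o (fun=> s) (fun t => t) x 1 0 1
    (is_derive_cst _ _ _) (is_derive_id _ _)).
have dc := @is_derive_comp R R^o (derive1n n f) (fun t : R => s - t) _ _ _ _
   (cinf_is_derive (s - x) cfn) ds.
by have [] := is_derive_scale ((-1) ^+ n) dc.
Qed.

End SmoothFunctions.

Section Bump.
Variable R : realType.
Local Notation mu := (@lebesgue_measure R).

(* Closed under differentiation, which makes its members smooth. *)
Inductive flat_alg : (R -> R) -> Prop :=
| flat_alg_base n (c d : R) : flat_alg (fun t => flat n (c + d * t))
| flat_alg_add f g : flat_alg f -> flat_alg g -> flat_alg (fun t => f t + g t)
| flat_alg_mul f g : flat_alg f -> flat_alg g -> flat_alg (fun t => f t * g t)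
| flat_alg_scale (c : R) f : flat_alg f -> flat_alg (fun t => c * f t).

Lemma flat_alg_cinf f : flat_alg f -> cinf f.
Proof.
apply: (@cinf_closed _ flat_alg) => {f} f.
elim=> {f} [n c d|f g _ [f' Pf df] _ [g' Pg dg]|f g Pf [f' Pf' df] Pg [g' Pg' dg]
           |c f _ [f' Pf df]].
- exists (fun t => d * (flat n.+2 (c + d * t) + (- n%:R) * flat n.+1 (c + d * t))).
    apply: flat_alg_scale; apply: flat_alg_add; first exact: flat_alg_base.
    exact/flat_alg_scale/flat_alg_base.
  move=> t.
  have da : is_derive t 1 (fun t : R => c + d * t) (0 + d * 1).
    exact: (@is_derive_add R R^o (fun=> c) (fun t => d * t)).
  have := @is_derive_comp R R^o (flat n) (fun t : R => c + d * t) _ _ _ _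
   (is_derive_flat n (c + d * t)) da.
  by rewrite add0r mulr1 mulrC mulNr.
- exists (fun t => f' t + g' t); first exact: flat_alg_add.
  by move=> t; exact: (@is_derive_add R R^o).
- exists (fun t => f' t * g t + f t * g' t).
    by apply: flat_alg_add; exact: flat_alg_mul.
  by move=> t; exact: (@is_derive_mul R R^o).
- exists (fun t => c * f' t); first exact: flat_alg_scale.
  by move=> t; exact: (@is_derive_scale R R^o).
Qed.

Lemma flat_eq0 n (t : R) : t <= 0 -> flat n t = 0.
Proof. by move=> t0; rewrite /flat ltNge t0. Qed.

Lemma flat0_le1 (t : R) : flat 0 t <= 1.
Proof.
rewrite /flat; case: ifPn => // t0; rewrite expr0 mul1r expR_le1.
by rewrite oppr_le0 invr_ge0 ltW.
Qed.

Lemma flat0_ge (s t : R) : 0 < s -> s <= t -> flat 0 s <= flat 0 t.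
Proof.
move=> s0 st; have t0 := lt_le_trans s0 st.
by rewrite /flat s0 t0 !expr0 !mul1r ler_expR lerN2 lef_pV2.
Qed.

Definition bump n (t : R) : R := flat 0 (1 + n.+1%:R * t) * flat 0 (1 - n.+1%:R * t).

Lemma bump_cinf n : cinf (bump n).
Proof.
apply: flat_alg_cinf; apply: flat_alg_mul; first exact: flat_alg_base.
rewrite (_ : (fun t => _) = fun t => flat 0 (1 + (- n.+1%:R) * t)).
  exact: flat_alg_base.
by apply/funext => t; rewrite mulNr.
Qed.

Lemma bump_ge0 n t : 0 <= bump n t.
Proof. by rewrite mulr_ge0// flat_ge0. Qed.

Lemma bump_le1 n t : bump n t <= 1.
Proof. by rewrite mulr_ile1// ?flat_ge0// flat0_le1. Qed.

Lemma bumpN n t : bump n (- t) = bump n t.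
Proof. by rewrite /bump mulrN opprK mulrC. Qed.

Lemma bump_eq0 n t : n.+1%:R^-1 <= `|t| -> bump n t = 0.
Proof.
move=> h; have n0 : (0 : R) < n.+1%:R by [].
have {}h : 1 <= n.+1%:R * `|t| by rewrite -ler_pdivrMl// mulr1.
rewrite /bump; have [t0|t0] := leP 0 t.
  by rewrite [X in _ * X]flat_eq0 ?mulr0// subr_le0 -(ger0_norm t0).
by rewrite flat_eq0 ?mul0r// -lerBrDl sub0r lerNr -mulrN -(ltr0_norm t0).
Qed.

(** A lower bound of [bump n] on the middle half of its support, independent of [n]. It bounds the
    normalizing integral from below by a constant times the width. *)
Definition bump_lb : R := flat 0 2^-1 ^+ 2.

Lemma bump_lb_gt0 : 0 < bump_lb.
Proof. by rewrite /bump_lb exprn_gt0// /flat invr_gt0 ltr0n /= mulr_gt0 ?expR_gt0. Qed.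

Lemma bump_ge n t : `|t| <= (2 * n.+1%:R)^-1 -> bump_lb <= bump n t.
Proof.
move=> h; have n0 : (0 : R) < n.+1%:R by [].
have : `|n.+1%:R * t| <= 2^-1.
  rewrite normrM gtr0_norm// -ler_pdivlMl//.
  by rewrite -invfM mulrC.
rewrite ler_norml => /andP[h1 h2].
rewrite /bump_lb expr2 ler_pM ?flat_ge0//; apply: flat0_ge => //; lra.
Qed.

Lemma bump_continuous n : continuous (bump n).
Proof. exact/cinf_continuous/bump_cinf. Qed.

Lemma measurable_bump n : measurable_fun setT (bump n).
Proof. apply: continuous_measurable_fun; exact: bump_continuous. Qed.

Lemma integral_bump n :
  ((bump_lb / n.+1%:R)%:E <= \int[mu]_t (bump n t)%:E < +oo)%E.
Proof.
have mE : measurable_fun setT (fun t => (bump n t)%:E).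
  by apply/measurable_EFinP; exact: measurable_bump.
have n0 : (0 : R) < n.+1%:R by [].
apply/andP; split.
- pose h := ((2 * n.+1%:R)^-1 : R).
  have h0 : 0 < h by rewrite invr_gt0 mulr_gt0.
  apply: (@le_trans _ _ (\int[mu]_(t in `[(- h)%R, h]) (bump_lb)%:E)%E).
    rewrite integral_cst//= lebesgue_measure_itv /= lte_fin gtrN//.
    rewrite -EFinD -EFinM lee_fin opprK.
    have -> : h + h = n.+1%:R^-1 by rewrite /h invfM; field; rewrite gt_eqF//.
    by [].
  apply: (@le_trans _ _ (\int[mu]_(t in `[(- h)%R, h]) (bump n t)%:E)%E).
    apply: ge0_le_integral => //.
    + by move=> *; rewrite lee_fin ltW// bump_lb_gt0.
    + exact: measurable_funTS.
    + move=> t /=; rewrite in_itv /= -ler_norml => th.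
      by rewrite lee_fin bump_ge.
  apply: ge0_subset_integral => //.
  by move=> t _; rewrite lee_fin bump_ge0.
- apply: (@le_lt_trans _ _ (\int[mu]_(t in `[(-1)%R, 1%R]) (1 : \bar R))%E).
    apply: (@le_trans _ _ (\int[mu]_(t in `[(-1)%R, 1%R]) (bump n t)%:E)%E).
      rewrite [leRHS]integral_mkcond; apply: ge0_le_integral => //.
      + by move=> *; rewrite lee_fin bump_ge0.
      + exact: (measurable_restrictT _ _).1 (measurable_funTS mE).
      + move=> t _; rewrite patchE; case: ifPn => // tn.
        rewrite bump_eq0//; move: tn; rewrite notin_setE /= in_itv /= -ler_norml.
        move/negP; rewrite -ltNge => /ltW; apply: le_trans.
        by rewrite invf_le1// ler1n.
    apply: ge0_le_integral => //.
    + by move=> *; rewrite lee_fin bump_ge0.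
    + exact: measurable_funTS.
    + by move=> t _; rewrite lee_fin bump_le1.
  rewrite integral_cst//= lebesgue_measure_itv /= lte_fin.
  by case: ifP => _; rewrite ?mule0 ?mul1e// -EFinB ltry.
Qed.

Definition moll n (t : R) : R := bump n t / fine (\int[mu]_t (bump n t)%:E)%E.

Let Z n := fine (\int[mu]_t (bump n t)%:E)%E.

Let ZE n : (Z n)%:E = (\int[mu]_t (bump n t)%:E)%E.
Proof.
have /andP[h1 h2] := integral_bump n.
rewrite /Z fineK// ge0_fin_numE// integral_ge0// => t _.
by rewrite lee_fin bump_ge0.
Qed.

Let Zge n : bump_lb / n.+1%:R <= Z n.
Proof. by have /andP[h1 _] := integral_bump n; rewrite -lee_fin ZE. Qed.

Let Zgt0 n : 0 < Z n.
Proof. by rewrite (lt_le_trans _ (Zge n))// divr_gt0// bump_lb_gt0. Qed.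

Lemma moll_ge0 n t : 0 <= moll n t.
Proof. by rewrite divr_ge0// ?bump_ge0// ltW// Zgt0. Qed.

Lemma moll_ccinf n : ccinf (moll n).
Proof.
split; last first.
  by exists n.+1%:R^-1 => t h; rewrite /moll bump_eq0// mul0r.
apply: flat_alg_cinf.
rewrite (_ : moll n = fun t => (Z n)^-1 *
    (flat 0 (1 + n.+1%:R * t) * flat 0 (1 + (- n.+1%:R) * t))); last first.
  by apply/funext => t; rewrite /moll mulrC mulNr.
apply/flat_alg_scale/flat_alg_mul; exact: flat_alg_base.
Qed.

Lemma moll_eq0 n t : n.+1%:R^-1 <= `|t| -> moll n t = 0.
Proof. by move=> h; rewrite /moll bump_eq0// mul0r. Qed.

Lemma mollN n t : moll n (- t) = moll n t.
Proof. by rewrite /moll bumpN. Qed.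

(** A height of at most a constant over the width is what lets averages over shrinking balls
    dominate the mollification at a Lebesgue point. *)
Lemma moll_le n t : moll n t <= n.+1%:R / bump_lb.
Proof.
rewrite /moll -/(Z n) (le_trans (ler_pM _ _ (bump_le1 _ _) (lexx _)))//.
- exact: bump_ge0.
- by rewrite invr_ge0 ltW.
rewrite mul1r -[leRHS]invrK lef_pV2 ?posrE ?invr_gt0 ?divr_gt0 ?bump_lb_gt0//.
by rewrite invf_div.
Qed.

Lemma integral_moll n : (\int[mu]_t (moll n t)%:E = 1)%E.
Proof.
have E t : (moll n t)%:E = ((Z n)^-1%:E * (bump n t)%:E)%E.
  by rewrite -EFinM mulrC.
under eq_integral do rewrite E.
rewrite ge0_integralZl//.
- by rewrite -ZE -EFinM mulVf// gt_eqF.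
- by apply/measurable_EFinP; exact: measurable_bump.
- by move=> t _; rewrite lee_fin bump_ge0.
- by rewrite lee_fin invr_ge0 ltW.
Qed.

End Bump.

(** * Integration along coordinate directions *)

Section LineIntegral.
Variable R : realType.
Local Notation mu := (@lebesgue_measure R).

(** Markov's inequality: an integrable function cannot exceed [e] throughout sets of unbounded
    measure. This supplies endpoints at which boundary terms are small, without any decay
    assumption. *)
Lemma integrable_small_value (f : R -> R) (A : nat -> set (measurableTypeR R)) (e : R) :
  0 < e -> mu.-integrable setT (EFin \o f) ->
  (forall k, measurable (A k)) ->
  (forall k, (k%:R%:E <= mu (A k))%E) ->
  exists k t, A k t /\ `|f t| <= e.
Proof.
move=> e0 /integrableP[mf fi] mA Ak.
apply: contrapT => H.
have fA k t : A k t -> e <= `|f t|.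
  move=> At; rewrite leNgt; apply/negP => /ltW fe; apply: H.
  by exists k, t.
have mnf : measurable_fun setT (fun t => `|(f t)%:E|%E) by exact: measurableT_comp.
have I0 : (0 <= \int[mu]_t `|(f t)%:E|)%E by exact: integral_ge0.
pose I := fine (\int[mu]_t `|(f t)%:E|)%E.
have IE : (\int[mu]_t `|(f t)%:E|)%E = I%:E.
  by rewrite /I fineK// ge0_fin_numE.
have HI k : e * k%:R <= I.
  rewrite -lee_fin -IE EFinM.
  apply: (@le_trans _ _ (e%:E * mu (A k))%E).
    by apply: lee_wpmul2l => //; rewrite lee_fin ltW.
  rewrite -integral_cst//.
  apply: (@le_trans _ _ (\int[mu]_(t in A k) `|(f t)%:E|)%E).
    apply: ge0_le_integral => //.
    - by move=> *; rewrite /= lee_fin ltW.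
    - exact: measurable_funTS.
    - by move=> t At /=; rewrite lee_fin (fA k).
  exact: ge0_subset_integral.
have := HI (Num.truncn (I / e)).+1.
rewrite -ler_pdivlMl// mulrC leNgt.
by rewrite truncnS_gt// divr_ge0// ?ltW// -lee_fin -IE.
Qed.

(** On long intervals beyond n + 1 and below - (n + 1) there are points where |f| <= 1 / (n + 1).
    The fundamental theorem between two such points and dominated convergence give the result. *)
Lemma integral_derivative_eq0 (f f' : R -> R) :
  (forall t : R, is_derive t 1 f (f' t)) -> continuous f' ->
  mu.-integrable setT (EFin \o f) -> mu.-integrable setT (EFin \o f') ->
  (\int[mu]_t (f' t)%:E = 0)%E.
Proof.
move=> df cf' fi f'i.
have /choice[t Ht] : forall n, exists t : R, n.+1%:R <= t /\ `|f t| <= n.+1%:R^-1.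
  move=> n.
  have [||k|k [t [At ft]]] := @integrable_small_value f
    (fun k => `[n.+1%:R, (n.+1 + k)%:R]%classic) n.+1%:R^-1 _ fi.
  - by rewrite invr_gt0.
  - by move=> k; exact: measurable_itv.
  - rewrite /= lebesgue_measure_itv /= lte_fin.
    case: ifPn; first by rewrite -EFinB lee_fin (natrD _ n.+1 k) addrAC subrr add0r.
    by rewrite ltr_nat -leqNgt -[leqRHS]addn0 leq_add2l leqn0 => /eqP ->.
  - by exists t; move: At; rewrite /= in_itv /= => /andP[].
have /choice[s Hs] : forall n, exists t : R, t <= - n.+1%:R /\ `|f t| <= n.+1%:R^-1.
  move=> n.
  have [||k|k [x [Ax fx]]] := @integrable_small_value f
    (fun k => `[- (n.+1 + k)%:R, - n.+1%:R]%classic) n.+1%:R^-1 _ fi.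
  - by rewrite invr_gt0.
  - by move=> k; exact: measurable_itv.
  - rewrite /= lebesgue_measure_itv /= lte_fin ltrN2.
    case: ifPn; first by rewrite -EFinB lee_fin (natrD _ n.+1 k) opprK addKr.
    by rewrite ltr_nat -leqNgt -[leqRHS]addn0 leq_add2l leqn0 => /eqP ->.
  - by exists x; move: Ax; rewrite /= in_itv /= => /andP[].
have st n : s n < t n.
  have [tn _] := Ht n; have [sn _] := Hs n.
  by rewrite (le_lt_trans sn)// (lt_le_trans _ tn)// (@lt_trans _ _ 0)// oppr_lt0.
have cf : continuous f.
  by move=> x; apply/differentiable_continuous/derivable1_diffP; case: (df x).
have FTC n : (\int[mu]_(x in `[s n, t n]) (f' x)%:E = (f (t n) - f (s n))%:E)%E.
  rewrite EFinB; apply: continuous_FTC2 => //.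
  - exact: continuous_subspaceT.
  - split.
    + by move=> x _; case: (df x).
    + by apply: cvg_at_right_filter; exact: cf.
    + by apply: cvg_at_left_filter; exact: cf.
  - by move=> x _; rewrite derive1E; case: (df x).
pose g n : R -> \bar R := (EFin \o f') \_ `[s n, t n].
have mf' : measurable_fun setT (EFin \o f') by have /integrableP[] := f'i.
have [] := @dominated_convergence _ _ _ mu setT measurableT g (EFin \o f')
   (fun x => `|(f' x)%:E|%E).
- by move=> n; apply: (measurable_restrictT _ _).1 => //; exact: measurable_funTS.
- by [].
- apply: aeW => x _.
  apply: cvg_near_cst; near=> n; rewrite /g patchE mem_set//= in_itv /=.
  have [tn _] := Ht n; have [sn _] := Hs n.
  have xn : `|x| <= n.+1%:R.
    apply: (@le_trans _ _ n%:R); last by rewrite ler_nat.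
    by near: n; exact: nbhs_infty_ger.
  move: xn; rewrite ler_norml => /andP[x1 x2].
  by rewrite (le_trans sn x1) (le_trans x2 tn).
- exact: integrable_abse.
- apply: aeW => x n _; rewrite /g patchE; case: ifP => // _.
  by rewrite abse0.
move=> _ _ H.
have H0 : [sequence (\int[mu]_x g n x)%E]_n @ \oo --> (0 : \bar R).
  have E : [sequence (\int[mu]_x g n x)%E]_n = (fun n => (f (t n) - f (s n))%:E).
    by apply/funext => n /=; rewrite -FTC [RHS]integral_mkcond.
  rewrite E; apply: cvg_EFin; first exact: nearW.
  apply/cvgrPdist_le => e e0; near=> n.
  rewrite sub0r normrN (le_trans (ler_normB _ _))//.
  have [_ tn] := Ht n; have [_ sn] := Hs n.
  rewrite (le_trans (lerD tn sn))//.
  have : n.+1%:R^-1 <= e / 2.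
    rewrite -[leRHS]invrK lef_pV2 ?posrE ?invr_gt0 ?divr_gt0//.
    apply: (@le_trans _ _ n%:R); last by rewrite ler_nat.
    by near: n; exact: nbhs_infty_ger.
  by move=> h; rewrite [leRHS]splitr lerD.
by rewrite -(cvg_lim _ H)// (cvg_lim _ H0).
Unshelve. all: by end_near.
Qed.

End LineIntegral.

Section Slices.
Variable R : realType.
Local Notation mu := (@lebesgue_measure R).

Definition cube1 (n : nat) : set (measurableTypeR R) := `[- n%:R, n%:R]%classic.

Lemma cube1_lty n : (mu (cube1 n) < +oo)%E.
Proof.
by rewrite /cube1 /= lebesgue_measure_itv /=; case: ifP => // _; rewrite -EFinB ltry.
Qed.
Lemma cube1E (x : R) n : (cube1 n x) = (`|x| <= n%:R) :> Prop.
Proof. by rewrite /cube1 /= in_itv /= -ler_norml. Qed.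

Definition leb2 : set (measurableTypeR R * measurableTypeR R) -> \bar R := (mu \x mu)%E.
HB.instance Definition _ := Measure.on leb2.

Lemma leb2_sigma_finite : sigma_finite setT leb2.
Proof.
exists (fun n => cube1 n `*` cube1 n).
  apply/esym; rewrite -subTset => -[x y] _.
  have [n xn] : exists n : nat, Num.max `|x| `|y| <= n%:R.
    by exists (Num.truncn (Num.max `|x| `|y|)).+1; rewrite ltW// truncnS_gt.
  by exists n => //; split; rewrite /= cube1E (le_trans _ xn)// le_max lexx ?orbT.
move=> n; split; first by apply: measurableX; exact: measurable_itv.
have m1 : measurable (cube1 n) by exact: measurable_itv.
rewrite [X in (X < _)%E](product_measure1E mu mu m1 m1).
by rewrite lte_mul_pinfty ?cube1_lty// ge0_fin_numE ?cube1_lty.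
Qed.
HB.instance Definition _ := Measure_isSigmaFinite.Build _ _ _ leb2 leb2_sigma_finite.

Lemma lebesgue3_sigma_finite : sigma_finite setT (@lebesgue3 R).
Proof.
exists (fun n => (cube1 n `*` cube1 n) `*` cube1 n).
  apply/esym; rewrite -subTset => -[[x y] z] _.
  have [n xn] : exists n : nat, Num.max `|x| (Num.max `|y| `|z|) <= n%:R.
    by exists (Num.truncn (Num.max `|x| (Num.max `|y| `|z|))).+1; rewrite ltW// truncnS_gt.
  by exists n => //; split; [split|]; rewrite /= cube1E (le_trans _ xn)// !le_max lexx ?orbT.
have m1 n : measurable (cube1 n) by exact: measurable_itv.
move=> n; split; first by apply: measurableX => //; exact: measurableX.
have m2 : measurable (cube1 n `*` cube1 n) by exact: measurableX.
rewrite [X in (X < _)%E](product_measure1E leb2 mu m2 (m1 n)) [X in (X * _)%E](product_measure1E mu mu (m1 n) (m1 n)).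
have f : mu (cube1 n) \is a fin_num by rewrite ge0_fin_numE ?cube1_lty.
by rewrite lte_mul_pinfty ?cube1_lty ?mule_ge0// fin_numM.
Qed.
HB.instance Definition _ := Measure_isSigmaFinite.Build _ _ _ (@lebesgue3 R) lebesgue3_sigma_finite.

Local Notation mu2 := leb2.
Local Notation mu3 := (@lebesgue3 R).

Lemma integral_moll_shift n (s : R) : (\int[mu]_t (moll n (s - t))%:E = 1)%E.
Proof.
have d (x : R) : is_derive x 1 (fun t : R => t - s) (1 - 0).
  exact: (@is_derive_sub R R^o (fun t => t) (fun=> s)).
have d1 : (fun t : R => t - s)^`()%classic = cst 1.
  by apply/funext => x; rewrite derive1E; have [_ ->] := d x; rewrite subr0.
rewrite -(integral_moll R n).
(* As [moll] is even, the increasing substitution t - s replaces the decreasing s - t. *)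
rewrite (@increasing_ge0_integration_by_substitutionT _ (fun t : R => t - s) (@moll R n)).
- by apply: eq_integral => t _; rewrite d1 /= mulr1 -mollN opprB.
- by move=> x y xy; rewrite ltrD2r.
- by rewrite d1; exact: cst_continuous.
- by rewrite d1; exact: is_cvg_cst.
- by rewrite d1; exact: is_cvg_cst.
- by move=> x; case: (d x).
- exact: cvg_addrr_Ny.
- exact: cvg_addrr.
- by apply: cinf_continuous; case: (moll_ccinf R n).
- exact: moll_ge0.
Qed.

(** [ins k], [coor k] and [rest k] split R^3 into a line in direction [k] and a plane, uniformly in
    [k], so that each fact on the line serves in all three directions. *)
Definition ins (k : 'I_3) (t : R) (y : R * R) : R3 R :=
  match val k with
  | 0 => (t, y.1, y.2)
  | 1 => (y.1, t, y.2)
  | _ => (y.1, y.2, t)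
  end.

Definition coor (k : 'I_3) (x : R3 R) : R :=
  match val k with 0 => x.1.1 | 1 => x.1.2 | _ => x.2 end.

Definition rest (k : 'I_3) (x : R3 R) : R * R :=
  match val k with 0 => (x.1.2, x.2) | 1 => (x.1.1, x.2) | _ => x.1 end.

Lemma ins_coor k x : ins k (coor k x) (rest k x) = x.
Proof. by case: x => -[x y] z; rewrite /ins /coor /rest; case: (val k) => [|[|]]. Qed.

Lemma ins_basis k h t y : h *: basis3 R k + ins k t y = ins k (h + t) y.
Proof.
have E (a b c t' y' z' : R) : h *: ((a, b, c) : R3 R) + (t', y', z') =
  (h * a + t', h * b + y', h * c + z') by [].
by case: y => y z; rewrite /ins /basis3; case: k => [[|[|[|]]]] //= _;
  rewrite E ?mulr0 ?mulr1 ?add0r.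
Qed.

Lemma is_derive_ins k (f : R3 R -> R) t y (df : R) :
  is_derive (ins k t y) (basis3 R k) f df <->
  is_derive t 1 (fun s => f (ins k s y)) df.
Proof.
rewrite is_derive_line [X in _ <-> X](@is_derive_line R R^o).
have -> // : (fun h : R => f (h *: basis3 R k + ins k t y)) =
             (fun h : R => f (ins k (h *: 1 + t) y)).
by apply/funext => h; rewrite ins_basis [_%:A]mulr1.
Qed.

Lemma measurable_coor k : measurable_fun [set: mR3 R] (coor k).
Proof.
rewrite /coor; case: (val k) => [|[|n]].
- exact: (measurableT_comp measurable_fst measurable_fst).
- exact: (measurableT_comp measurable_snd measurable_fst).
- exact: measurable_snd.
Qed.

Lemma measurable_fst_fst : measurable_fun [set: mR3 R] (fun z : mR3 R => z.1.1).
Proof. exact: (measurableT_comp measurable_fst measurable_fst). Qed.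

Lemma measurable_snd_fst : measurable_fun [set: mR3 R] (fun z : mR3 R => z.1.2).
Proof. exact: (measurableT_comp measurable_snd measurable_fst). Qed.

Lemma measurable_ins_pair k : measurable_fun [set: mR3 R]
  (fun z : mR3 R => ins k z.2 z.1 : mR3 R).
Proof.
have m11 := measurable_fst_fst; have m12 := measurable_snd_fst.
have m2 : measurable_fun [set: mR3 R] (fun z : mR3 R => z.2).
  exact: measurable_snd.
rewrite /ins; case: (val k) => [|[|n]];
  by do 2 (apply/measurable_fun_pair => //=).
Qed.

Lemma measurable_ins_comp d (T : measurableType d) k (f : mR3 R -> T) :
  measurable_fun [set: mR3 R] f ->
  measurable_fun [set: mR3 R] (fun z : mR3 R => f (ins k z.2 z.1)).
Proof. by move=> mf; exact: (measurableT_comp mf (measurable_ins_pair k)). Qed.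

Lemma measurable_ins d (T : measurableType d) k (f : mR3 R -> T) y :
  measurable_fun [set: mR3 R] f ->
  measurable_fun [set: measurableTypeR R] (fun t : measurableTypeR R => f (ins k t y)).
Proof.
by move=> mf; exact: (measurableT_comp (measurable_ins_comp k mf) (measurable_pair1 y)).
Qed.

Lemma tonelli_ins k (f : mR3 R -> \bar R) :
  measurable_fun [set: mR3 R] f -> (forall x, 0 <= f x)%E ->
  (\int[mu3]_x f x = \int[mu2]_y \int[mu]_t f (ins k t y))%E.
Proof.
move=> mf f0.
have mfk := measurable_ins_comp k mf.
have mG := measurable_fun_fubini_tonelli_F (m2 := mu) _ mfk (fun z => f0 _).
have G0 y : (0 <= \int[mu]_t f (ins k t y))%E by exact: integral_ge0.
have E0 : (\int[mu3]_x f x = \int[mu]_z \int[mu2]_p f (p, z))%E.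
  exact: (@fubini_tonelli2 _ _ _ _ _ mu2 mu f mf f0).
have E2 (g : measurableTypeR R * measurableTypeR R -> \bar R) :
    measurable_fun setT g -> (forall p, 0 <= g p)%E ->
    (\int[mu2]_p g p = \int[mu]_z \int[mu]_x g (x, z))%E.
  by move=> mg g0; exact: (@fubini_tonelli2 _ _ _ _ _ mu mu g mg g0).
have E1 (g : measurableTypeR R * measurableTypeR R -> \bar R) :
    measurable_fun setT g -> (forall p, 0 <= g p)%E ->
    (\int[mu2]_p g p = \int[mu]_x \int[mu]_z g (x, z))%E.
  by move=> mg g0; exact: (@fubini_tonelli1 _ _ _ _ _ mu mu g mg g0).
have mz z : measurable_fun [set: measurableTypeR R * measurableTypeR R]
    (fun p => f (p, z)).
  exact: (measurableT_comp mf (measurable_pair2 z)).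
(* For k = 2 this is Tonelli for the outer product. Otherwise the third coordinate is integrated
   last on both sides, and Tonelli in the plane puts the line of direction [k] innermost. *)
case: k mfk mG G0 => -[|[|[|]]] //= kP mfk mG G0.
- rewrite E0 (E2 _ mG G0); apply: eq_integral => z _; exact: E2.
- rewrite E0 (E2 _ mG G0); apply: eq_integral => z _; exact: E1.
- have -> := @fubini_tonelli1 _ _ _ _ _ mu2 mu f mf f0.
  by apply: eq_integral => -[y z] _.
Qed.

(** Moving coordinate [k] to the end is a permutation of the coordinates and preserves the measure.
    Fubini in direction [k] for signed functions thereby reduces to the outer product structure. *)
Lemma integral_ins k (f : mR3 R -> \bar R) :
  measurable_fun [set: mR3 R] f -> (forall x, 0 <= f x)%E ->
  (\int[mu3]_x f x = \int[mu3]_z f (ins k z.2 z.1))%E.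
Proof.
move=> mf f0; rewrite (tonelli_ins k mf f0).
exact/esym/(@fubini_tonelli1 _ _ _ _ _ mu2 mu _ (measurable_ins_comp k mf)).
Qed.

Lemma integrable_ins k (f : mR3 R -> \bar R) :
  mu3.-integrable [set: mR3 R] f ->
  mu3.-integrable [set: mR3 R] (fun z : mR3 R => f (ins k z.2 z.1)).
Proof.
move=> /integrableP[mf fi]; apply/integrableP; split.
  exact: measurable_ins_comp.
rewrite -(@integral_ins k (fun x => `|f x|%E))//.
exact: measurableT_comp.
Qed.

Lemma fubini_ins k (f : mR3 R -> \bar R) :
  mu3.-integrable [set: mR3 R] f ->
  (\int[mu3]_x f x = \int[mu2]_y \int[mu]_t f (ins k t y))%E.
Proof.
move=> fi; have fik := integrable_ins k fi.
transitivity (\int[mu3]_z f (ins k z.2 z.1))%E; last first.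
  exact/esym/(@integral12_prod_meas1 _ _ _ _ _ mu2 mu _ fik).
have /integrableP[mf _] := fi.
rewrite integralE [RHS]integralE.
rewrite (@integral_ins k f^\+%E); [|exact: measurable_funepos|by []].
rewrite (@integral_ins k f^\-%E); [|exact: measurable_funeneg|by []].
by congr (_ - _)%E; apply: eq_integral => z _; rewrite ?funeposE ?funenegE.
Qed.

Lemma ae_integrable_ins k (f : mR3 R -> \bar R) :
  mu3.-integrable [set: mR3 R] f ->
  {ae mu2, forall y, mu.-integrable setT (fun t => f (ins k t y))}.
Proof.
move=> /(integrable_ins k) fik.
exact: (@ae_integrable1 _ _ _ _ _ mu2 mu _ fik).
Qed.

(** [G] and [G'] are integrable on almost every line of direction [k], where the derivative
    integrates to 0. Derivability of [G'] gives the continuity along lines that the fundamental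
    theorem asks for. *)
Lemma integral_partial_eq0 k (G G' : R3 R -> R) :
  mu3.-integrable [set: mR3 R] (EFin \o G) ->
  mu3.-integrable [set: mR3 R] (EFin \o G') ->
  (forall x, is_derive x (basis3 R k) G (G' x)) ->
  (forall x, derivable G' x (basis3 R k)) ->
  (\int[mu3]_x (G' x)%:E = 0)%E.
Proof.
move=> Gi G'i dG dG'.
rewrite (@fubini_ins k (EFin \o G'))//.
have H : {ae mu2, forall y, (\int[mu]_t (G' (ins k t y))%:E = 0)%E}.
  have := ae_integrable_ins k Gi.
  apply: filter_app; first exact: (ae_filter_ringOfSetsType mu2).
  have := ae_integrable_ins k G'i.
  apply: filterS; first exact: (ae_filter_ringOfSetsType mu2).
  move=> y i' i.
  apply: (@integral_derivative_eq0 _ (fun t => G (ins k t y))) => //.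
    by move=> t; apply/is_derive_ins; exact: dG.
  move=> t; apply/differentiable_continuous/derivable1_diffP.
  have /derivableP := dG' (ins k t y).
  by move=> /is_derive_ins[].
rewrite (ae_eq_integral (cst 0%E)) ?integral0//; last first.
  move: H; apply: filterS; first exact: (ae_filter_ringOfSetsType mu2).
  by move=> y /= H _.
exact: (@measurable_fubini_F _ _ _ _ _ mu2 mu _ (integrable_ins k G'i)).
Qed.

End Slices.

(** * Tensor products of test functions of one variable *)

Section TensorProducts.
Variable R : realType.
Local Notation mu := (@lebesgue_measure R).
Local Notation mu2 := (mu \x mu)%E.
Local Notation mu3 := (@lebesgue3 R).
Implicit Types f h : 'I_3 -> R -> R.

Definition prod3 h (y : R3 R) : R := h 0 y.1.1 * h 1 y.1.2 * h 2 y.2.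

(** The partial derivative at the level of the factors: iterated derivatives of tensor products
    remain tensor products, and their commutation is immediate. *)
Definition derive_at (k : 'I_3) h (i : 'I_3) : R -> R :=
  if i == k then derive1 (h i) else h i.

Lemma ccinf_derive_at k h :
  (forall i, ccinf (h i)) -> forall i, ccinf (derive_at k h i).
Proof. by move=> ch i; rewrite /derive_at; case: ifP => _ //; exact: ccinf_derive1. Qed.

Lemma derive_atC j k h : derive_at j (derive_at k h) = derive_at k (derive_at j h).
Proof.
apply/funext => i; rewrite /derive_at.
by case: (i == j); case: (i == k).
Qed.

Lemma is_derive_prod3 k h x : (forall i, ccinf (h i)) ->
  is_derive x (basis3 R k) (prod3 h) (prod3 (derive_at k h) x).
Proof.
move=> ch; rewrite -(ins_coor k x); apply/is_derive_ins.
set t := coor k x; set y := rest k x.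
have dk : is_derive t 1 (h k) (derive1 (h k) t).
  by apply: cinf_is_derive; case: (ch k).
pose c := (match val k with 0 => h 1 y.1 * h 2 y.2 | 1 => h 0 y.1 * h 2 y.2
   | _ => h 0 y.1 * h 1 y.2 end).
have -> : (fun s => prod3 h (ins k s y)) = (fun s => c * h k s).
  apply/funext => s; rewrite /prod3 /ins /c.
  by case: (k) => -[|[|[|]]]//= kP;
    [have -> : Ordinal kP = 0 by exact/val_inj |
     have -> : Ordinal kP = 1 by exact/val_inj |
     have -> : Ordinal kP = 2 by exact/val_inj]; ring.
have -> : prod3 (derive_at k h) (ins k t y) = c * derive1 (h k) t.
  rewrite /prod3 /ins /c /derive_at {dk}.
  by case: (k) => -[|[|[|]]]//= kP;
    [have -> : Ordinal kP = 0 by exact/val_inj |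
     have -> : Ordinal kP = 1 by exact/val_inj |
     have -> : Ordinal kP = 2 by exact/val_inj] => /=; ring.
exact: (@is_derive_scale R R^o).
Qed.

Lemma continuous_prod3 h : (forall i, continuous (h i)) -> continuous (prod3 h).
Proof.
move=> ch x; rewrite /prod3.
apply: (@continuousM _ _ (fun y : R3 R => h 0 y.1.1 * h 1 y.1.2) (fun y : R3 R => h 2 y.2)).
  apply: (@continuousM _ _ (fun y : R3 R => h 0 y.1.1) (fun y : R3 R => h 1 y.1.2)).
    apply: (@continuous_comp _ _ _ (fun y : R3 R => y.1.1) (h 0)); last exact: ch.
    by apply: (@continuous_comp _ _ _ fst fst); exact: cvg_fst.
  apply: (@continuous_comp _ _ _ (fun y : R3 R => y.1.2) (h 1)); last exact: ch.
  by apply: (@continuous_comp _ _ _ fst snd); [exact: cvg_fst|exact: cvg_snd].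
by apply: (@continuous_comp _ _ _ snd (h 2)); [exact: cvg_snd|exact: ch].
Qed.

Lemma partial_prod3 k h : (forall i, ccinf (h i)) ->
  partial k (prod3 h) = prod3 (derive_at k h).
Proof.
by move=> ch; apply/funext => x; rewrite /partial; case: (is_derive_prod3 k x ch).
Qed.

Lemma prod3_test_function h : (forall i, ccinf (h i)) -> test_function (prod3 h).
Proof.
move=> ch; split.
  move=> s.
  have [h' ch' ->] : exists2 h', (forall i, ccinf (h' i)) & partials s (prod3 h) = prod3 h'.
    elim: s => [|k s [h' ch' /= ->]]; first by exists h.
    by exists (derive_at k h'); [exact: ccinf_derive_at|exact: partial_prod3].
  split; first by apply: continuous_prod3 => i; apply: cinf_continuous; case: (ch' i).
  by move=> k x; case: (is_derive_prod3 k x ch').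
have [M hM] : exists M : R, forall i t, M <= `|t| -> h i t = 0.
  have [_ [M0 H0]] := ch 0; have [_ [M1 H1]] := ch 1; have [_ [M2 H2]] := ch 2.
  exists (Num.max M0 (Num.max M1 M2)) => i t.
  rewrite !ge_max => /and3P[t0 t1 t2].
  case: i => -[|[|[|]]] //= iP.
  - by rewrite (_ : Ordinal iP = 0) ?H0//; exact/val_inj.
  - by rewrite (_ : Ordinal iP = 1) ?H1//; exact/val_inj.
  - by rewrite (_ : Ordinal iP = 2) ?H2//; exact/val_inj.
pose I := `[- M, M]%classic.
have cI : compact I by exact: segment_compact.
have cB : compact ((I `*` I) `*` I) by apply: compact_setX => //; exact: compact_setX.
apply: (subclosed_compact _ cB); first exact: closed_closure.
have clB : closed ((I `*` I) `*` I).
  by apply: compact_closed cB; exact: norm_hausdorff.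
rewrite [X in _ `<=` X]((closure_id _).1 clB).
apply: closureS => x /=; rewrite /prod3 => hx.
have Hi i t : h i t != 0 -> I t.
  move=> /eqP hit; rewrite /I /= in_itv /= -ler_norml leNgt; apply/negP => /ltW.
  by move=> Mt; apply: hit; exact: hM.
move: hx; rewrite !mulf_eq0 !negb_or => /andP[/andP[h0 h1] h2].
by split; [split|]; apply: Hi; [exact: h0|exact: h1|exact: h2].
Qed.

Lemma measurable_prod3 h : (forall i, measurable_fun setT (h i)) ->
  measurable_fun [set: mR3 R] (prod3 h).
Proof.
move=> mh; apply: measurable_funM; last exact: (measurableT_comp (mh 2) measurable_snd).
apply: measurable_funM; first exact: (measurableT_comp (mh 0) (@measurable_fst_fst R)).
exact: (measurableT_comp (mh 1) (@measurable_snd_fst R)).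
Qed.

Lemma integral_prod3 h : (forall i, measurable_fun setT (h i)) ->
  (forall i t, 0 <= h i t) ->
  (\int[mu3]_y (prod3 h y)%:E = \int[mu]_t (h 0 t)%:E * \int[mu]_t (h 1 t)%:E
    * \int[mu]_t (h 2 t)%:E)%E.
Proof.
move=> mh h0.
have mhE i : measurable_fun [set: measurableTypeR R] (fun t : measurableTypeR R => (h i t)%:E).
  by apply/measurable_EFinP; exact: mh.
have hE0 i t : (0 <= (h i t)%:E)%E by rewrite lee_fin.
have I0 i : (0 <= \int[mu]_t (h i t)%:E)%E by apply: integral_ge0 => t _; rewrite lee_fin.
rewrite (@tonelli_ins _ 2 (EFin \o prod3 h)); last 2 first.
- by apply/measurable_EFinP; exact: measurable_prod3.
- by move=> x; rewrite lee_fin /prod3 !mulr_ge0.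
have E (y : R * R) : (\int[mu]_t (EFin \o prod3 h) (ins 2%R t y) =
   \int[mu]_t (h 2 t)%:E * ((h 0 y.1)%:E * (h 1 y.2)%:E))%E.
  rewrite muleC -ge0_integralZl//=; last by rewrite -EFinM lee_fin mulr_ge0.
have m1 : measurable_fun setT (fun y : measurableTypeR R * measurableTypeR R => (h 0 y.1)%:E).
  by apply/measurable_EFinP; exact: (measurableT_comp (mh 0) measurable_fst).
have m2 : measurable_fun setT (fun y : measurableTypeR R * measurableTypeR R => (h 1 y.2)%:E).
  by apply/measurable_EFinP; exact: (measurableT_comp (mh 1) measurable_snd).
have m12 := emeasurable_funM m1 m2.
under eq_integral do rewrite E.
rewrite ge0_integralZl//; last by move=> y _; rewrite -EFinM lee_fin mulr_ge0.
rewrite muleC; congr (_ * _)%E.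
have -> := @fubini_tonelli1 _ _ _ _ _ mu mu _ m12
  (fun y => mule_ge0 (hE0 0 y.1) (hE0 1 y.2)).
rewrite muleC -ge0_integralZl//; apply: eq_integral => t _.
by rewrite /fubini_F /= ge0_integralZl// muleC.
Qed.

End TensorProducts.

(** * Convolution and mollification *)

Section Convolution.
Variable R : realType.
Local Notation mu := (@lebesgue_measure R).
Local Notation mu2 := (@leb2 R).
Local Notation mu3 := (@lebesgue3 R).
Implicit Types (f : 'I_3 -> R -> R) (u g : R3 R -> R).

(** The convolution kernel f (x - y) for a tensor product. With either variable fixed it is again a
    tensor product, so its derivatives and integrals come from the line. *)
Definition ker3 f (x y : R3 R) : R :=
  f 0 (x.1.1 - y.1.1) * f 1 (x.1.2 - y.1.2) * f 2 (x.2 - y.2).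

Lemma ker3_fix1 f x : ker3 f x = prod3 (fun i t => f i (coor i x - t)).
Proof. by []. Qed.

Lemma ker3_fix2 f y : ker3 f ^~ y = prod3 (fun i s => f i (s - coor i y)).
Proof. by []. Qed.

Lemma ccinf_measurable (h : R -> R) : ccinf h ->
  measurable_fun [set: measurableTypeR R] h.
Proof.
by case=> ch _; apply: continuous_measurable_fun; exact: cinf_continuous.
Qed.

Lemma ccinf_shift (h : R -> R) c : ccinf h -> ccinf (fun s => h (s - c)).
Proof.
move=> ch; have := ccinf_reflect c (ccinf_reflect 0 ch).
by congr ccinf; apply/funext => s; rewrite sub0r opprB.
Qed.

Lemma derive1_shift (h : R -> R) c : ccinf h ->
  derive1 (fun s => h (s - c)) = (fun s => derive1 h (s - c)).
Proof.
move=> [ch _]; apply/funext => s; rewrite derive1E.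
have ds : is_derive s 1 (fun t : R => t - c) (1 - 0).
  exact: (@is_derive_sub R R^o (fun t => t) (fun=> c)).
have [_ ->] := @is_derive_comp R R^o h (fun t : R => t - c) _ _ _ _
   (cinf_is_derive (s - c) ch) ds.
by rewrite subr0 mulr1.
Qed.

Lemma derive1_reflect (h : R -> R) c : ccinf h ->
  derive1 (fun t => h (c - t)) = (fun t => - derive1 h (c - t)).
Proof.
move=> [ch _]; have := derive1n_reflect c 1 ch; rewrite !derive1n1 => ->.
by apply/funext => t; rewrite expr1 mulN1r.
Qed.

Lemma is_derive_ker3 k f x y : (forall i, ccinf (f i)) ->
  is_derive x (basis3 R k) (ker3 f ^~ y) (ker3 (derive_at k f) x y).
Proof.
move=> cf; have := @is_derive_prod3 R k (fun i s => f i (s - coor i y)) x.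
rewrite -ker3_fix2 => H; apply: is_derive_eq; first by apply: H => i; exact: ccinf_shift.
rewrite -[RHS]/((ker3 (derive_at k f) ^~ y) x) ker3_fix2.
congr (prod3 _ x); apply/funext => i; rewrite /derive_at.
by case: ifP => // _; exact: derive1_shift.
Qed.

Lemma prod3_scale_at k (c : R) f :
  prod3 (fun i => if i == k then (fun t => c * f i t) else f i) =
  (fun y => c * prod3 f y).
Proof.
apply/funext => y; rewrite /prod3.
by case: k => -[|[|[|//]]] kP /=; ring.
Qed.

Lemma partial_ker3 k f x : (forall i, ccinf (f i)) ->
  partial k (ker3 f x) = (fun y => - ker3 (derive_at k f) x y).
Proof.
move=> cf; rewrite ker3_fix1 partial_prod3; last by move=> i; exact: ccinf_reflect.
rewrite (_ : (fun y => - ker3 (derive_at k f) x y) =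
   (fun y => -1 * prod3 (fun i t => derive_at k f i (coor i x - t)) y)); last first.
  by apply/funext => y; rewrite mulN1r.
rewrite -(prod3_scale_at k); apply: (congr1 (fun F => prod3 F)); apply: funext => i; rewrite /derive_at.
case: ifP => // _; rewrite derive1_reflect//.
by apply/funext => t; rewrite mulN1r.
Qed.

Lemma ker3_test_function f x : (forall i, ccinf (f i)) -> test_function (ker3 f x).
Proof. by move=> cf; rewrite ker3_fix1; apply: prod3_test_function => i; exact: ccinf_reflect. Qed.

Lemma ker3_bounded f : (forall i, ccinf (f i)) ->
  exists2 B : R, 0 < B & forall x y, `|ker3 f x y| <= B.
Proof.
move=> cf.
have [B0 B00 H0] := ccinf_bounded (cf 0).
have [B1 B10 H1] := ccinf_bounded (cf 1).
have [B2 B20 H2] := ccinf_bounded (cf 2).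
exists (B0 * B1 * B2); first by rewrite !mulr_gt0.
by move=> x y; rewrite /ker3 !normrM !ler_pM// mulr_ge0.
Qed.

Lemma measurable_ker3 f : (forall i, ccinf (f i)) ->
  measurable_fun [set: mR3 R * mR3 R] (fun z => ker3 f z.1 z.2).
Proof.
move=> cf.
have mf i := ccinf_measurable (cf i).
have m11 := @measurable_fst_fst R; have m12 := @measurable_snd_fst R.
apply: measurable_funM; [apply: measurable_funM|].
- apply: (measurableT_comp (mf 0)); apply: measurable_funB.
    exact: (measurableT_comp m11 measurable_fst).
  exact: (measurableT_comp m11 measurable_snd).
- apply: (measurableT_comp (mf 1)); apply: measurable_funB.
    exact: (measurableT_comp m12 measurable_fst).
  exact: (measurableT_comp m12 measurable_snd).
- apply: (measurableT_comp (mf 2)); apply: measurable_funB.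
    exact: (measurableT_comp measurable_snd measurable_fst).
  exact: (measurableT_comp measurable_snd measurable_snd).
Qed.

Lemma integral_bounded_itv (h : R -> R) (c M B : R) :
  measurable_fun [set: measurableTypeR R] h -> 0 < B ->
  (forall t, `|h t| <= B) -> (forall t, M <= `|t - c| -> h t = 0) ->
  (\int[mu]_t `|h t|%:E <= (B * (2 * `|M|))%:E)%E.
Proof.
move=> mh B0 hB h0.
(* [M] may be negative; replacing it by its absolute value only enlarges the interval. *)
apply: (@le_trans _ _ (\int[mu]_(t in `[(c - `|M|)%R, (c + `|M|)%R]) B%:E)%E).
  rewrite [leRHS]integral_mkcond; apply: ge0_le_integral => //.
  - exact/measurable_EFinP/measurableT_comp.
  - exact/(measurable_restrictT _ _).1.
  - move=> t _; rewrite patchE; case: ifPn; first by rewrite lee_fin.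
    rewrite notin_setE /= in_itv /= -ler_distlC => /negP; rewrite -ltNge => Mt.
    by rewrite h0 ?normr0// distrC (le_trans _ (ltW Mt))// ler_norm.
rewrite integral_cst//= lebesgue_measure_itv /= lte_fin.
case: ifPn => _; last by rewrite mule0 lee_fin !mulr_ge0// ltW.
rewrite -EFinB -EFinM lee_fin ler_wpM2l ?(ltW B0)//.
by have -> : c + `|M| - (c - `|M|) = 2 * `|M| by ring.
Qed.

Definition ker3_L1 f (A : R) :=
  (forall x, (\int[mu3]_y `|ker3 f x y|%:E <= A%:E)%E) /\
  (forall y, (\int[mu3]_x `|ker3 f x y|%:E <= A%:E)%E).

Lemma ker3_L1_exists f : (forall i, ccinf (f i)) -> exists2 A : R, 0 < A & ker3_L1 f A.
Proof.
move=> cf.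
have H i : exists2 A : R, 0 < A &
  (forall c, (\int[mu]_t `|f i (c - t)|%:E <= A%:E)%E) /\
  (forall c, (\int[mu]_t `|f i (t - c)|%:E <= A%:E)%E).
  have [B B0 HB] := ccinf_bounded (cf i).
  have [_ [M HM]] := cf i.
  exists (B * (2 * `|M|) + 1).
    by rewrite ltr_wpDl// !mulr_ge0// ltW.
  split=> c; (apply: (@le_trans _ _ (B * (2 * `|M|))%:E); last by rewrite lee_fin lerDl).
    apply: (@integral_bounded_itv _ c) => //.
      by apply: ccinf_measurable; exact: ccinf_reflect.
    by move=> t; rewrite distrC => /HM.
  apply: (@integral_bounded_itv _ c) => //.
    by apply: ccinf_measurable; exact: ccinf_shift.
  by move=> t /HM.
have [A0 A00 [a0 b0]] := H 0; have [A1 A10 [a1 b1]] := H 1; have [A2 A20 [a2 b2]] := H 2.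
have mul3 (a b c : \bar R) : (0 <= a -> 0 <= b -> 0 <= c ->
   a <= A0%:E -> b <= A1%:E -> c <= A2%:E -> a * b * c <= (A0 * A1 * A2)%:E)%E.
  by move=> *; rewrite !EFinM !lee_pmul// mule_ge0.
have nrm (h : 'I_3 -> R -> R) : (fun y => `|prod3 h y|) = prod3 (fun i t => `|h i t|).
  by apply/funext => y; rewrite /prod3 !normrM.
have I0 (h : R -> R) : (0 <= \int[mu]_t `|h t|%:E)%E.
  by apply: integral_ge0 => t _; rewrite lee_fin.
exists (A0 * A1 * A2); first by rewrite !mulr_gt0.
split=> [x|y].
  under eq_integral do rewrite ker3_fix1 (congr1 (fun F => F _) (nrm _)).
  rewrite integral_prod3//; first exact: mul3.
  by move=> i; apply: measurableT_comp => //; apply: ccinf_measurable; exact: ccinf_reflect.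
under eq_integral do rewrite -[ker3 f _ y]/((ker3 f ^~ y) _) ker3_fix2
   (congr1 (fun F => F _) (nrm _)).
rewrite integral_prod3//; first exact: mul3.
by move=> i; apply: measurableT_comp => //; apply: ccinf_measurable; exact: ccinf_shift.
Qed.

End Convolution.

Lemma measurable_fun_Rintegral d1 d2 (T1 : measurableType d1)
    (T2 : measurableType d2) (R : realType)
    (m : {sigma_finite_measure set T2 -> \bar R}) (F : T1 * T2 -> R) :
  measurable_fun [set: T1 * T2] F ->
  measurable_fun [set: T1] (fun x => (\int[m]_y F (x, y))%R).
Proof.
move=> mF'; have mF : measurable_fun [set: T1 * T2] (EFin \o F) by exact/measurable_EFinP.
rewrite /Rintegral.
have mP := @measurable_fun_fubini_tonelli_F _ _ _ _ _ m _ (measurable_funepos mF) (funepos_ge0 _).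
have mN := @measurable_fun_fubini_tonelli_F _ _ _ _ _ m _ (measurable_funeneg mF) (funeneg_ge0 _).
have := emeasurable_funB mP mN.
set H := (X in measurable_fun _ X) => mH.
rewrite (_ : (fun x => _) = fine \o H); first exact: (measurableT_comp (fine_measurable measurableT) mH).
apply/funext => x; congr fine.
rewrite [LHS]integralE /H /fubini_F.
by congr (_ - _)%E; apply: eq_integral => y _; rewrite ?funeposE ?funenegE.
Qed.

(** * Schur's test for integral operators *)

Section Schur.
Context d (T : measurableType d) (R : realType).
Variable m : {sigma_finite_measure set T -> \bar R}.
Implicit Types (u : T -> R) (K : T -> T -> R).

Definition sq_integrable u :=
  measurable_fun [set: T] u /\ (\int[m]_x (u x ^+ 2)%:E < +oo)%E.

(** The sup bound [B] makes the integral against an L^2 function exist at every point; the bound [A]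
    on both marginals is Schur's and controls the L^2 norm. The measure is arbitrary because both
    the line and R^3 are needed. *)
Definition schur_kernel K (B A : R) := [/\ 0 < B, 0 < A,
  measurable_fun [set: T * T] (fun z => K z.1 z.2) &
  (forall x y, `|K x y| <= B) /\
  (forall x, (\int[m]_y `|K x y|%:E <= A%:E)%E) /\
  (forall y, (\int[m]_x `|K x y|%:E <= A%:E)%E)].

Definition schur K u (x : T) : R := (\int[m]_y (u y * K x y))%R.

Lemma normM_le_sqr (a b : R) : `|a * b| <= a ^+ 2 * `|b| + `|b|.
Proof.
rewrite normrM -[X in _ + X]mul1r -mulrDl ler_wpM2r//.
by rewrite -(real_normK (num_real a)); have := normr_ge0 a; nra.
Qed.

Lemma sq_integrable_sqr u : sq_integrable u ->
  m.-integrable [set: T] (fun y => (u y ^+ 2)%:E).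
Proof.
move=> [mu_ ui]; apply/integrableP; split.
  by apply/measurable_EFinP; exact: measurable_funX.
by under eq_integral do rewrite gee0_abs ?lee_fin ?sqr_ge0//.
Qed.

Section Kernel.
Variables (K : T -> T -> R) (B A : R).
Hypothesis hK : schur_kernel K B A.

Let B0 : 0 < B. Proof. by case: hK. Qed.
Let A0 : 0 < A. Proof. by case: hK. Qed.
Let mK : measurable_fun [set: T * T] (fun z => K z.1 z.2). Proof. by case: hK. Qed.
Let HB x y : `|K x y| <= B. Proof. by case: hK => _ _ _ []. Qed.
Let HA x : (\int[m]_y `|K x y|%:E <= A%:E)%E. Proof. by case: hK => _ _ _ [_ []]. Qed.
Let HA2 y : (\int[m]_x `|K x y|%:E <= A%:E)%E. Proof. by case: hK => _ _ _ [_ []]. Qed.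

Let mK1 x : measurable_fun [set: T] (K x).
Proof. exact: (measurableT_comp mK (measurable_pair1 x)). Qed.

Let mK2 y : measurable_fun [set: T] (K ^~ y).
Proof. exact: (measurableT_comp mK (measurable_pair2 y)). Qed.

Lemma kernel_integrable x : m.-integrable [set: T] (fun y => `|K x y|%:E).
Proof.
apply/integrableP; split; first by apply/measurable_EFinP; exact: measurableT_comp.
under eq_integral do rewrite gee0_abs ?lee_fin//.
by rewrite (le_lt_trans (HA x))// ltry.
Qed.

Lemma sqr_kernel_integrable u x : sq_integrable u ->
  m.-integrable [set: T] (fun y => (u y ^+ 2 * `|K x y|)%:E).
Proof.
move=> su; have := integrableZl measurableT B (sq_integrable_sqr su).
apply: le_integrable => //.
  apply/measurable_EFinP/measurable_funM.
    by apply: measurable_funX; case: su.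
  by apply: measurableT_comp => //; exact: mK1.
move=> y _; rewrite -EFinM !abse_EFin lee_fin.
rewrite (normrM (u y ^+ 2)) (ger0_norm (sqr_ge0 (u y))) normr_id.
rewrite (normrM B) (ger0_norm (sqr_ge0 (u y))) (gtr0_norm B0).
by rewrite [leLHS]mulrC ler_wpM2r ?sqr_ge0.
Qed.

Lemma schur_integrable u x : sq_integrable u ->
  m.-integrable [set: T] (fun y => (u y * K x y)%:E).
Proof.
move=> su.
have := integrableD measurableT (sqr_kernel_integrable x su) (kernel_integrable x).
apply: le_integrable => //.
  by apply/measurable_EFinP; apply: measurable_funM => //; case: su.
move=> y _; rewrite -EFinD !abse_EFin lee_fin.
exact: (le_trans (normM_le_sqr _ _) (ler_norm _)).
Qed.

Lemma schurE u x : sq_integrable u ->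
  (schur K u x)%:E = (\int[m]_y (u y * K x y)%:E)%E.
Proof.
move=> su; rewrite /schur /Rintegral fineK//.
exact: integrable_fin_num (schur_integrable x su).
Qed.

Lemma measurable_schur u : sq_integrable u ->
  measurable_fun [set: T] (schur K u).
Proof.
move=> [mu_ _]; apply: (@measurable_fun_Rintegral _ _ _ _ _ m (fun z => u z.2 * K z.1 z.2)).
by apply: measurable_funM; [exact: (measurableT_comp mu_ measurable_snd)|exact: mK].
Qed.

(** Cauchy-Schwarz for the measure |K x y| dy, of mass at most [A]: expand the integral of |K| (u -
    c)^2 where K >= 0 and of |K| (u + c)^2 where K < 0. The choice c = v / A is optimal when the
    mass equals [A]. *)
Lemma schur_sqr_le u x : sq_integrable u ->
  (((schur K u x) ^+ 2)%:E <= A%:E * \int[m]_y (u y ^+ 2 * `|K x y|)%:E)%E.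
Proof.
move=> su.
set v := schur K u x; pose c := v / A.
have i1 := sqr_kernel_integrable x su.
have i2 := kernel_integrable x.
have i3 := schur_integrable x su.
have fin1 := integrable_fin_num measurableT i1.
have fin2 := integrable_fin_num measurableT i2.
have iZ := integrableZl measurableT (2 * c) i3.
have iD := integrableD measurableT i1 (integrableZl measurableT (c ^+ 2) i2).
have := le_integral measurableT iZ iD.
rewrite integralZl// integralD//; last exact: integrableZl.
rewrite integralZl// -schurE// -/v => H.
have {}H : ((2 * c)%:E * v%:E <= \int[m]_y (u y ^+ 2 * `|K x y|)%:E +
   (c ^+ 2)%:E * A%:E)%E.
  apply: (le_trans (H _)).
    move=> y _; rewrite -!EFinM -EFinD lee_fin.
    rewrite -subr_ge0; have [k0|k0] := ger0P (K x y).
      have := mulr_ge0 k0 (sqr_ge0 (u y - c)).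
      by congr (0 <= _); ring.
    have := mulr_ge0 (ltW (etrans (oppr_gt0 _) k0)) (sqr_ge0 (u y + c)).
    by congr (0 <= _); ring.
  by apply/leeD2l/lee_wpmul2l; [rewrite lee_fin sqr_ge0|exact: HA].
move: H; set J := (\int[m]_y _)%E.
have [j ->] : exists j : R, J = j%:E by exists (fine J); rewrite fineK.
rewrite -!EFinM -EFinD !lee_fin /c => H.
have : 2 * (v / A) * v * A <= (j + (v / A) ^+ 2 * A) * A by rewrite ler_wpM2r// ltW.
have -> : 2 * (v / A) * v * A = 2 * v ^+ 2 by field; rewrite gt_eqF.
have -> : (j + (v / A) ^+ 2 * A) * A = A * j + v ^+ 2 by field; rewrite gt_eqF.
lra.
Qed.

(** One factor [A] comes from each marginal of |K|, through [schur_sqr_le] and then Tonelli. The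
    weight at x is exchanged for [W2] at y only where the kernel couples x to y, so the cost is the
    oscillation of the weight at the scale of the kernel. *)
Lemma schur_weighted_le u (W W2 : T -> R) :
  sq_integrable u ->
  measurable_fun [set: T] W -> (forall x, 0 <= W x) ->
  measurable_fun [set: T] W2 -> (forall x, 0 <= W2 x) ->
  (forall x y, K x y != 0 -> W x <= W2 y) ->
  (\int[m]_x (W x * schur K u x ^+ 2)%:E <=
   (A ^+ 2)%:E * \int[m]_y (W2 y * u y ^+ 2)%:E)%E.
Proof.
move=> su mW W0 mW2 W20 WW2.
have [mu_ _] := su.
pose F : T * T -> \bar R := fun z =>
  (W z.1 * (u z.2 ^+ 2 * `|K z.1 z.2|))%:E.
have mF : measurable_fun [set: T * T] F.
  apply/measurable_EFinP; apply: measurable_funM.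
    exact: (measurableT_comp mW measurable_fst).
  apply: measurable_funM.
    by apply: measurable_funX; exact: (measurableT_comp mu_ measurable_snd).
  by apply: measurableT_comp => //; exact: mK.
have uK0 x y : 0 <= u y ^+ 2 * `|K x y| by apply: mulr_ge0 => //; exact: sqr_ge0.
have Wu0 y : 0 <= W2 y * u y ^+ 2 by apply: mulr_ge0 => //; exact: sqr_ge0.
have F0 z : (0 <= F z)%E by rewrite lee_fin; exact: mulr_ge0.
have mF1 x : measurable_fun [set: T] (fun y => (u y ^+ 2 * `|K x y|)%:E).
  apply/measurable_EFinP/measurable_funM; first exact: measurable_funX.
  by apply: measurableT_comp => //; exact: mK1.
have mG : measurable_fun [set: T] (fun x => \int[m]_y F (x, y))%E.
  exact: (@measurable_fun_fubini_tonelli_F _ _ _ _ _ m _ mF F0).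
apply: (@le_trans _ _ (\int[m]_x (A%:E * \int[m]_y F (x, y)))%E).
  apply: ge0_le_integral; [exact: measurableT|..].
  - by move=> x _; rewrite lee_fin; apply: mulr_ge0 => //; exact: sqr_ge0.
  - apply/measurable_EFinP/measurable_funM => //.
    by apply: measurable_funX; exact: measurable_schur.
  - exact: measurable_funeM.
  - move=> x _; rewrite [in leRHS]/F /=.
    under [in leRHS]eq_integral do rewrite EFinM.
    rewrite ge0_integralZl//; last 2 first.
      by move=> y _; rewrite lee_fin.
      by rewrite lee_fin.
    rewrite EFinM muleCA; apply: lee_wpmul2l; first by rewrite lee_fin.
    exact: schur_sqr_le.
rewrite ge0_integralZl//; last 2 first.
- by move=> x _; exact: integral_ge0.
- by rewrite lee_fin ltW.
rewrite (@fubini_tonelli _ _ _ _ _ m m F mF F0).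
rewrite expr2 EFinM -muleA lee_pmul2l//.
rewrite -ge0_integralZl//; last 3 first.
- by apply/measurable_EFinP/measurable_funM => //; exact: measurable_funX.
- by move=> y _; rewrite lee_fin.
- by rewrite lee_fin ltW.
apply: ge0_le_integral; [exact: measurableT|by move=> y _; exact: integral_ge0|..].
- exact: (@measurable_fun_fubini_tonelli_G _ _ _ _ _ m _ mF F0).
- apply: measurable_funeM; apply/measurable_EFinP/measurable_funM => //.
  exact: measurable_funX.
- move=> y _.
  apply: (@le_trans _ _ (\int[m]_x ((W2 y * u y ^+ 2)%:E * `|K x y|%:E))%E).
    apply: ge0_le_integral; [exact: measurableT|by move=> x _; exact: F0|..].
    + exact: (measurableT_comp mF (measurable_pair2 y)).
    + apply: measurable_funeM; apply/measurable_EFinP/measurableT_comp => //.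
    + move=> x _; rewrite /F /= -EFinM lee_fin mulrA.
      have [->|k0] := eqVneq (K x y) 0; first by rewrite normr0 !mulr0.
      by rewrite ler_wpM2r// ler_wpM2r ?sqr_ge0// WW2.
  rewrite ge0_integralZl//; last 2 first.
  + by apply/measurable_EFinP/measurableT_comp => //; exact: mK2.
  + by rewrite lee_fin.
  by rewrite muleC lee_wpmul2r// lee_fin.
Qed.

Lemma sq_integrable_schur u : sq_integrable u -> sq_integrable (schur K u).
Proof.
move=> su; split; first exact: measurable_schur.
have := @schur_weighted_le u (fun=> 1) (fun=> 1) su.
under eq_integral do rewrite mul1r.
move=> /(_ _ _ _ _ _)/le_lt_trans; apply => //.
under eq_integral do rewrite mul1r.
by case: su => _ ui; rewrite lte_mul_pinfty// lee_fin sqr_ge0.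
Qed.

End Kernel.
End Schur.

Section Convolution.
Variable R : realType.
Local Notation mu3 := (@lebesgue3 R).
Implicit Types (f : 'I_3 -> R -> R) (u g : R3 R -> R).

Definition sq_int u := @sq_integrable _ _ R (@lebesgue3 R) u.

Definition convol u f (x : R3 R) : R := (\int[mu3]_y (u y * ker3 f x y))%R.

Lemma sq_int_integrable u : sq_int u ->
  mu3.-integrable [set: mR3 R] (fun y => (u y ^+ 2)%:E).
Proof. exact: sq_integrable_sqr. Qed.

Lemma schur_kernel_ker3 f A : (forall i, ccinf (f i)) -> 0 < A -> ker3_L1 f A ->
  exists B, schur_kernel mu3 (ker3 f) B A.
Proof.
move=> cf A0 KA; have [B B0 HB] := ker3_bounded cf; exists B; split => //.
exact: measurable_ker3.
Qed.

Lemma schur_kernel_ker3_exists f : (forall i, ccinf (f i)) ->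
  exists B A, schur_kernel mu3 (ker3 f) B A.
Proof.
move=> cf; have [A A0 HA] := ker3_L1_exists cf.
by have [B HB] := schur_kernel_ker3 cf A0 HA; exists B, A.
Qed.

Lemma convol_integrable u f x : sq_int u -> (forall i, ccinf (f i)) ->
  mu3.-integrable [set: mR3 R] (fun y => (u y * ker3 f x y)%:E).
Proof.
move=> su cf; have [B [A HK]] := schur_kernel_ker3_exists cf.
exact: (schur_integrable HK x su).
Qed.

Lemma convolE u f x : sq_int u -> (forall i, ccinf (f i)) ->
  (convol u f x)%:E = (\int[mu3]_y (u y * ker3 f x y)%:E)%E.
Proof.
move=> su cf; have [B [A HK]] := schur_kernel_ker3_exists cf.
exact: (schurE HK x su).
Qed.

Lemma sq_int_convol u f : sq_int u -> (forall i, ccinf (f i)) -> sq_int (convol u f).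
Proof.
move=> su cf; have [B [A HK]] := schur_kernel_ker3_exists cf.
exact: (sq_integrable_schur HK su).
Qed.

End Convolution.

(** * Derivatives of convolutions *)

Section ConvolutionDerivative.
Variable R : realType.
Local Notation mu := (@lebesgue_measure R).
Local Notation mu2 := (@leb2 R).
Local Notation mu3 := (@lebesgue3 R).
Implicit Types (f : 'I_3 -> R -> R) (u g : R3 R -> R).

Lemma coor_ins (i k : 'I_3) (s t : R) (p : R * R) : i != k ->
  coor i (ins k s p) = coor i (ins k t p).
Proof. by case: i => -[|[|[|//]]] iP; case: k => -[|[|[|//]]] kP. Qed.

Lemma coor_ins_same (k : 'I_3) (s : R) (p : R * R) : coor k (ins k s p) = s.
Proof. by case: k => -[|[|[|//]]] kP. Qed.

Definition box_ind (c : R3 R) (M : R) (y : R3 R) : R :=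
  prod3 (fun i => \1_[set t | `|t - coor i c| <= M]) y.

Lemma dist_le_itv (c M : R) :
  [set t : R | `|t - c| <= M] = [set` `[(c - M), (c + M)]].
Proof. by apply/seteqP; split => t /=; rewrite in_itv /= -ler_distlC distrC. Qed.

Lemma measurable_dist_le (c M : R) :
  measurable ([set t | `|t - c| <= M] : set (measurableTypeR R)).
Proof.
by rewrite dist_le_itv; exact: measurable_itv. Qed.

Lemma box_ind_integrable c M : mu3.-integrable [set: mR3 R] (fun y => (box_ind c M y)%:E).
Proof.
pose h i : R -> R := \1_[set t | `|t - coor i c| <= M].
have mh i : measurable_fun [set: measurableTypeR R] (h i).
  by apply: measurable_indic; exact: measurable_dist_le.
have h0 i t : 0 <= h i t by [].
apply/integrableP; split; first by apply/measurable_EFinP; exact: measurable_prod3.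
under eq_integral do rewrite gee0_abs ?lee_fin ?mulr_ge0//.
rewrite [ltLHS](@integral_prod3 R h mh h0).
have Hi i : (0 <= \int[mu]_t (h i t)%:E < +oo)%E.
  apply/andP; split; first by apply: integral_ge0 => t _; rewrite lee_fin.
  rewrite [ltLHS](@integral_indic _ _ _ mu setT measurableT); last exact: measurable_dist_le.
  rewrite setIT dist_le_itv /= lebesgue_measure_itv /= lte_fin.
  by case: ifP => _ //; rewrite -EFinB ltry.
have /andP[a0 a1] := Hi 0; have /andP[b0 b1] := Hi 1; have /andP[c0 c1] := Hi 2.
have F (a : \bar R) : (0 <= a)%E -> (a < +oo)%E -> a \is a fin_num.
  by move=> ? ?; rewrite ge0_fin_numE.
by rewrite -ge0_fin_numE ?mule_ge0// !fin_numM// F.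
Qed.

Lemma is_derive_convol u f k (x : R3 R) : sq_int u -> (forall i, ccinf (f i)) ->
  is_derive x (basis3 R k) (convol u f) (convol u (derive_at k f) x).
Proof.
move=> su cf; have cf' := ccinf_derive_at k cf.
rewrite -(ins_coor k x); apply/is_derive_ins.
set t := coor k x; set p := rest k x.
have [B B0 HB] := ker3_bounded cf'.
have [M HM] : exists M : R, forall i s, M <= `|s| -> derive_at k f i s = 0.
  have [_ [M0 H0]] := cf' 0; have [_ [M1 H1]] := cf' 1; have [_ [M2 H2]] := cf' 2.
  exists (Num.max M0 (Num.max M1 M2)) => i s.
  rewrite !ge_max => /and3P[t0 t1 t2].
  case: i => -[|[|[|]]] //= iP.
  - by rewrite (_ : Ordinal iP = 0) ?H0//; exact/val_inj.
  - by rewrite (_ : Ordinal iP = 1) ?H1//; exact/val_inj.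
  - by rewrite (_ : Ordinal iP = 2) ?H2//; exact/val_inj.
(* The dominating function for differentiation under the integral: B |u| <= B (u^2 + 1) where the
   differentiated kernel is nonzero. As s moves within 1 of t, these points y stay in the box of
   half-width |M| + 1 around x, which has finite volume. *)
pose G y := B * (u y ^+ 2) + B * box_ind x (`|M| + 1) y.
have box0 y : 0 <= box_ind x (`|M| + 1) y by rewrite /box_ind /prod3 !mulr_ge0.
have G0 y : 0 <= G y
  by apply: addr_ge0; [apply: mulr_ge0; [exact: ltW|exact: sqr_ge0]|
    apply: mulr_ge0 => //; exact: ltW].
have iG : mu3.-integrable [set: mR3 R] (EFin \o G).
  exact: (integrableD measurableT (integrableZl measurableT B (sq_int_integrable su))
    (integrableZl measurableT B (box_ind_integrable x (`|M| + 1)))).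
pose F s y := u y * ker3 f (ins k s p) y.
have dF (s : R) (y : R3 R) : is_derive s 1 (F ^~ y) (u y * ker3 (derive_at k f) (ins k s p) y).
  have dk := (is_derive_ins k (ker3 f ^~ y) s p _).1 (is_derive_ker3 k (ins k s p) y cf).
  exact: (@is_derive_scale R R^o (u y) _ s 1 _ dk).
have dF1 (s : R) (y : R3 R) : partial1of2 F s y = u y * ker3 (derive_at k f) (ins k s p) y.
  by rewrite /partial1of2 derive1E; case: (dF s y).
have tI : (`]t - 1, t + 1[%classic : set R) t.
  by rewrite /= in_itv /= ltrBlDr ltrDl ltr01.
have iF (s : R) : (`]t - 1, t + 1[%classic : set R) s ->
    mu3.-integrable [set: mR3 R] (EFin \o F s).
  by move=> _; exact: convol_integrable.
have derF (s : R) (y : R3 R) : (`]t - 1, t + 1[%classic : set R) s -> [set: mR3 R] y ->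
   derivable (F ^~ y) s 1.
  by move=> _ _; case: (dF s y).
have Gub (s : R) (y : R3 R) : (`]t - 1, t + 1[%classic : set R) s -> [set: mR3 R] y ->
    `|partial1of2 F s y| <= G y.
  move=> sI _; rewrite dF1.
  have [->|k0] := eqVneq (ker3 (derive_at k f) (ins k s p) y) 0.
    by rewrite mulr0 normr0.
  have -> : G y = B * (u y ^+ 2 + 1).
    rewrite /G; suff -> : box_ind x (`|M| + 1) y = 1 by rewrite mulr1 mulrDr mulr1.
    have Hi i : \1_[set t : R | `|t - coor i x| <= `|M| + 1] (coor i y) = 1 :> R.
      rewrite indicE mem_set//=.
      have Hki : derive_at k f i (coor i (ins k s p) - coor i y) != 0.
        apply: contra k0 => /eqP h.
        move: h; rewrite /ker3; case: i => -[|[|[|//]]] iP.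
        - by rewrite (_ : Ordinal iP = 0); [move=> ->; rewrite !mul0r|exact/val_inj].
        - by rewrite (_ : Ordinal iP = 1); [move=> ->; rewrite mulr0 mul0r|exact/val_inj].
        - by rewrite (_ : Ordinal iP = 2); [move=> ->; rewrite mulr0|exact/val_inj].
      have lt1 : `|coor i (ins k s p) - coor i y| <= `|M|.
        rewrite (le_trans _ (ler_norm _))// leNgt; apply/negP => /ltW /HM h.
        by rewrite h eqxx in Hki.
      have lt2 : `|coor i (ins k s p) - coor i x| <= 1.
        rewrite -[x](ins_coor k) -/t -/p.
        have [->|ik] := eqVneq i k; last by rewrite (coor_ins s t p ik) subrr normr0.
        rewrite !coor_ins_same; move: sI; rewrite /= in_itv /= -ltr_distlC distrC.
        exact: ltW.
      rewrite -(subrKA (coor i (ins k s p))) (le_trans (ler_normD _ _))//.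
      by rewrite lerD// distrC.
    by rewrite /box_ind /prod3 !(Hi 0, Hi 1, Hi 2) !mulr1.
  rewrite normrM mulrC ler_pM//.
  by rewrite -(real_normK (num_real (u y))); have := normr_ge0 (u y); nra.
apply: DeriveDef.
  exact: (derivable_under_integral measurableT tI iF derF G0 iG Gub).
rewrite -derive1E.
have -> := differentiation_under_integral measurableT tI iF derF G0 iG Gub.
by rewrite /convol; apply: eq_Rintegral => y _; rewrite dF1.
Qed.

(** The weak derivative is tested against y |-> f (x - y). The sign from reflecting the variable
    cancels the one in the definition of the weak derivative. *)
Lemma convol_weak k u g f x : sq_int u -> sq_int g -> weak_partial_real k u g ->
  (forall i, ccinf (f i)) -> convol u (derive_at k f) x = convol g f x.
Proof.
move=> su sg H cf; have := H _ (ker3_test_function x cf).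
rewrite partial_ker3// => E; apply: EFin_inj.
have cf' := ccinf_derive_at k cf.
rewrite !convolE//; apply/eqP; rewrite -eqe_opp -E; apply/eqP.
transitivity (\int[mu3]_y ((-1)%:E * (u y * ker3 (derive_at k f) x y)%:E))%E.
  rewrite integralZl//; last exact: convol_integrable.
  by rewrite EFinN mulN1e.
by apply: eq_integral => y _; rewrite -EFinM mulN1r mulrN.
Qed.

Lemma ker3_L1_moll (n : 'I_3 -> nat) : ker3_L1 (fun i => @moll R (n i)) 1.
Proof.
have E n' (c : R) : (\int[mu]_t (moll n' (t - c))%:E = 1)%E.
  by rewrite -(integral_moll_shift n' c); apply: eq_integral => t _; rewrite -mollN opprB.
have mm n' : measurable_fun [set: measurableTypeR R] (@moll R n').
  by apply: ccinf_measurable; exact: moll_ccinf.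
have nrm x y : `|ker3 (fun i => @moll R (n i)) x y| = ker3 (fun i => @moll R (n i)) x y.
  rewrite ger0_norm// /ker3.
  by apply: mulr_ge0; [apply: mulr_ge0|]; exact: moll_ge0.
split=> [x|y].
  have H i : (\int[mu]_t (moll (n i) (coor i x - t))%:E = 1)%E.
    exact: integral_moll_shift.
  under eq_integral do rewrite nrm.
  rewrite ker3_fix1 integral_prod3//.
  - apply: (@le_trans _ _ (1 * 1 * 1)%E); last by rewrite !mule1.
    rewrite le_eqVlt; apply/orP; left; apply/eqP.
    by congr (_ * _ * _)%E; [exact: (H 0)|exact: (H 1)|exact: (H 2)].
  - by move=> i; apply: ccinf_measurable; exact: (ccinf_reflect _ (moll_ccinf R (n i))).
  - by move=> i t; exact: moll_ge0.
have H i : (\int[mu]_t (moll (n i) (t - coor i y))%:E = 1)%E by exact: E.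
have -> : (\int[mu3]_x `|ker3 (fun i => @moll R (n i)) x y|%:E =
    \int[mu3]_x (prod3 (fun i s => moll (n i) (s - coor i y)) x)%:E)%E.
  by apply: eq_integral => x _; rewrite nrm.
rewrite integral_prod3//.
- apply: (@le_trans _ _ (1 * 1 * 1)%E); last by rewrite !mule1.
  rewrite le_eqVlt; apply/orP; left; apply/eqP.
    by congr (_ * _ * _)%E; [exact: (H 0)|exact: (H 1)|exact: (H 2)].
- by move=> i; apply: ccinf_measurable; exact: (ccinf_shift _ (moll_ccinf R (n i))).
- by move=> i t; exact: moll_ge0.
Qed.

End ConvolutionDerivative.

(** * Mollification on the line and Lebesgue points *)

Section LineMollification.
Variable R : realType.
Local Notation mu := (@lebesgue_measure R).
Local Notation mu2 := (@leb2 R).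
Local Notation mu3 := (@lebesgue3 R).
Implicit Types (u v : R3 R -> R) (h : R -> R).

Definition mollker n (s t : R) : R := moll n (s - t).

Lemma measurable_moll n : measurable_fun [set: measurableTypeR R] (@moll R n).
Proof. by apply: ccinf_measurable; exact: moll_ccinf. Qed.

Lemma measurable_mollker n : measurable_fun
  [set: measurableTypeR R * measurableTypeR R] (fun z => mollker n z.1 z.2).
Proof.
apply: (measurableT_comp (measurable_moll n)).
by apply: measurable_funB; [exact: measurable_fst|exact: measurable_snd].
Qed.

Lemma integral_mollker1 n s : (\int[mu]_t (mollker n s t)%:E = 1)%E.
Proof. exact: integral_moll_shift. Qed.

Lemma integral_mollker2 n t : (\int[mu]_s (mollker n s t)%:E = 1)%E.
Proof.
rewrite -(integral_moll_shift n t); apply: eq_integral => s _.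
by rewrite /mollker -mollN opprB.
Qed.

Lemma mollker_ge0 n s t : 0 <= mollker n s t. Proof. exact: moll_ge0. Qed.

Lemma mollker_schur n : exists B, schur_kernel mu (mollker n) B 1.
Proof.
have [B B0 HB] := ccinf_bounded (moll_ccinf R n).
exists B; split => //; first exact: measurable_mollker.
split; first by move=> s t; exact: HB.
split=> [s|t].
  under eq_integral do rewrite ger0_norm ?mollker_ge0//.
  by rewrite integral_mollker1.
under eq_integral do rewrite ger0_norm ?mollker_ge0//.
by rewrite integral_mollker2.
Qed.

Local Notation sq1 := (@sq_integrable _ _ R mu).

Lemma sq1_locally_integrable h : sq1 h -> locally_integrable setT h.
Proof.
move=> [mh hi]; split => //; first exact: openT.
move=> K _ cK.
have mK : measurable (K : set (measurableTypeR R)) by exact: compact_measurable.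
have mh2 : measurable_fun [set: measurableTypeR R] (fun t => (h t ^+ 2)%:E).
  by apply/measurable_EFinP; exact: measurable_funX.
apply: (@le_lt_trans _ _ (\int[mu]_(t in K) ((h t ^+ 2)%:E + cst 1%:E t))%E).
  apply: ge0_le_integral => //.
  - by apply/measurable_EFinP/measurableT_comp => //; exact: measurable_funTS.
  - by apply: emeasurable_funD => //; exact: measurable_funTS.
  - move=> t _; rewrite /= -EFinD lee_fin -(real_normK (num_real (h t))).
    by have := normr_ge0 (h t); nra.
rewrite ge0_integralD//; last 2 first.
- by move=> t _; rewrite lee_fin sqr_ge0.
- exact: measurable_funTS.
rewrite integral_cst// mul1e lte_add_pinfty//; last exact: compact_finite_measure.
apply: le_lt_trans hi; apply: ge0_subset_integral => //.
by move=> t _; rewrite lee_fin sqr_ge0.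
Qed.

(** The kernel has mass 1, is supported in the ball of radius 1 / (n + 1) around x, and is at most
    (n + 1) / c there. As this ball has length 2 / (n + 1), the error is at most 2 / c times the
    mean of |h - h x| over it. *)
Lemma schur_moll_cvg h (x : R) : sq1 h -> lebesgue_pt h x ->
  schur mu (mollker n) h x @[n --> \oo] --> h x.
Proof.
move=> sh lx.
have [mh _] := sh.
pose c : R := bump_lb R; have c0 : 0 < c := bump_lb_gt0 R.
have H n : (`|schur mu (mollker n) h x - h x|%:E <=
   (2 / c)%:E * davg h x n.+1%:R^-1)%E.
  have [B HK] := mollker_schur n.
  have i1 : mu.-integrable [set: measurableTypeR R] (fun t => (h t * mollker n x t)%:E).
    exact: (schur_integrable HK x sh).
  have mk : measurable_fun [set: measurableTypeR R] (mollker n x).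
    exact: (measurableT_comp (measurable_mollker n) (measurable_pair1 x)).
  have i2 : mu.-integrable [set: measurableTypeR R] (fun t => (mollker n x t)%:E).
    apply/integrableP; split; first exact/measurable_EFinP.
    under eq_integral do rewrite gee0_abs ?lee_fin ?mollker_ge0//.
    by rewrite integral_mollker1 ltry.
  have E : ((schur mu (mollker n) h x - h x)%:E =
      \int[mu]_t ((h t - h x) * mollker n x t)%:E)%E.
    rewrite EFinB (schurE HK x sh).
    rewrite -[(h x)%:E]mule1 -(integral_mollker1 n x) -integralZl// -integralB//.
      by apply: eq_integral => t _; rewrite -EFinM -EFinB mulrBl.
    exact: integrableZl.
  rewrite -abse_EFin E.
  have mE : measurable_fun [set: measurableTypeR R]
      (fun t => ((h t - h x) * mollker n x t)%:E).
    by apply/measurable_EFinP/measurable_funM => //; exact: measurable_funB.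
  apply: (le_trans (le_abse_integral _ measurableT mE)).
  have n0 : 0 < n.+1%:R^-1 :> R by rewrite invr_gt0.
  have mb : measurable (ball x n.+1%:R^-1 : set (measurableTypeR R)).
    exact: measurable_ball.
  have mhx : measurable_fun [set: measurableTypeR R] (fun t => `|(h t - h x)%:E|%E).
    apply: measurableT_comp => //; apply/measurable_EFinP.
    exact: measurable_funB.
  apply: (@le_trans _ _ (\int[mu]_(t in ball x n.+1%:R^-1)
      ((n.+1%:R / c)%:E * `|(h t - h x)%:E|))%E).
    rewrite [leRHS]integral_mkcond; apply: ge0_le_integral => //.
    - exact: measurableT_comp.
    - apply: (measurable_restrictT _ _).1 => //.
      by apply: measurable_funeM; exact: measurable_funTS.
    - move=> t _; rewrite patchE; case: ifPn.
        move=> _; rewrite !abse_EFin -EFinM lee_fin normrM mulrC ler_wpM2r//.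
        by rewrite ger0_norm ?mollker_ge0// moll_le.
      rewrite notin_setE /ball /= => /negP; rewrite -leNgt => Hx.
      by rewrite /mollker moll_eq0// mulr0 /= normr0.
  rewrite ge0_integralZl//; last 2 first.
  - exact: measurable_funTS.
  - by rewrite lee_fin divr_ge0// ltW.
  rewrite /davg /iavg (lebesgue_measure_ball _ (ltW n0)) muleA.
  have -> : ((2 / c)%:E * (n.+1%:R^-1 *+ 2 : R)%:E^-1 = (n.+1%:R / c)%:E)%E.
    rewrite inver mulrn_eq0 /= gt_eqF// -EFinM; congr EFin.
    by rewrite -mulr_natl; field; rewrite gt_eqF//= addrC natr1.
  by [].
have Hd : (davg h x n.+1%:R^-1 @[n --> \oo] --> (0 : \bar R)).
  apply: (@cvg_comp _ _ _ (fun n : nat => n.+1%:R^-1 : R) (davg h x) _ _ _ _ lx).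
  move=> P [e /= e0 HP]; near=> n; apply: HP; rewrite ?invr_gt0//=.
  rewrite sub0r normrN gtr0_norm ?invr_gt0// -[ltRHS]invrK ltf_pV2 ?posrE ?invr_gt0//.
  apply: (@le_lt_trans _ _ n%:R); last by rewrite ltr_nat.
  by near: n; exact: nbhs_infty_ger.
apply/cvgrPdist_le => e e0.
have /fine_cvgP[Hf /cvgrPdist_le Hc] := Hd.
have ce0 : 0 < c * e / 2 by rewrite divr_gt0// mulr_gt0.
have {}Hc := Hc _ ce0.
near=> n.
have fn : davg h x n.+1%:R^-1 \is a fin_num by near: n.
have cn : `|0 - fine (davg h x n.+1%:R^-1)| <= c * e / 2 by near: n.
rewrite distrC -lee_fin (le_trans (H n))// -(fineK fn) -EFinM lee_fin.
move: cn; rewrite sub0r normrN => /(le_trans (ler_norm _)) cn.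
rewrite mulrC -ler_pdivlMr ?divr_gt0//.
by rewrite (le_trans cn)// invf_div mulrA [e * c]mulrC.
Unshelve. all: by end_near.
Qed.

End LineMollification.

(** * Semicontinuity under mollification in one coordinate *)

Section Fatou.
Variable R : realType.
Local Notation mu := (@lebesgue_measure R).
Local Notation mu2 := (@leb2 R).
Local Notation mu3 := (@lebesgue3 R).
Local Notation sq1 := (@sq_integrable _ _ R mu).
Implicit Types (u v : R3 R -> R) (h : R -> R).

Definition lmoll k n v (x : R3 R) : R :=
  (\int[mu]_s (v (ins k s (rest k x)) * mollker n (coor k x) s))%R.

Lemma rest_ins (k : 'I_3) (t : R) (y : R * R) : rest k (ins k t y) = y.
Proof. by case: y => ? ?; case: k => -[|[|[|//]]] kP. Qed.

Lemma lmoll_ins k n v t y :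
  lmoll k n v (ins k t y) = schur mu (mollker n) (fun s => v (ins k s y)) t.
Proof. by rewrite /lmoll rest_ins coor_ins_same. Qed.

Lemma measurable_rest k :
  measurable_fun [set: mR3 R] (rest k : mR3 R -> measurableTypeR R * measurableTypeR R).
Proof.
have m11 := @measurable_fst_fst R; have m12 := @measurable_snd_fst R.
rewrite /rest; case: (val k) => [|[|n]].
- by apply/measurable_fun_pair => //=; exact: measurable_snd.
- by apply/measurable_fun_pair => //=; exact: measurable_snd.
- exact: measurable_fst.
Qed.

Lemma measurable_lmoll k n v : measurable_fun [set: mR3 R] v ->
  measurable_fun [set: mR3 R] (lmoll k n v).
Proof.
move=> mv.
apply: (@measurable_fun_Rintegral _ _ (mR3 R) _ _ mu
  (fun z => v (ins k z.2 (rest k z.1)) * mollker n (coor k z.1) z.2)).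
apply: measurable_funM.
  apply: (@measurableT_comp _ _ _ _ _ _ (fun z : mR3 R => v (ins k z.2 z.1)) _
    (fun z : mR3 R * measurableTypeR R => (rest k z.1, z.2) : mR3 R)).
    exact: measurable_ins_comp.
  apply/measurable_fun_pair => /=; last exact: measurable_snd.
  exact: (measurableT_comp (measurable_rest k) measurable_fst).
apply: (@measurableT_comp _ _ _ _ _ _ (fun z : measurableTypeR R * measurableTypeR R => mollker n z.1 z.2) _
    (fun z : mR3 R * measurableTypeR R => (coor k z.1 : measurableTypeR R, z.2))).
  exact: measurable_mollker.
apply/measurable_fun_pair => /=; last exact: measurable_snd.
have mc : measurable_fun [set: mR3 R] (coor k : mR3 R -> measurableTypeR R).
  exact: measurable_coor.
exact: (measurableT_comp mc measurable_fst).
Qed.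

Lemma ae_sq1_ins k v : sq_int v ->
  {ae mu2, forall y, sq1 (fun s => v (ins k s y))}.
Proof.
move=> sv; have := ae_integrable_ins k (sq_int_integrable sv).
apply: filterS; first exact: (ae_filter_ringOfSetsType mu2).
move=> y /integrableP[_ H]; split.
  by case: sv => mv _; exact: measurable_ins.
apply: le_lt_trans H; apply: ge0_le_integral => //.
- by move=> t _; rewrite lee_fin sqr_ge0.
- apply/measurable_EFinP; apply: measurable_funX.
  by case: sv => mv _; exact: measurable_ins.
- apply: measurableT_comp => //; apply/measurable_EFinP; apply: measurable_funX.
  by case: sv => mv _; exact: measurable_ins.
- by move=> t _; exact: lee_abs.
Qed.

Lemma sq_int_lmoll k n v : sq_int v -> sq_int (lmoll k n v).
Proof.
move=> sv; have [mv vi] := sv; have ml := measurable_lmoll k n mv.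
have m2 (w : R3 R -> R) : measurable_fun [set: mR3 R] w ->
    measurable_fun [set: mR3 R] (fun x => (w x ^+ 2)%:E).
  by move=> mw; apply/measurable_EFinP; exact: measurable_funX.
have p2 (w : R3 R -> R) x : (0 <= (w x ^+ 2)%:E)%E by rewrite lee_fin sqr_ge0.
split => //; apply: le_lt_trans vi.
rewrite (tonelli_ins k (m2 _ ml) (p2 _)) (tonelli_ins k (m2 _ mv) (p2 _)).
have mT (w : R3 R -> R) : measurable_fun [set: mR3 R] w ->
    measurable_fun setT (fun y => \int[mu]_t (w (ins k t y) ^+ 2)%:E)%E.
  move=> mw.
  exact: (@measurable_fun_fubini_tonelli_F _ _ _ _ _ mu _ (measurable_ins_comp k (m2 _ mw))).
apply: ae_ge0_le_integral => //.
- by move=> y _; exact: integral_ge0.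
- exact: mT.
- by move=> y _; exact: integral_ge0.
- exact: mT.
- have := ae_sq1_ins k sv.
  apply: filterS; first exact: (ae_filter_ringOfSetsType mu2).
  move=> y sy _.
  have [B HK] := mollker_schur R n.
  have := @schur_weighted_le _ _ _ mu _ _ _ HK (fun s => v (ins k s y)) (fun=> 1) (fun=> 1) sy.
  rewrite expr1n mul1e => H.
  under eq_integral do rewrite lmoll_ins.
  under eq_integral do rewrite -[X in X%:E]mul1r.
  under [leRHS]eq_integral do rewrite -[X in X%:E]mul1r.
  exact: H.
Qed.

(** On almost every line of direction [k] the slices are in L^2, and almost every point of it is a
    Lebesgue point of all four, so the mollifications converge there. The index is shifted by [N]
    because the bound is available only for small widths. *)
Lemma fatou_lmoll k (W : R3 R -> R) (v : 'I_4 -> R3 R -> R) (C : \bar R) N :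
  (forall p, sq_int (v p)) -> measurable_fun [set: mR3 R] W -> (forall x, 0 <= W x) ->
  (forall n, (N <= n)%N ->
    (\int[mu3]_x (W x * sum4 (fun p => lmoll k n (v p) x ^+ 2))%:E <= C)%E) ->
  (\int[mu3]_x (W x * sum4 (fun p => v p x ^+ 2))%:E <= C)%E.
Proof.
move=> sv mW W0 HC.
have mv p : measurable_fun [set: mR3 R] (v p) by case: (sv p).
have msum (w : 'I_4 -> R3 R -> R) : (forall p, measurable_fun [set: mR3 R] (w p)) ->
    measurable_fun [set: mR3 R] (fun x => (W x * sum4 (fun p => w p x ^+ 2))%:E).
  move=> mw; apply/measurable_EFinP; apply: measurable_funM => //.
  by rewrite /sum4; do 3 (apply: measurable_funD; last exact: measurable_funX);
    exact: measurable_funX.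
have psum (w : 'I_4 -> R3 R -> R) x : (0 <= (W x * sum4 (fun p => w p x ^+ 2))%:E)%E.
  by rewrite lee_fin; apply: mulr_ge0 => //; rewrite /sum4 !addr_ge0 ?sqr_ge0.
pose f n x : \bar R := (W x * sum4 (fun p => lmoll k (n + N)%N (v p) x ^+ 2))%:E.
have mf n : measurable_fun [set: mR3 R] (f n).
  exact: (msum (fun p => lmoll k (n + N)%N (v p)) (fun p => measurable_lmoll k _ (mv p))).
have f0 n x : (0 <= f n x)%E by exact: (psum (fun p => lmoll k (n + N)%N (v p))).
(* The lower limit is measurable on R^3, and its comparison with the limit is made between iterated
   integrals. Almost every point of almost every line then suffices, with no exceptional null set in
   R^3 to exhibit. *)
pose L x : \bar R := limn_einf (f ^~ x).
have mL : measurable_fun [set: mR3 R] L.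
  rewrite /L /limn_einf; apply: measurableT_comp => //.
  apply: measurable_fun_limn_esup => n.
  by apply: measurableT_comp => //; exact: mf.
have L0 x : (0 <= L x)%E.
  rewrite /L limn_einf_lim; apply: lime_ge; first exact: is_cvg_einfs.
  by apply: nearW => n; apply: le_ereal_inf_tmp => _ [m _ <-].
apply: (@le_trans _ _ (\int[mu3]_x L x)%E); last first.
  apply: (le_trans (fatou mu3 measurableT (f := f) mf (fun n x _ => f0 n x))).
  rewrite limn_einf_lim; apply: lime_le; first exact: is_cvg_einfs.
  apply: nearW => n; apply: (@le_trans _ _ (\int[mu3]_x f n x)%E).
    by apply: ereal_inf_lbound; exists n => //=.
  by apply: HC; exact: leq_addl.
rewrite (tonelli_ins k (msum _ mv) (psum _)) (tonelli_ins k mL L0).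
have mT (w : R3 R -> \bar R) : measurable_fun [set: mR3 R] w -> (forall x, 0 <= w x)%E ->
    measurable_fun setT (fun y => \int[mu]_t (w (ins k t y)))%E.
  move=> mw w0.
  exact: (@measurable_fun_fubini_tonelli_F _ _ _ _ _ mu _ (measurable_ins_comp k mw)).
apply: ae_ge0_le_integral => //.
- by move=> y _; exact: integral_ge0.
- exact: (mT _ (msum _ mv)).
- by move=> y _; exact: integral_ge0.
- exact: mT.
have H : {ae mu2, forall y, forall p, sq1 (fun s => v p (ins k s y))}.
  have := @ae_foralln _ _ _ mu2 (fun n y => sq1 (fun s => v (inord n) (ins k s y)))
    (fun n => ae_sq1_ins k (sv _)).
  apply: (@filterS _ (almost_everywhere mu2) (ae_filter_ringOfSetsType mu2)).
  by move=> y Hy p; have := Hy p; rewrite inord_val.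
move: H; apply: filterS; first exact: (ae_filter_ringOfSetsType mu2).
move=> y sy _.
have mv1 := measurable_ins k y (msum _ mv); have mL1 := measurable_ins k y mL.
apply: (@ae_ge0_le_integral _ _ _ mu setT measurableT _ _ (fun t _ => psum v (ins k t y))
  mv1 (fun t _ => L0 (ins k t y)) mL1).
have Hl p : {ae mu, forall t, lebesgue_pt (fun s => v p (ins k s y)) t}.
  by apply: lebesgue_differentiation; exact: sq1_locally_integrable.
have Hl4 : {ae mu, forall t, forall p, lebesgue_pt (fun s => v p (ins k s y)) t}.
  have := @ae_foralln _ _ _ mu (fun n t => lebesgue_pt (fun s => v (inord n) (ins k s y)) t)
    (fun n => Hl _).
  apply: (@filterS _ (almost_everywhere mu) (ae_filter_ringOfSetsType mu)).
  by move=> t Ht p; have := Ht p; rewrite inord_val.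
move: Hl4; apply: filterS; first exact: (ae_filter_ringOfSetsType mu).
move=> t lt _; rewrite /L.
have cv : f n (ins k t y) @[n --> \oo] -->
    ((W (ins k t y) * sum4 (fun p => v p (ins k t y) ^+ 2))%:E : \bar R).
  apply: cvg_EFin; first exact: nearW.
  apply: cvgM; first exact: cvg_cst.
  have c p : (lmoll k (n + N)%N (v p) (ins k t y) ^+ 2) @[n --> \oo] --> v p (ins k t y) ^+ 2.
    have cl : lmoll k (n + N)%N (v p) (ins k t y) @[n --> \oo] --> v p (ins k t y).
      rewrite (cvg_shiftn N (fun n => lmoll k n (v p) (ins k t y))).
      under eq_fun do rewrite lmoll_ins.
      exact: (schur_moll_cvg (sy p) (lt p)).
    have -> : (fun n => lmoll k (n + N)%N (v p) (ins k t y) ^+ 2) =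
       (fun n => lmoll k (n + N)%N (v p) (ins k t y)) \* (fun n => lmoll k (n + N)%N (v p) (ins k t y)).
      by apply/funext => n; rewrite expr2.
    by rewrite expr2; exact: cvgM.
  by rewrite /sum4; do 3 (apply: cvgD; last exact: c); exact: c.
by rewrite (cvg_limn_einf_sup cv).1.
Qed.

End Fatou.

(** * Convolution as an iterated mollification *)

Section Iterated.
Variable R : realType.
Local Notation mu := (@lebesgue_measure R).
Local Notation mu2 := (@leb2 R).
Local Notation mu3 := (@lebesgue3 R).
Implicit Types (u v : R3 R -> R).

(** When c = 0, [phi] itself may fail to be integrable; both sides are then 0, whatever value its
    total integral takes. This occurs wherever a mollifier vanishes. *)
Lemma integral_scale_fine d (T : measurableType d) (m : {measure set T -> \bar R})
    (c : R) (phi : T -> R) :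
  m.-integrable setT (fun t => (c * phi t)%:E) ->
  (\int[m]_t (c * phi t)%:E = (c * (\int[m]_t phi t)%R)%:E)%E.
Proof.
move=> ic; have [c0|c0] := eqVneq c 0.
  rewrite c0 mul0r; under eq_integral do rewrite mul0r.
  exact: integral0.
have ip : m.-integrable setT (EFin \o phi).
  have := integrableZl measurableT c^-1 ic; congr (integrable _ _ _).
  by apply/funext => t; rewrite -EFinM mulKf.
rewrite EFinM /Rintegral fineK; last exact: integrable_fin_num.
by rewrite -integralZl//; apply: eq_integral => t _; rewrite EFinM.
Qed.

(** Three independent widths, since the limits are taken one coordinate at a time. *)
Definition moll3 (n0 n1 n2 : nat) (i : 'I_3) : R -> R :=
  @moll R (match val i with 0 => n0 | 1 => n1 | _ => n2 end).

Lemma moll3_ccinf n0 n1 n2 i : ccinf (moll3 n0 n1 n2 i).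
Proof. exact: moll_ccinf. Qed.

(** Fubini twice, at a fixed [x]. The inner integrals agree with the partial mollifications only on
    almost every line, but the next integration does not see the exceptions, so the equality holds
    at every [x]. *)
Lemma convol_moll3 n0 n1 n2 u x : sq_int u ->
  convol u (moll3 n0 n1 n2) x = lmoll 0 n0 (lmoll 1 n1 (lmoll 2 n2 u)) x.
Proof.
move=> su; case: x => -[x0 x1] x2.
have cf := moll3_ccinf n0 n1 n2.
have gi := convol_integrable (x0, x1, x2) su cf.
set g := fun y => (u y * ker3 (moll3 n0 n1 n2) (x0, x1, x2) y)%:E in gi.
have [mu_ _] := su.
pose w := lmoll 2 n2 u.
have mw : measurable_fun [set: mR3 R] w by exact: measurable_lmoll.
pose w1 := lmoll 1 n1 w.
have mw1 : measurable_fun [set: mR3 R] w1 by exact: measurable_lmoll.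
have mk n (s : R) : measurable_fun [set: measurableTypeR R] (mollker n s).
  by apply: ccinf_measurable; exact: (ccinf_reflect s (moll_ccinf R n)).
pose h (p : R * R) : R := mollker n0 x0 p.1 * (mollker n1 x1 p.2 * w (p.1, p.2, x2)).
have mh : measurable_fun [set: measurableTypeR R * measurableTypeR R] h.
  apply: measurable_funM; first exact: (measurableT_comp (mk n0 x0) measurable_fst).
  apply: measurable_funM; first exact: (measurableT_comp (mk n1 x1) measurable_snd).
  have := measurableT_comp mw (measurable_pair2 (x2 : measurableTypeR R)).
  by congr measurable_fun; apply/funext => -[].
have gik := integrable_ins 2 gi.
have ghE : {ae mu2, forall p, (\int[mu]_s g (ins 2%R s p) = (h p)%:E)%E}.
  have := ae_integrable_ins 2 gi.
  apply: (@filterS _ (almost_everywhere mu2) (ae_filter_ringOfSetsType mu2)).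
  move=> -[a b].
  have E s : g (ins 2 s (a, b)) =
     ((mollker n0 x0 a * mollker n1 x1 b) * (u (ins 2 s (a, b)) * mollker n2 x2 s))%:E.
    exact: (congr1 EFin (mulrCA (u (ins 2 s (a, b)))
      (mollker n0 x0 a * mollker n1 x1 b) (mollker n2 x2 s))).
  rewrite (_ : (fun s => g (ins 2 s (a, b))) = (fun s =>
     ((mollker n0 x0 a * mollker n1 x1 b) * (u (ins 2 s (a, b)) * mollker n2 x2 s))%:E)); last first.
    by apply/funext => s; exact: E.
  move=> /integral_scale_fine Hi.
  by rewrite Hi /h -mulrA; congr (EFin (_ * (_ * _))).
have mG : measurable_fun [set: measurableTypeR R * measurableTypeR R]
    (fun p => \int[mu]_s g (ins 2%R s p))%E.
  exact: (@measurable_fubini_F _ _ _ _ _ mu2 mu _ gik).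
have mhE : measurable_fun [set: measurableTypeR R * measurableTypeR R] (EFin \o h).
  exact/measurable_EFinP.
have ih : mu2.-integrable setT (EFin \o h).
  have := @integrable_fubini_F _ _ _ _ _ mu2 mu _ gik.
  move=> /integrableP[_ Hlt]; apply/integrableP; split => //.
  apply: le_lt_trans Hlt; rewrite le_eqVlt; apply/orP; left; apply/eqP.
  apply: ae_eq_integral => //.
  - exact: measurableT_comp.
  - exact: measurableT_comp.
  - move: ghE; apply: (@filterS _ (almost_everywhere mu2) (ae_filter_ringOfSetsType mu2)).
    by move=> p Hp _; exact: (congr1 abse (esym Hp)).
have E1 : (\int[mu3]_y g y = \int[mu2]_p (h p)%:E)%E.
  rewrite (fubini_ins 2 gi); apply: ae_eq_integral => //.
  move: ghE; apply: (@filterS _ (almost_everywhere mu2) (ae_filter_ringOfSetsType mu2)).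
  by move=> p Hp _.
have E2 : (\int[mu2]_p (h p)%:E = \int[mu]_a \int[mu]_b (h (a, b))%:E)%E.
  exact/esym/(@integral12_prod_meas1 _ _ _ _ _ mu mu _ ih).
pose q a : R := w1 (a, x1, x2) * mollker n0 x0 a.
have E3 : (\int[mu]_a \int[mu]_b (h (a, b))%:E = \int[mu]_a (q a)%:E)%E.
  apply: ae_eq_integral => //.
  - exact: (@measurable_fubini_F _ _ _ _ _ mu mu _ ih).
  - apply/measurable_EFinP; apply: measurable_funM; last exact: mk.
    have := measurable_ins (0 : 'I_3) (x1, x2) mw1.
    by congr measurable_fun; apply/funext.
  - have := @ae_integrable1 _ _ _ _ _ mu mu _ ih.
    apply: (@filterS _ (almost_everywhere mu) (ae_filter_ringOfSetsType mu)).
    move=> a Hi _.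
    apply: (etrans (@integral_scale_fine _ _ mu (mollker n0 x0 a)
      (fun b => mollker n1 x1 b * w (a, b, x2)) Hi)).
    rewrite /q mulrC; congr (EFin (_ * _)); apply: eq_Rintegral => b _.
    exact: mulrC.
rewrite /convol /Rintegral -/g E1 E2 E3.
by rewrite {3}/lmoll /Rintegral.
Qed.

(** The mollifiers are removed in succession: first n0 tends to infinity with n1 and n2 fixed, then
    n1, then n2. A single threshold [N] serves all three. *)
Lemma fatou_convol (W : R3 R -> R) (u : 'I_4 -> R3 R -> R) (C : \bar R) N :
  (forall p, sq_int (u p)) -> measurable_fun [set: mR3 R] W -> (forall x, 0 <= W x) ->
  (forall n0 n1 n2, (N <= n0)%N -> (N <= n1)%N -> (N <= n2)%N ->
    (\int[mu3]_x (W x * sum4 (fun p => convol (u p) (moll3 n0 n1 n2) x ^+ 2))%:E <= C)%E) ->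
  (\int[mu3]_x (W x * sum4 (fun p => u p x ^+ 2))%:E <= C)%E.
Proof.
move=> su mW W0 H.
apply: (@fatou_lmoll R 2 W u C N) => // n2 hn2.
have s2 p : sq_int (lmoll 2 n2 (u p)) by exact: sq_int_lmoll.
apply: (@fatou_lmoll R 1 W (fun p => lmoll 2 n2 (u p)) C N) => // n1 hn1.
have s1 p : sq_int (lmoll 1 n1 (lmoll 2 n2 (u p))) by exact: sq_int_lmoll.
apply: (@fatou_lmoll R 0 W (fun p => lmoll 1 n1 (lmoll 2 n2 (u p))) C N) => // n0 hn0.
apply: le_trans (H _ _ _ hn0 hn1 hn2).
rewrite le_eqVlt; apply/orP; left; apply/eqP; apply: eq_integral => x _.
by rewrite /sum4 !convol_moll3.
Qed.

End Iterated.

(** * The inequality for smooth functions *)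

Section ZeroIntegral.
Variable R : realType.
Local Notation mu3 := (@lebesgue3 R).
Implicit Types (U V b : R3 R -> R).

(** The class of the divergences that integration by parts discards. Working modulo it, the
    inequality for smooth functions becomes pointwise. *)
Definition zint (h : R3 R -> R) :=
  mu3.-integrable [set: mR3 R] (EFin \o h) /\ (\int[mu3]_x (h x)%:E = 0)%E.

Lemma zintD h1 h2 : zint h1 -> zint h2 -> zint (fun x => h1 x + h2 x).
Proof.
move=> [i1 z1] [i2 z2]; split; first exact: (integrableD measurableT i1 i2).
under eq_integral do rewrite EFinD.
by rewrite (integralD measurableT i1 i2) z1 z2 adde0.
Qed.

Lemma zintZ c h : zint h -> zint (fun x => c * h x).
Proof.
move=> [i z]; split; first exact: (integrableZl measurableT c i).
under eq_integral do rewrite EFinM.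
by rewrite (integralZl measurableT i) z mule0.
Qed.

Lemma zintB h1 h2 : zint h1 -> zint h2 -> zint (fun x => h1 x - h2 x).
Proof.
move=> z1 /(zintZ (-1)) z2; have := zintD z1 z2; congr zint.
by apply/funext => x; rewrite mulN1r.
Qed.

Lemma integrable_bounded_mul b U V (B : R) :
  measurable_fun [set: mR3 R] b -> (forall x, `|b x| <= B) ->
  sq_int U -> sq_int V ->
  mu3.-integrable [set: mR3 R] (fun x => (b x * (U x * V x))%:E).
Proof.
move=> mb bB sU sV; have [mU _] := sU; have [mV _] := sV.
have B0 : 0 <= B by rewrite (le_trans (normr_ge0 (b 0))).
have := integrableZl measurableT B (integrableD measurableT (sq_int_integrable sU) (sq_int_integrable sV)).
apply: le_integrable => //.
  by apply/measurable_EFinP; apply: measurable_funM => //; exact: measurable_funM.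
move=> x _; rewrite -EFinD -EFinM !abse_EFin lee_fin !(normrM (b x), normrM B).
rewrite (ger0_norm B0) (ger0_norm (addr_ge0 (sqr_ge0 (U x)) (sqr_ge0 (V x)))).
apply: ler_pM => //; rewrite ler_norml.
by have := sqr_ge0 (U x - V x); have := sqr_ge0 (U x + V x);
  have := sqr_ge0 (U x); have := sqr_ge0 (V x) => *; apply/andP; split; nra.
Qed.

Lemma zint_partial k (G G' : R3 R -> R) :
  mu3.-integrable [set: mR3 R] (EFin \o G) ->
  mu3.-integrable [set: mR3 R] (EFin \o G') ->
  (forall x, is_derive x (basis3 R k) G (G' x)) ->
  (forall x, derivable G' x (basis3 R k)) -> zint G'.
Proof. by move=> iG iG' dG dG'; split => //; exact: (integral_partial_eq0 iG iG' dG dG'). Qed.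

Lemma is_derive_coor (i k : 'I_3) (x : R3 R) :
  is_derive x (basis3 R k) (coor i) (i == k)%:R.
Proof.
rewrite -(ins_coor k x); apply/is_derive_ins; set t := coor k x; set y := rest k x.
have [->|ik] := eqVneq i k.
  have -> : (fun s => coor k (ins k s y)) = id by apply/funext => s; rewrite coor_ins_same.
  exact: is_derive_id.
have -> : (fun s => coor i (ins k s y)) = (fun=> coor i (ins k 0 y)).
  by apply/funext => s; exact: coor_ins.
exact: (@is_derive_const R R^o).
Qed.

(** What the integrations by parts ask of a function: gradient and Hessian in L^2, a symmetric
    Hessian so that cross products of gradients are divergence free, and a derivable one so that the
    integrated derivatives are continuous along lines. *)
Record smooth2 U (A : 'I_3 -> R3 R -> R) (H : 'I_3 -> 'I_3 -> R3 R -> R) : Prop := Smooth2 {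
  smooth2_U : sq_int U;
  smooth2_A : forall k, sq_int (A k);
  smooth2_H : forall i k, sq_int (H i k);
  smooth2_dU : forall k x, is_derive x (basis3 R k) U (A k x);
  smooth2_dA : forall i k x, is_derive x (basis3 R i) (A k) (H i k x);
  smooth2_sym : forall i k, H i k = H k i;
  smooth2_dH : forall i k j x, derivable (H i k) x (basis3 R j) }.

(** The gradient is written as the mollified weak gradient, which relates it to sigma . grad phi,
    but the Hessian with both derivatives on the kernel, where its symmetry is evident. *)
Lemma convol_smooth2 u (g : 'I_3 -> R3 R -> R) f : sq_int u -> (forall i, ccinf (f i)) ->
  (forall k, sq_int (g k)) -> (forall k, weak_partial_real k u (g k)) ->
  smooth2 (convol u f) (fun k => convol (g k) f)
    (fun i k => convol u (derive_at i (derive_at k f))).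
Proof.
move=> su cf sg wg.
have cd k := ccinf_derive_at k cf.
have cdd i k := ccinf_derive_at i (cd k).
have E k : convol (g k) f = convol u (derive_at k f).
  by apply/funext => x; rewrite (convol_weak x su (sg k) (wg k) cf).
split.
- exact: sq_int_convol.
- by move=> k; exact: sq_int_convol.
- by move=> i k; exact: sq_int_convol.
- by move=> k x; rewrite E; exact: is_derive_convol.
- by move=> i k x; rewrite E; exact: is_derive_convol.
- by move=> i k; rewrite derive_atC.
- by move=> i k j x; case: (is_derive_convol j x su (cdd i k)).
Qed.

Lemma is_derive_derivable U x v (d : R) : is_derive x v U d -> derivable U x v.
Proof. by case. Qed.

Lemma derivable_mul U V x v : derivable U x v -> derivable V x v ->
  derivable (fun y => U y * V y) x v.
Proof.
move=> /derivableP dU /derivableP dV.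
exact: is_derive_derivable (is_derive_mul dU dV).
Qed.

Lemma derivable_add U V x v : derivable U x v -> derivable V x v ->
  derivable (fun y => U y + V y) x v.
Proof.
move=> /derivableP dU /derivableP dV.
exact: is_derive_derivable (is_derive_add dU dV).
Qed.

Lemma derivable_sub U V x v : derivable U x v -> derivable V x v ->
  derivable (fun y => U y - V y) x v.
Proof.
move=> /derivableP dU /derivableP dV.
exact: is_derive_derivable (is_derive_sub dU dV).
Qed.

Lemma zint_partial_product k b b' U U' V V' (B B' : R) :
  measurable_fun [set: mR3 R] b -> (forall x, `|b x| <= B) ->
  measurable_fun [set: mR3 R] b' -> (forall x, `|b' x| <= B') ->
  sq_int U -> sq_int V -> sq_int U' -> sq_int V' ->
  (forall x, is_derive x (basis3 R k) b (b' x)) ->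
  (forall x, is_derive x (basis3 R k) U (U' x)) ->
  (forall x, is_derive x (basis3 R k) V (V' x)) ->
  (forall x, derivable b' x (basis3 R k)) ->
  (forall x, derivable U' x (basis3 R k)) ->
  (forall x, derivable V' x (basis3 R k)) ->
  zint (fun x => b' x * (U x * V x) + b x * (U' x * V x + U x * V' x)).
Proof.
move=> mb bB mb' bB' sU sV sU' sV' db dU dV db' dU' dV'.
apply: (@zint_partial k (fun x => b x * (U x * V x))).
- exact: integrable_bounded_mul bB sU sV.
- have := integrableD measurableT (integrable_bounded_mul mb' bB' sU sV)
    (integrableD measurableT (integrable_bounded_mul mb bB sU' sV)
       (integrable_bounded_mul mb bB sU sV')).
  by congr integrable; apply/funext => x /=; rewrite -!EFinD mulrDr.
- by move=> x; exact: (is_derive_mul (db x) (is_derive_mul (dU x) (dV x))).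
- move=> x.
  have d1 := is_derive_derivable (db x); have d2 := is_derive_derivable (dU x).
  have d3 := is_derive_derivable (dV x).
  exact: (derivable_add (derivable_mul (db' x) (derivable_mul d2 d3))
    (derivable_mul d1 (derivable_add (derivable_mul (dU' x) d3) (derivable_mul d2 (dV' x))))).
Qed.

(** grad U x grad V is the curl of U grad V: in d_k (U d_j V) - d_j (U d_k V) the second derivatives
    cancel. *)
Lemma zint_cross3 U A H V A2 H2 l : smooth2 U A H -> smooth2 V A2 H2 ->
  zint (fun x => cross3 (A^~ x) (A2^~ x) l).
Proof.
move=> sU sV.
have Z k j : zint (fun x => 0 * (U x * A2 j x) + 1 * (A k x * A2 j x + U x * H2 k j x)).
  have b1 (x : R3 R) : `|1 : R| <= 1 by rewrite normr1.
  have b0 (x : R3 R) : `|0 : R| <= 0 by rewrite normr0.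
  have d1 x : is_derive x (basis3 R k) (fun=> 1 : R) 0 by exact: is_derive_const.
  have d0 x : derivable (fun=> 0 : R) x (basis3 R k) by exact: derivable_cst.
  have dH' x : derivable (H2 k j) x (basis3 R k) by exact: (smooth2_dH sV).
  exact: (@zint_partial_product k (fun=> 1) (fun=> 0) U (A k) (A2 j) (H2 k j) 1 0
    (measurable_cst _) b1 (measurable_cst _) b0 (smooth2_U sU) (smooth2_A sV j)
    (smooth2_A sU k) (smooth2_H sV k j) d1 (smooth2_dU sU k) (smooth2_dA sV k j)
    d0 (fun x => is_derive_derivable (smooth2_dA sU k k x)) dH').
have D k j : zint (fun x => A k x * A2 j x - A j x * A2 k x).
  have := zintB (Z k j) (Z j k); congr zint; apply/funext => x.
  rewrite (smooth2_sym sV j k); ring.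
rewrite /cross3; case: (val l) => [|[|n]]; exact: D.
Qed.

(** grad F . (grad U x grad V) is the divergence of F grad U x grad V, since the cross product of
    two gradients is divergence free. *)
Lemma zint_null_lagrangian U A H V A2 H2 (F : R3 R -> R) (F' : 'I_3 -> R3 R -> R) (B B' : R) :
  smooth2 U A H -> smooth2 V A2 H2 ->
  measurable_fun [set: mR3 R] F -> (forall x, `|F x| <= B) ->
  (forall l, measurable_fun [set: mR3 R] (F' l)) -> (forall l x, `|F' l x| <= B') ->
  (forall l x, is_derive x (basis3 R l) F (F' l x)) ->
  (forall l x, derivable (F' l) x (basis3 R l)) ->
  zint (fun x => sum3 (fun l => F' l x * cross3 (A^~ x) (A2^~ x) l)).
Proof.
move=> sU sV mF FB mF' FB' dF dF'.
have Z l i j : zint (fun x => F' l x * (A i x * A2 j x)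
    + F x * (H l i x * A2 j x + A i x * H2 l j x)).
  have d1 x : derivable (H l i) x (basis3 R l) by exact: (smooth2_dH sU).
  have d2 x : derivable (H2 l j) x (basis3 R l) by exact: (smooth2_dH sV).
  exact: (@zint_partial_product l F (F' l) (A i) (H l i) (A2 j) (H2 l j) B B'
    mF FB (mF' l) (FB' l) (smooth2_A sU i) (smooth2_A sV j) (smooth2_H sU l i)
    (smooth2_H sV l j) (dF l) (smooth2_dA sU l i) (smooth2_dA sV l j) (dF' l) d1 d2).
have := zintD (zintD (zintB (Z 0 1 2) (Z 0 2 1)) (zintB (Z 1 2 0) (Z 1 0 2)))
  (zintB (Z 2 0 1) (Z 2 1 0)).
congr zint; apply/funext => x.
rewrite (smooth2_sym sU 1 0) (smooth2_sym sU 2 0) (smooth2_sym sU 2 1).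
rewrite (smooth2_sym sV 1 0) (smooth2_sym sV 2 0) (smooth2_sym sV 2 1).
rewrite /sum3 /cross3 /=; ring.
Qed.

End ZeroIntegral.

(** * The regularized weights and their divergences *)

Section Weights.
Variable R : realType.
Local Notation mu3 := (@lebesgue3 R).
Variables (d alpha nu : R).
Hypotheses (d0 : 0 < d) (alpha0 : 0 < alpha) (nu0 : 0 < nu).

Definition rho (x : R3 R) : R := Num.sqrt (nsq3 (fun k => coor k x) + d ^+ 2).
Definition irho (x : R3 R) : R := (rho x)^-1.
Definition lam (x : R3 R) : R := (alpha * rho x + nu)^-1.

Lemma nsq3_ge0 (x : R3 R) : 0 <= nsq3 (fun k => coor k x).
Proof. by rewrite /nsq3 /sum3 !addr_ge0 ?sqr_ge0. Qed.

Lemma rho_arg_gt0 x : 0 < nsq3 (fun k => coor k x) + d ^+ 2.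
Proof. by rewrite ltr_wpDl ?nsq3_ge0// exprn_gt0. Qed.

Lemma rho_sqr x : rho x ^+ 2 = nsq3 (fun k => coor k x) + d ^+ 2.
Proof. by rewrite sqr_sqrtr// ltW// rho_arg_gt0. Qed.

Lemma rho_ge x : d <= rho x.
Proof.
rewrite -[leLHS]ger0_norm ?(ltW d0)// -sqrtr_sqr ler_sqrt ?sqr_ge0//.
by rewrite lerDr nsq3_ge0.
by rewrite ltW// rho_arg_gt0.
Qed.

Lemma rho_gt0 x : 0 < rho x.
Proof. by rewrite (lt_le_trans d0)// rho_ge. Qed.

Lemma coor_sqr_le k x : coor k x ^+ 2 <= rho x ^+ 2.
Proof.
rewrite rho_sqr /nsq3 /sum3.
have := sqr_ge0 (coor 0 x); have := sqr_ge0 (coor 1 x); have := sqr_ge0 (coor 2 x).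
have := sqr_ge0 d.
have : [|| k == 0, k == 1 | k == 2] by case: k => [[|[|[|]]]].
by case/or3P => /eqP -> *; lra.
Qed.

Lemma coor_le k x : `|coor k x| <= rho x.
Proof.
by rewrite -(ger0_norm (ltW (rho_gt0 x))) -ler_sqr ?nnegrE// !real_normK ?num_real// coor_sqr_le.
Qed.

Lemma irho_gt0 x : 0 < irho x. Proof. by rewrite invr_gt0 rho_gt0. Qed.
Lemma irho_le x : irho x <= d^-1.
Proof. by rewrite lef_pV2 ?posrE ?rho_gt0// rho_ge. Qed.
Lemma rho_irho x : rho x * irho x = 1.
Proof. by rewrite divff// gt_eqF// rho_gt0. Qed.

Lemma lam_den_gt0 x : 0 < alpha * rho x + nu.
Proof. by rewrite addr_gt0// mulr_gt0// rho_gt0. Qed.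
Lemma lam_gt0 x : 0 < lam x. Proof. by rewrite invr_gt0 lam_den_gt0. Qed.
Lemma lam_le x : lam x <= nu^-1.
Proof. by rewrite lef_pV2 ?posrE ?lam_den_gt0// lerDr mulr_ge0// ltW// rho_gt0. Qed.
Lemma rho_lam_le x : rho x * lam x <= alpha^-1.
Proof.
rewrite ler_pdivrMr ?lam_den_gt0// mulrDr mulKf ?gt_eqF//.
by rewrite lerDl mulr_ge0// ltW// invr_gt0.
Qed.

Lemma measurable_rho : measurable_fun [set: mR3 R] rho.
Proof.
apply: measurableT_comp; first exact: (continuous_measurable_fun (@sqrt_continuous R)).
apply: measurable_funD => //; rewrite /nsq3 /sum3.
by do 2 (apply: measurable_funD; last by apply: measurable_funX; exact: measurable_coor);
  apply: measurable_funX; exact: measurable_coor.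
Qed.

Lemma measurable_inv (f : R3 R -> R) : (forall x, 0 <= f x) ->
  measurable_fun [set: mR3 R] f -> measurable_fun [set: mR3 R] (fun x => (f x)^-1).
Proof.
move=> f0 mf.
(* The convention 0^-1 = 0 accounts for the first branch. *)
rewrite (_ : (fun x => _) = fun x => (if f x == 0 then 0 else expR (- ln (f x)))).
  apply: measurable_fun_ifT.
  - apply: (@measurable_fun_eqr _ _ _ _ f (cst 0)); [exact: mf|exact: measurable_cst].
  - exact: measurable_cst.
  - apply: measurableT_comp; first exact: measurable_expR.
    apply: measurableT_comp => //; exact: measurableT_comp.
apply/funext => x; have [->|fx0] := eqVneq (f x) 0; first by rewrite invr0.
by rewrite expRN lnK// posrE lt_neqAle eq_sym fx0 f0.
Qed.

Lemma measurable_irho : measurable_fun [set: mR3 R] irho.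
Proof. by apply: measurable_inv; [by move=> x; exact/ltW/rho_gt0|exact: measurable_rho]. Qed.

Lemma measurable_lam : measurable_fun [set: mR3 R] lam.
Proof.
apply: measurable_inv; first by move=> x; exact/ltW/lam_den_gt0.
by apply: measurable_funD => //; apply: measurable_funM => //; exact: measurable_rho.
Qed.

Lemma is_derive_rho k x : is_derive x (basis3 R k) rho (coor k x * irho x).
Proof.
have H i : is_derive x (basis3 R k) (fun y => coor i y ^+ 2) (2 * coor i x * (i == k)%:R).
  exact: (is_derive_expn 2 (is_derive_coor i k x)).
have HA := is_derive_add (is_derive_add (is_derive_add (H 0) (H 1)) (H 2)) (is_derive_const (d ^+ 2) x (basis3 R k)).
have HS := @is_derive_comp R _ Num.sqrt (fun y : R3 R => nsq3 (fun k => coor k y) + d ^+ 2)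
  x (basis3 R k) _ _ (is_derive1_sqrt (rho_arg_gt0 x)) HA.
apply: is_derive_eq HS _.
rewrite -/(rho x) addr0 /irho.
have r0 : rho x != 0 by rewrite gt_eqF// rho_gt0.
have : [|| k == 0, k == 1 | k == 2] by case: (k) => [[|[|[|]]]].
by case/or3P => /eqP -> /=; field; rewrite r0.
Qed.

Lemma is_derive_irho k x :
  is_derive x (basis3 R k) irho (- (coor k x * irho x ^+ 3)).
Proof.
have r0 : rho x != 0 by rewrite gt_eqF// rho_gt0.
apply: is_derive_eq (is_derive_inv r0 (is_derive_rho k x)) _.
by rewrite /irho; field.
Qed.

Lemma is_derive_lam k x :
  is_derive x (basis3 R k) lam (- (alpha * (coor k x * irho x) * lam x ^+ 2)).
Proof.
have l0 : alpha * rho x + nu != 0 by rewrite gt_eqF// lam_den_gt0.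
have HD := is_derive_add (is_derive_scale alpha (is_derive_rho k x)) (is_derive_const nu x (basis3 R k)).
apply: is_derive_eq (@is_derive_inv R _ (fun y : R3 R => alpha * rho y + nu) x _ _ l0 HD) _.
by rewrite /lam addr0 exprVn mulNr.
Qed.

(** The divergence of U^2 x / rho. Here div (x / rho) = 3 / rho - |x|^2 / rho^3 = 2 / rho + d^2 /
    rho^3, and the term created by the regularization is nonnegative. *)
Lemma zint_radial U A H : @smooth2 R U A H ->
  zint (fun x => 2 * irho x * (U x * sum3 (fun k => coor k x * A k x))
     + U x ^+ 2 * (2 * irho x + d ^+ 2 * irho x ^+ 3)).
Proof.
move=> sU.
pose b k x := coor k x * irho x.
pose b' k x := irho x - coor k x ^+ 2 * irho x ^+ 3.
have mb k : measurable_fun [set: mR3 R] (b k).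
  by apply: measurable_funM; [exact: measurable_coor|exact: measurable_irho].
have mb' k : measurable_fun [set: mR3 R] (b' k).
  apply: measurable_funB; first exact: measurable_irho.
  by apply: measurable_funM; apply: measurable_funX;
    [exact: measurable_coor|exact: measurable_irho].
have bB k x : `|b k x| <= 1.
  rewrite normrM (gtr0_norm (irho_gt0 x)) -(rho_irho x) ler_wpM2r ?coor_le//.
  exact: ltW (irho_gt0 x).
have b'E k x : 0 <= coor k x ^+ 2 * irho x ^+ 3 <= irho x.
  have i0 := irho_gt0 x; rewrite mulr_ge0 ?sqr_ge0 ?exprn_ge0 ?(ltW i0)//=.
  have E1 : rho x ^+ 2 * irho x ^+ 3 = irho x.
    by rewrite [irho x ^+ 3]exprS mulrCA -exprMn rho_irho expr1n mulr1.
  by rewrite -[leRHS]E1 ler_wpM2r ?coor_sqr_le// exprn_ge0// ltW.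
have b'B k x : `|b' k x| <= d^-1.
  have /andP[h1 h2] := b'E k x; have := irho_le x; have := irho_gt0 x => i0 i1.
  by rewrite ger0_norm /b' ?subr_ge0//; lra.
have db k x : is_derive x (basis3 R k) (b k) (b' k x).
  apply: is_derive_eq (is_derive_mul (is_derive_coor k k x) (is_derive_irho k x)) _.
  by rewrite eqxx mul1r /b'; ring.
have db' k x : derivable (b' k) x (basis3 R k).
  have di := is_derive_derivable (is_derive_irho k x).
  have d3 := is_derive_derivable (is_derive_expn 3 (is_derive_irho k x)).
  have dc := is_derive_derivable (is_derive_expn 2 (is_derive_coor k k x)).
  exact: (derivable_sub di (derivable_mul dc d3)).
have Z k : zint (fun x => b' k x * (U x * U x) + b k x * (A k x * U x + U x * A k x)).
  exact: (@zint_partial_product R k (b k) (b' k) U (A k) U (A k) 1 d^-1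
    (mb k) (bB k) (mb' k) (b'B k) (smooth2_U sU) (smooth2_U sU) (smooth2_A sU k)
    (smooth2_A sU k) (db k) (smooth2_dU sU k) (smooth2_dU sU k) (db' k)
    (fun x => is_derive_derivable (smooth2_dA sU k k x))
    (fun x => is_derive_derivable (smooth2_dA sU k k x))).
have := zintD (zintD (Z 0) (Z 1)) (Z 2); congr zint; apply/funext => x.
have E : rho x ^+ 2 = coor 0 x ^+ 2 + coor 1 x ^+ 2 + coor 2 x ^+ 2 + d ^+ 2 by rewrite rho_sqr.
have E1 : irho x = rho x ^+ 2 * irho x ^+ 3.
  by rewrite [irho x ^+ 3]exprS mulrCA -exprMn rho_irho expr1n mulr1.
rewrite /b /b' /sum3.
have -> : d ^+ 2 * irho x ^+ 3 = irho x -
   (coor 0 x ^+ 2 + coor 1 x ^+ 2 + coor 2 x ^+ 2) * irho x ^+ 3.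
  by rewrite [X in _ = X - _]E1 E; ring.
ring.
Qed.

(** The field w x is unbounded, so it cannot serve directly as the coefficient. From w = 1 / alpha -
    (nu / alpha) lam, its component [c] splits into x_c / alpha, whose constant gradient leaves a
    bare cross product, and a multiple of F = x_c lam, bounded by 1 / alpha. *)
Lemma zint_jacobian U A H V A2 H2 c : @smooth2 R U A H -> smooth2 V A2 H2 ->
  zint (fun x => sum3 (fun l =>
    (rho x * lam x * (c == l)%:R + nu * irho x * lam x ^+ 2 * coor c x * coor l x) *
      cross3 (A^~ x) (A2^~ x) l)).
Proof.
move=> sU sV.
pose F x := coor c x * lam x.
pose F' l x := (c == l)%:R * lam x - alpha * (coor c x * coor l x * (irho x * lam x ^+ 2)).
have mc := @measurable_coor R.
have mF : measurable_fun [set: mR3 R] F by apply: measurable_funM => //; exact: measurable_lam.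
have FB x : `|F x| <= alpha^-1.
  rewrite normrM (gtr0_norm (lam_gt0 x)) (le_trans _ (rho_lam_le x))//.
  by rewrite ler_wpM2r ?coor_le// ltW// lam_gt0.
have mF' l : measurable_fun [set: mR3 R] (F' l).
  apply: measurable_funB; first by apply: measurable_funM => //; exact: measurable_lam.
  apply: measurable_funM => //; apply: measurable_funM; first exact: measurable_funM.
  by apply: measurable_funM; [exact: measurable_irho|apply: measurable_funX; exact: measurable_lam].
have FB' l x : `|F' l x| <= 2 / nu.
  have i0 := irho_gt0 x; have l0 := lam_gt0 x; have r0 := rho_gt0 x.
  have h1 : `|(c == l)%:R * lam x| <= nu^-1.
    case: (c == l); rewrite ?mul0r ?mul1r ?normr0 ?invr_ge0 ?(ltW nu0)//.
    by rewrite gtr0_norm// lam_le.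
  have h2 : `|alpha * (coor c x * coor l x * (irho x * lam x ^+ 2))| <= nu^-1.
    rewrite normrM (gtr0_norm alpha0) normrM (gtr0_norm (mulr_gt0 i0 (exprn_gt0 2 l0))).
    apply: (@le_trans _ _ (alpha * (rho x * rho x * (irho x * lam x ^+ 2)))).
      rewrite ler_wpM2l ?(ltW alpha0)// ler_wpM2r//; first exact: ltW (mulr_gt0 i0 (exprn_gt0 2 l0)).
      by rewrite normrM ler_pM// coor_le.
    have -> : alpha * (rho x * rho x * (irho x * lam x ^+ 2)) = alpha * (rho x * lam x) * lam x * (rho x * irho x) by ring.
    rewrite rho_irho mulr1 (le_trans _ (lam_le x))// -[leRHS]mul1r ler_wpM2r ?(ltW l0)//.
    by rewrite -(@mulfV _ alpha) ?gt_eqF// ler_wpM2l ?(ltW alpha0)// rho_lam_le.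
  rewrite (le_trans (ler_normB _ _))// (le_trans (lerD h1 h2))//.
  by rewrite -mulr2n mulr_natl.
have dF l x : is_derive x (basis3 R l) F (F' l x).
  apply: is_derive_eq (is_derive_mul (is_derive_coor c l x) (is_derive_lam l x)) _.
  by rewrite /F'; ring.
have dF' l x : derivable (F' l) x (basis3 R l).
  have dl := is_derive_derivable (is_derive_lam l x).
  have dl2 := is_derive_derivable (is_derive_expn 2 (is_derive_lam l x)).
  have di := is_derive_derivable (is_derive_irho l x).
  have dc i := is_derive_derivable (is_derive_coor i l x).
  have dk (k : R) : derivable (fun=> k) x (basis3 R l) by exact: derivable_cst.
  exact: (derivable_sub (derivable_mul (dk _) dl) (derivable_mul (dk alpha)
    (derivable_mul (derivable_mul (dc c) (dc l)) (derivable_mul di dl2)))).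
have Z1 := zintZ alpha^-1 (zint_cross3 c sU sV).
have Z2 := zintZ (nu / alpha) (zint_null_lagrangian sU sV mF FB mF' FB' dF dF').
have := zintB Z1 Z2; congr zint; apply/funext => x.
have E : rho x * lam x = alpha^-1 - nu / alpha * lam x.
  by rewrite /lam; field; rewrite !gt_eqF// lam_den_gt0.
have a0 : alpha != 0 by rewrite gt_eqF.
rewrite E /F' /sum3.
have : [|| c == 0, c == 1 | c == 2] by case: (c) => [[|[|[|]]]].
by case/or3P => /eqP -> /=; field.
Qed.

End Weights.

Section SmoothHardy.
Variable R : realType.
Local Notation mu3 := (@lebesgue3 R).

Lemma sq_int_comb (c e : R) (U V : R3 R -> R) : sq_int U -> sq_int V ->
  sq_int (fun x => c * U x + e * V x).
Proof.
move=> sU sV; have [mU _] := sU; have [mV _] := sV.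
have mW : measurable_fun [set: mR3 R] (fun x => c * U x + e * V x).
  by apply: measurable_funD; exact: measurable_funM.
split => //.
have iD := integrableD measurableT
  (integrableZl measurableT (2 * c ^+ 2) (sq_int_integrable sU))
  (integrableZl measurableT (2 * e ^+ 2) (sq_int_integrable sV)).
have : mu3.-integrable [set: mR3 R] (fun x => ((c * U x + e * V x) ^+ 2)%:E).
  apply: le_integrable iD => //.
    by apply/measurable_EFinP; exact: measurable_funX.
  move=> x _; rewrite -!EFinM -EFinD !abse_EFin lee_fin.
  rewrite ger0_norm ?sqr_ge0// (le_trans _ (ler_norm _))//.
  have := sqr_ge0 (c * U x - e * V x).
  rewrite -subr_ge0 => H; rewrite -subr_ge0.
  by move: H; congr (0 <= _); ring.
case/integrableP => _; congr (_ < _)%E; apply: eq_integral => x _.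
by rewrite gee0_abs// lee_fin sqr_ge0.
Qed.

Lemma sq_intD (U V : R3 R -> R) : sq_int U -> sq_int V -> sq_int (fun x => U x + V x).
Proof.
move=> sU sV; have := sq_int_comb 1 1 sU sV; congr sq_int.
by apply/funext => x; rewrite !mul1r.
Qed.

Lemma sq_intB (U V : R3 R -> R) : sq_int U -> sq_int V -> sq_int (fun x => U x - V x).
Proof.
move=> sU sV; have := sq_int_comb 1 (-1) sU sV; congr sq_int.
by apply/funext => x; rewrite mul1r mulN1r.
Qed.

Lemma sq_int_dirac_op (g : 'I_4 -> 'I_3 -> R3 R -> R) (p : 'I_4) :
  (forall q k, sq_int (g q k)) -> sq_int (fun x => dirac_op (fun q k => g q k x) p).
Proof.
move=> sg; rewrite /dirac_op; case: (val p) => [|[|[|n]]].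
- by apply: sq_intD => //; exact: sq_intD.
- by apply: sq_intD => //; exact: sq_intB.
- by apply: sq_intB => //; exact: sq_intB.
- by apply: sq_intB => //; exact: sq_intD.
Qed.

Lemma integrable_weight_sum4 (b : R3 R -> R) (B : R) (U : 'I_4 -> R3 R -> R) :
  measurable_fun [set: mR3 R] b -> (forall x, `|b x| <= B) -> (forall p, sq_int (U p)) ->
  mu3.-integrable [set: mR3 R] (fun x => (b x * sum4 (fun p => U p x ^+ 2))%:E).
Proof.
move=> mb bB sU.
have H p := integrable_bounded_mul mb bB (sU p) (sU p).
have := integrableD measurableT (integrableD measurableT (integrableD measurableT (H 0) (H 1)) (H 2)) (H 3).
by congr integrable; apply/funext => x; rewrite /sum4 -!EFinD; congr EFin; ring.
Qed.

Lemma smooth_hardy (d alpha nu beta : R) (U : 'I_4 -> R3 R -> R)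
    (A : 'I_4 -> 'I_3 -> R3 R -> R) (H : 'I_4 -> 'I_3 -> 'I_3 -> R3 R -> R) :
  0 < d -> 0 < alpha -> 0 < nu -> 0 <= beta ->
  (forall p, smooth2 (U p) (A p) (H p)) ->
  ((2 * beta - beta ^+ 2 * nu)%:E *
     \int[mu3]_x (irho d x * sum4 (fun p => U p x ^+ 2))%:E <=
   \int[mu3]_x (rho d x * lam d alpha nu x *
      sum4 (fun p => dirac_op (fun q k => A q k x) p ^+ 2))%:E +
   (beta ^+ 2 * alpha)%:E * \int[mu3]_x (1 * sum4 (fun p => U p x ^+ 2))%:E)%E.
Proof.
move=> d0 a0 nu0 b0 sU.
pose S x := sum4 (fun p => U p x ^+ 2).
pose D x := sum4 (fun p => dirac_op (fun q k => A q k x) p ^+ 2).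
pose w x := rho d x * lam d alpha nu x.
pose ir := irho d.
pose C := 2 * beta - beta ^+ 2 * nu.
have i0 x : 0 < ir x by exact: irho_gt0.
have r0 x : 0 < rho d x by exact: rho_gt0.
have l0 x : 0 < lam d alpha nu x by exact: lam_gt0.
have S0 x : 0 <= S x by rewrite /S /sum4 !addr_ge0 ?sqr_ge0.
have sUU p : sq_int (U p) := smooth2_U (sU p).
have sD p : sq_int (fun x => dirac_op (fun q k => A q k x) p).
  by apply: sq_int_dirac_op => q k; exact: (smooth2_A (sU q)).
have iS : mu3.-integrable [set: mR3 R] (fun x => (1 * S x)%:E).
  apply: (@integrable_weight_sum4 (fun=> 1) 1) => //.
  by move=> x; rewrite normr1.
have iSi : mu3.-integrable [set: mR3 R] (fun x => (ir x * S x)%:E).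
  apply: (@integrable_weight_sum4 ir d^-1) => //; first exact: measurable_irho.
  by move=> x; rewrite gtr0_norm// irho_le.
have iD : mu3.-integrable [set: mR3 R] (fun x => (w x * D x)%:E).
  apply: (@integrable_weight_sum4 w alpha^-1) => //.
    by apply: measurable_funM; [exact: measurable_rho|exact: measurable_lam].
  by move=> x; rewrite gtr0_norm ?mulr_gt0// rho_lam_le.
pose rad p x := 2 * ir x * (U p x * sum3 (fun k => coor k x * A p k x))
     + U p x ^+ 2 * (2 * ir x + d ^+ 2 * ir x ^+ 3).
have zr p : zint (rad p) by exact: (zint_radial d0 (sU p)).
pose J c p q x := sum3 (fun l =>
    (rho d x * lam d alpha nu x * (c == l)%:R +
     nu * irho d x * lam d alpha nu x ^+ 2 * coor c x * coor l x) *
      cross3 (fun k => A p k x) (fun k => A q k x) l).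
have zJ c p q : zint (J c p q) by exact: (zint_jacobian d0 a0 nu0 c (sU p) (sU q)).
(* The null part: the radial divergences, and the contraction of the Jacobian of w x with [curl],
   whose rows are spelled out with their common factor 2. *)
pose Z x := beta * (rad 0 x + rad 1 x + rad 2 x + rad 3 x)
   - 2 * (J 0 3 0 x + J 0 1 2 x + (J 1 0 2 x + J 1 1 3 x) + (J 2 2 3 x - J 2 0 1 x)).
have zZ : zint Z.
  apply: zintB; apply: zintZ.
    by apply: zintD => //; apply: zintD => //; exact: zintD.
  apply: zintD; last exact: zintB.
  by apply: zintD; exact: zintD.
pose Q2 x := w x * D x + beta ^+ 2 * alpha * (1 * S x) - C * (ir x * S x).
have iQ2 : mu3.-integrable [set: mR3 R] (EFin \o Q2).
  have := integrableB measurableT (integrableD measurableT iD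
    (integrableZl measurableT (beta ^+ 2 * alpha) iS)) (integrableZl measurableT C iSi).
  by congr integrable.
(* [Q2 + Z] is exactly the expression of [pointwise_hardy] plus the d^2 term of div (x / rho), which
   has a favourable sign because [beta] is nonnegative. *)
have PQ x : - Z x <= Q2 x.
  have nsq : nsq3 (fun k => coor k x) <= rho d x ^+ 2.
    by rewrite rho_sqr// lerDl sqr_ge0.
  have Eg : nu * ir x * lam d alpha nu x ^+ 2 = nu / (rho d x * (alpha * rho d x + nu) ^+ 2).
    rewrite /ir /irho /lam exprVn; field.
    by rewrite !gt_eqF// lam_den_gt0.
  have := @pointwise_hardy R (fun k => coor k x) (fun p => U p x) (fun p k => A p k x)
     (rho d x) alpha nu beta (w x) (nu * ir x * lam d alpha nu x ^+ 2)
     (erefl _) Eg (r0 x) a0 nu0 nsq.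
  rewrite -/(D x) -/(S x) => P0.
  have ds : 0 <= beta * (d ^+ 2 * ir x ^+ 3) * S x.
    apply: mulr_ge0 => //; apply: mulr_ge0 => //.
    by apply: mulr_ge0; [exact: sqr_ge0|apply: exprn_ge0; exact: ltW].
  rewrite -subr_ge0; apply: (le_trans (addr_ge0 P0 ds)).
  rewrite le_eqVlt; apply/orP; left; apply/eqP.
  rewrite /Q2 /Z /rad /C /J -/(w x) -/ir.
  rewrite /S /sum4 -[nu / rho d x]/(nu * ir x) -[2 * beta / rho d x]/(2 * beta * ir x).
  rewrite /sum3 /curl /=.
  set w' := w x; set i' := ir x; set D' := D x; set l' := lam d alpha nu x.
  ring.
have : (0 <= \int[mu3]_x (Q2 x)%:E)%E.
  have [iZ Z0] := zintZ (-1) zZ.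
  rewrite -Z0; apply: le_integral => //.
  by move=> x _; rewrite lee_fin mulN1r.
have -> : (\int[mu3]_x (Q2 x)%:E = \int[mu3]_x (w x * D x)%:E +
   (beta ^+ 2 * alpha)%:E * \int[mu3]_x (1 * S x)%:E - C%:E * \int[mu3]_x (ir x * S x)%:E)%E.
  rewrite -!integralZl// -integralD//; last exact: integrableZl.
  rewrite -integralB//; last 2 first.
  - by apply: integrableD => //; exact: integrableZl.
  - exact: integrableZl.
rewrite sube_ge0//.
by rewrite fin_numM// integrable_fin_num.
Qed.

End SmoothHardy.

(** * Removal of the regularizations *)

Section Hardy.
Variable R : realType.
Local Notation mu3 := (@lebesgue3 R).

Definition weight (alpha nu : R) (x : R3 R) : R := enorm x / (alpha * enorm x + nu).

Lemma enormE (x : R3 R) : enorm x = Num.sqrt (nsq3 (fun k => coor k x)).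
Proof. by []. Qed.

Lemma enorm_ge0 (x : R3 R) : 0 <= enorm x. Proof. exact: sqrtr_ge0. Qed.

Lemma enorm_sqr (x : R3 R) : enorm x ^+ 2 = nsq3 (fun k => coor k x).
Proof. by rewrite enormE sqr_sqrtr// nsq3_ge0. Qed.

Lemma measurable_enorm : measurable_fun [set: mR3 R] (@enorm R).
Proof.
apply: measurableT_comp; first exact: (continuous_measurable_fun (@sqrt_continuous R)).
rewrite -[X in measurable_fun _ X]/(fun x : R3 R => nsq3 (fun k => coor k x)) /nsq3 /sum3.
by do 2 (apply: measurable_funD; last by apply: measurable_funX; exact: measurable_coor);
  apply: measurable_funX; exact: measurable_coor.
Qed.

Lemma enorm_triangle (x y : R3 R) :
  enorm x <= enorm y + (`|coor 0 x - coor 0 y| + `|coor 1 x - coor 1 y| + `|coor 2 x - coor 2 y|).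
Proof.
set s := _ + _ + _.
have s0 : 0 <= s by rewrite !addr_ge0.
have ey := enorm_ge0 y.
rewrite -(ler_sqr (enorm_ge0 x)) ?nnegrE ?addr_ge0//.
rewrite sqrrD !enorm_sqr /nsq3 /sum3.
have c k : `|coor k y| <= enorm y.
  rewrite -(ger0_norm ey) -ler_sqr ?nnegrE// !real_normK ?num_real// enorm_sqr /nsq3 /sum3.
  have := sqr_ge0 (coor 0 y); have := sqr_ge0 (coor 1 y); have := sqr_ge0 (coor 2 y).
  have : [|| k == 0, k == 1 | k == 2] by case: k => [[|[|[|]]]].
  by case/or3P => /eqP -> *; lra.
have H k : coor k x ^+ 2 <= coor k y ^+ 2 + 2 * (enorm y * `|coor k x - coor k y|)
    + `|coor k x - coor k y| ^+ 2.
  rewrite real_normK ?num_real//.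
  have : coor k y * (coor k x - coor k y) <= enorm y * `|coor k x - coor k y|.
    by rewrite (le_trans (ler_norm _))// normrM ler_wpM2r.
  by nra.
have := H 0; have := H 1; have := H 2; rewrite /s.
set a0 := `|_ - coor 0 y|; set a1 := `|_ - coor 1 y|; set a2 := `|_ - coor 2 y|.
have p01 : 0 <= a0 * a1 by apply: mulr_ge0; exact: normr_ge0.
have p02 : 0 <= a0 * a2 by apply: mulr_ge0; exact: normr_ge0.
have p12 : 0 <= a1 * a2 by apply: mulr_ge0; exact: normr_ge0.
move=> h2 h1 h0; rewrite -subr_ge0 in h0; rewrite -subr_ge0 in h1; rewrite -subr_ge0 in h2.
rewrite -subr_ge0; lra.
Qed.

Lemma rho_le_enorm (d : R) (x : R3 R) : 0 < d -> rho d x <= enorm x + d.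
Proof.
move=> d0; have ex := enorm_ge0 x.
have d0' := ltW d0.
rewrite -(ler_sqr (ltW (rho_gt0 d0 x))) ?nnegrE ?addr_ge0//.
rewrite rho_sqr// sqrrD enorm_sqr lerD2r lerDl mulrn_wge0//.
exact: mulr_ge0.
Qed.

(** t / (alpha t + nu) is increasing with derivative nu / (alpha t + nu)^2 <= 1 / nu. The constant
    does not depend on [alpha]. *)
Lemma weight_lipschitz (alpha nu s t e : R) : 0 < alpha -> 0 < nu -> 0 <= s -> 0 <= t ->
  0 <= e -> s <= t + e ->
  s / (alpha * s + nu) <= t / (alpha * t + nu) + e / nu.
Proof.
move=> a0 n0 s0 t0 e0 st.
have ds : 0 < alpha * s + nu by rewrite ltr_wpDl// mulr_ge0// ltW.
have dt : 0 < alpha * t + nu by rewrite ltr_wpDl// mulr_ge0// ltW.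
rewrite -subr_ge0.
have -> : t / (alpha * t + nu) + e / nu - s / (alpha * s + nu) =
   ((t + e - s) * nu ^+ 2 + e * (alpha ^+ 2 * s * t + alpha * nu * (s + t)))
     / (nu * (alpha * t + nu) * (alpha * s + nu)).
  by field; rewrite !gt_eqF.
apply: divr_ge0; last by rewrite !mulr_ge0// ltW.
have ast : 0 <= alpha ^+ 2 * s * t by rewrite !mulr_ge0// ltW.
have ans : 0 <= alpha * nu * (s + t) by rewrite !mulr_ge0 ?addr_ge0// ltW.
by apply: addr_ge0; apply: mulr_ge0; rewrite ?subr_ge0 ?sqr_ge0 ?(addr_ge0 ast ans).
Qed.

Lemma ker3_moll3_near n0 n1 n2 N (x y : R3 R) :
  (N <= n0)%N -> (N <= n1)%N -> (N <= n2)%N -> ker3 (@moll3 R n0 n1 n2) x y != 0 ->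
  `|coor 0 x - coor 0 y| + `|coor 1 x - coor 1 y| + `|coor 2 x - coor 2 y| <= 3 / N.+1%:R.
Proof.
move=> h0 h1 h2.
have P (a b c : R) : a * b * c != 0 -> [/\ a != 0, b != 0 & c != 0].
  by rewrite !mulf_eq0 !negb_or => /andP[/andP[]].
case/P => k0 k1 k2.
have H n (t : R) : (N <= n)%N -> moll n t != 0 -> `|t| <= N.+1%:R^-1.
  move=> Nn; rewrite leNgt; apply: contra => Ht; apply/eqP; apply: moll_eq0.
  by rewrite (le_trans _ (ltW Ht))// lef_pV2 ?posrE// ler_nat.
have a0 := H _ _ h0 k0; have a1 := H _ _ h1 k1; have a2 := H _ _ h2 k2.
have -> : 3 / N.+1%:R = N.+1%:R^-1 + N.+1%:R^-1 + N.+1%:R^-1 :> R by ring.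
by rewrite !lerD.
Qed.

Lemma convol_lin (c e : R) (u v : R3 R -> R) f x : sq_int u -> sq_int v ->
  (forall i, ccinf (f i)) ->
  convol (fun y => c * u y + e * v y) f x = c * convol u f x + e * convol v f x.
Proof.
move=> su sv cf; apply: EFin_inj.
rewrite EFinD !EFinM !convolE//; last exact: sq_int_comb.
have i1 := convol_integrable x su cf; have i2 := convol_integrable x sv cf.
rewrite -!integralZl// -integralD//; try exact: integrableZl.
by apply: eq_integral => y _; rewrite -!EFinM -EFinD mulrDl !mulrA.
Qed.

Lemma convolD u v f x : sq_int u -> sq_int v -> (forall i, ccinf (f i)) ->
  convol (fun y : R3 R => u y + v y) f x = convol u f x + convol v f x.
Proof.
move=> su sv cf; have := convol_lin 1 1 x su sv cf; rewrite !mul1r => <-.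
by congr (convol _ f x); apply/funext => y; rewrite !mul1r.
Qed.

Lemma convolB u v f x : sq_int u -> sq_int v -> (forall i, ccinf (f i)) ->
  convol (fun y : R3 R => u y - v y) f x = convol u f x - convol v f x.
Proof.
move=> su sv cf; have := convol_lin 1 (-1) x su sv cf; rewrite mul1r mulN1r => <-.
by congr (convol _ f x); apply/funext => y; rewrite mul1r mulN1r.
Qed.

Lemma convol_dirac_op (g : 'I_4 -> 'I_3 -> R3 R -> R) f (p : 'I_4) x :
  (forall q k, sq_int (g q k)) -> (forall i, ccinf (f i)) ->
  dirac_op (fun q k => convol (g q k) f x) p =
  convol (fun y => dirac_op (fun q k => g q k y) p) f x.
Proof.
move=> sg cf; rewrite /dirac_op; case: (val p) => [|[|[|n]]].
- by rewrite !convolD//; exact: sq_intD.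
- by rewrite convolD ?convolB//; exact: sq_intB.
- by rewrite !convolB//; exact: sq_intB.
- by rewrite convolB ?convolD//; exact: sq_intD.
Qed.

End Hardy.

Section Core.
Variable R : realType.
Local Notation mu3 := (@lebesgue3 R).

Lemma sum4_sqr_ge0 (v : 'I_4 -> R) : 0 <= sum4 (fun p => v p ^+ 2).
Proof. by rewrite /sum4 !addr_ge0 ?sqr_ge0. Qed.

Lemma measurable_sum4_sqr (v : 'I_4 -> R3 R -> R) :
  (forall p, measurable_fun [set: mR3 R] (v p)) ->
  measurable_fun [set: mR3 R] (fun x => sum4 (fun p => v p x ^+ 2)).
Proof.
by move=> mv; rewrite /sum4; do 3 ? apply: measurable_funD; exact: measurable_funX.
Qed.

Lemma integral_weight_sum4 (W : R3 R -> R) (v : 'I_4 -> R3 R -> R) :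
  measurable_fun [set: mR3 R] W -> (forall x, 0 <= W x) ->
  (forall p, measurable_fun [set: mR3 R] (v p)) ->
  (\int[mu3]_x (W x * sum4 (fun p => v p x ^+ 2))%:E =
   \int[mu3]_x (W x * v 0%R x ^+ 2)%:E + \int[mu3]_x (W x * v 1%R x ^+ 2)%:E +
   \int[mu3]_x (W x * v 2%R x ^+ 2)%:E + \int[mu3]_x (W x * v 3%R x ^+ 2)%:E)%E.
Proof.
move=> mW W0 mv.
have m p : measurable_fun [set: mR3 R] (fun x => (W x * v p x ^+ 2)%:E).
  by apply/measurable_EFinP; apply: measurable_funM => //; exact: measurable_funX.
have p0 p x : (0 <= (W x * v p x ^+ 2)%:E)%E.
  by rewrite lee_fin; apply: mulr_ge0 => //; exact: sqr_ge0.
have s0 p q x : (0 <= (W x * v p x ^+ 2)%:E + (W x * v q x ^+ 2)%:E)%E.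
  by apply: adde_ge0; exact: p0.
rewrite -ge0_integralD//; try (by move=> x _; rewrite ?s0 ?p0).
rewrite -ge0_integralD//; try (by move=> x _; rewrite ?s0 ?p0); try exact: emeasurable_funD.
rewrite -ge0_integralD//; try (by move=> x _; rewrite ?p0// adde_ge0// s0);
  try (by apply: emeasurable_funD => //; exact: emeasurable_funD).
by apply: eq_integral => x _; rewrite -!EFinD /sum4; congr EFin; ring.
Qed.

(* Jensen's inequality: [ker3 (moll3 n0 n1 n2) x] is a probability density. *)
Lemma convol_moll3_weighted_le n0 n1 n2 (v : 'I_4 -> R3 R -> R) (W W2 : R3 R -> R) :
  (forall p, sq_int (v p)) ->
  measurable_fun [set: mR3 R] W -> (forall x, 0 <= W x) ->
  measurable_fun [set: mR3 R] W2 -> (forall x, 0 <= W2 x) ->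
  (forall x y, ker3 (@moll3 R n0 n1 n2) x y != 0 -> W x <= W2 y) ->
  (\int[mu3]_x (W x * sum4 (fun p => convol (v p) (moll3 n0 n1 n2) x ^+ 2))%:E <=
   \int[mu3]_x (W2 x * sum4 (fun p => v p x ^+ 2))%:E)%E.
Proof.
move=> sv mW W0 mW2 W20 WW2.
have cf := @moll3_ccinf R n0 n1 n2.
have [B HK] := schur_kernel_ker3 cf ltr01 (ker3_L1_moll R
  (fun i => match val i with 0 => n0 | 1 => n1 | _ => n2 end)).
have mc p : measurable_fun [set: mR3 R] (convol (v p) (moll3 n0 n1 n2)).
  by have [] := sq_int_convol (sv p) cf.
have mv p : measurable_fun [set: mR3 R] (v p) by have [] := sv p.
rewrite (integral_weight_sum4 mW W0 mc) (integral_weight_sum4 mW2 W20 mv).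
have H p : (\int[mu3]_x (W x * convol (v p) (moll3 n0 n1 n2) x ^+ 2)%:E <=
    \int[mu3]_x (W2 x * v p x ^+ 2)%:E)%E.
  have := schur_weighted_le HK (sv p) mW W0 mW2 W20 WW2.
  by rewrite expr1n mul1e.
by apply: leeD; [apply: leeD; [apply: leeD|]|]; exact: H.
Qed.

Definition regularity (u : 'I_4 -> R3 R -> R) (g : 'I_4 -> 'I_3 -> R3 R -> R) : Prop :=
  [/\ forall p, sq_int (u p), forall p k, sq_int (g p k) &
      forall p k, weak_partial_real k (u p) (g p k)].

Lemma weight_ge0 (alpha nu : R) x : 0 < alpha -> 0 < nu -> 0 <= weight alpha nu x.
Proof.
move=> a0 n0; apply: divr_ge0; first exact: enorm_ge0.
by apply: addr_ge0; [apply: mulr_ge0; [exact: ltW|exact: enorm_ge0]|exact: ltW].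
Qed.

Lemma measurable_weight (alpha nu : R) : 0 < alpha -> 0 < nu ->
  measurable_fun [set: mR3 R] (weight alpha nu).
Proof.
move=> a0 n0; apply: measurable_funM; first exact: measurable_enorm.
apply: measurable_inv.
  by move=> x; apply: addr_ge0; [apply: mulr_ge0; [exact: ltW|exact: enorm_ge0]|exact: ltW].
apply: measurable_funD => //; apply: measurable_funM => //; exact: measurable_enorm.
Qed.

(** A single scale d = 1 / (N + 1) regularizes r and bounds the mollifier widths; it stays fixed
    while the widths shrink. In the weight, the kernel displaces r by at most 3 d and passing from
    rho to r costs another d, whence the 4. *)
Lemma regularized_hardy (N : nat) (alpha nu beta : R) u g :
  0 < alpha -> 0 < nu -> 0 <= beta -> 0 <= 2 * beta - beta ^+ 2 * nu -> regularity u g ->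
  (\int[mu3]_x ((2 * beta - beta ^+ 2 * nu) * irho N.+1%:R^-1 x *
      sum4 (fun p => u p x ^+ 2))%:E <=
   \int[mu3]_x ((weight alpha nu x + (4 / nu) / N.+1%:R) *
      sum4 (fun p => dirac_op (fun q k => g q k x) p ^+ 2))%:E +
   (beta ^+ 2 * alpha)%:E * \int[mu3]_x (1 * sum4 (fun p => u p x ^+ 2))%:E)%E.
Proof.
move=> a0 n0 b0; set C := 2 * beta - _ => C0 [su sg wg].
set d := N.+1%:R^-1; have d0 : 0 < d by rewrite invr_gt0.
have mirho := measurable_irho d0.
have i0 x : 0 <= irho d x by apply: ltW; exact: irho_gt0.
have sD p : sq_int (fun x => dirac_op (fun q k => g q k x) p) by exact: sq_int_dirac_op.
apply: (@fatou_convol R (fun x => C * irho d x) u _ N) => //.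
- exact: measurable_funM.
- by move=> x; exact: mulr_ge0.
move=> n1 n2 n3 h1 h2 h3; set f := moll3 n1 n2 n3.
have cf : forall i, ccinf (f i) := @moll3_ccinf R n1 n2 n3.
have sc p : sq_int (convol (u p) f) by exact: sq_int_convol.
have := @smooth_hardy R d alpha nu beta (fun p => convol (u p) f)
  (fun p k => convol (g p k) f) _ d0 a0 n0 b0
  (fun p => convol_smooth2 (su p) cf (sg p) (wg p)).
rewrite -/C -ge0_integralZl//; last 2 first.
- apply/measurable_EFinP; apply: measurable_funM => //.
  by apply: measurable_sum4_sqr => p; have [] := sc p.
- by move=> x _; rewrite lee_fin; apply: mulr_ge0 => //; exact: sum4_sqr_ge0.
under eq_integral do rewrite -EFinM mulrA.
move/le_trans; apply; apply: leeD; last first.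
  apply: lee_wpmul2l; first by rewrite lee_fin mulr_ge0 ?sqr_ge0// ltW.
  by apply: (@convol_moll3_weighted_le n1 n2 n3 u (fun=> 1) (fun=> 1)).
rewrite [X in (X <= _)%E](_ : _ = \int[mu3]_x (rho d x * lam d alpha nu x * sum4 (fun p =>
    convol (fun y => dirac_op (fun q k => g q k y) p) f x ^+ 2))%:E)%E; last first.
  apply: eq_integral => x _; congr ((_ * _)%:E).
  by rewrite /sum4 !convol_dirac_op.
apply: (@convol_moll3_weighted_le n1 n2 n3 (fun p y => dirac_op (fun q k => g q k y) p)
  (fun x => rho d x * lam d alpha nu x) (fun x => weight alpha nu x + (4 / nu) * d)) => //.
- by apply: measurable_funM; [exact: measurable_rho|exact: measurable_lam].
- by move=> x; apply: mulr_ge0; apply: ltW; [exact: rho_gt0|exact: lam_gt0].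
- by apply: measurable_funD => //; exact: measurable_weight.
- move=> x; apply: addr_ge0; first exact: weight_ge0.
  by apply: mulr_ge0; [apply: divr_ge0 => //; exact: ltW|exact: ltW].
move=> x y kxy.
have -> : 4 / nu * d = 4 * d / nu by ring.
apply: weight_lipschitz => //.
- by apply: ltW; exact: rho_gt0.
- exact: enorm_ge0.
- by apply: mulr_ge0 => //; exact: ltW.
have := rho_le_enorm x d0; have := enorm_triangle x y.
have := ker3_moll3_near h1 h2 h3 kxy; rewrite -/d.
by lra.
Qed.

End Core.

Section Limit.
Variable R : realType.
Local Notation mu3 := (@lebesgue3 R).

Lemma fatou_cvg_le d (T : measurableType d) (m : {measure set T -> \bar R})
    (f : nat -> T -> R) (F : T -> R) (C : \bar R) :
  (forall n, measurable_fun [set: T] (f n)) -> (forall n x, 0 <= f n x) ->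
  (forall x, (fun n => f n x) @ \oo --> F x) ->
  (forall n, (\int[m]_x (f n x)%:E <= C)%E) -> (\int[m]_x (F x)%:E <= C)%E.
Proof.
move=> mf f0 fF fC.
have E x : (F x)%:E = limn_einf (fun n => (f n x)%:E).
  have : (fun n => (f n x)%:E) @ \oo --> (F x)%:E by apply: cvg_EFin; [exact: nearW|exact: fF].
  by move/cvg_limn_einf_sup => [].
under eq_integral do rewrite E.
apply: (le_trans (fatou m measurableT (f := fun n x => (f n x)%:E) _ _)).
- by move=> n; apply/measurable_EFinP.
- by move=> n x _; rewrite lee_fin.
rewrite limn_einf_lim; apply: lime_le; first exact: is_cvg_einfs.
apply: nearW => n; apply: (@le_trans _ _ (\int[m]_x (f n x)%:E)%E) => //.
by apply: ereal_inf_lbound; exists n => //=.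
Qed.

Lemma integral_sum4_lty (v : 'I_4 -> R3 R -> R) : (forall p, sq_int (v p)) ->
  (\int[mu3]_x (sum4 (fun p => v p x ^+ 2))%:E < +oo)%E.
Proof.
move=> sv.
have -> : (\int[mu3]_x (sum4 (fun p => v p x ^+ 2))%:E =
  \int[mu3]_x ((cst 1 : R3 R -> R) x * sum4 (fun p => v p x ^+ 2))%:E)%E.
  by apply: eq_integral => x _; rewrite mul1r.
rewrite (@integral_weight_sum4 R (cst 1) v)//; last by move=> p; have [] := sv p.
have H p : (\int[mu3]_x ((cst 1 : R3 R -> R) x * v p x ^+ 2)%:E < +oo)%E.
  by under eq_integral do rewrite mul1r; have [] := sv p.
by apply: lte_add_pinfty; [apply: lte_add_pinfty; [apply: lte_add_pinfty|]|]; exact: H.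
Qed.

Lemma cvg_regularized_inv (r : R) : 0 <= r ->
  (fun n => r / (r ^+ 2 + n.+1%:R^-1 ^+ 2)) @ \oo --> r^-1.
Proof.
rewrite le_eqVlt => /predU1P[<-|r0].
  by rewrite invr0; under eq_fun do rewrite mul0r; exact: cvg_cst.
have -> : r^-1 = r / (r ^+ 2 + 0 ^+ 2) by field; rewrite gt_eqF.
apply: cvgM; first exact: cvg_cst.
apply: cvgV; first by rewrite expr0n addr0 expf_neq0// gt_eqF.
apply: cvgD; first exact: cvg_cst.
rewrite !expr2; under eq_fun do rewrite expr2.
by apply: cvgM; exact: cvg_harmonic.
Qed.

(** The scale d now tends to 0: Fatou recovers 1 / r on the left, while the error on the right is d
    times a finite integral. *)
Lemma weighted_hardy (alpha nu beta : R) u g :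
  0 < alpha -> 0 < nu -> 0 <= beta -> 0 <= 2 * beta - beta ^+ 2 * nu -> regularity u g ->
  ((2 * beta - beta ^+ 2 * nu)%:E * \int[mu3]_x (sum4 (fun p => u p x ^+ 2) / enorm x)%:E <=
   \int[mu3]_x (weight alpha nu x *
      sum4 (fun p => dirac_op (fun q k => g q k x) p ^+ 2))%:E +
   (beta ^+ 2 * alpha)%:E * \int[mu3]_x (sum4 (fun p => u p x ^+ 2))%:E)%E.
Proof.
move=> a0 n0 b0; set C := 2 * beta - _ => C0 ug; have [su sg wg] := ug.
set S := fun x => sum4 (fun p => u p x ^+ 2).
set D := fun x => sum4 (fun p => dirac_op (fun q k => g q k x) p ^+ 2).
have sD p : sq_int (fun x => dirac_op (fun q k => g q k x) p) by exact: sq_int_dirac_op.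
have mS : measurable_fun [set: mR3 R] S.
  by apply: measurable_sum4_sqr => p; have [] := su p.
have mD : measurable_fun [set: mR3 R] D.
  by apply: (@measurable_sum4_sqr R (fun p x => dirac_op (fun q k => g q k x) p)) => p;
    have [] := sD p.
have S0 x : 0 <= S x by exact: sum4_sqr_ge0.
have D0 x : 0 <= D x by exact: (sum4_sqr_ge0 (fun p => dirac_op (fun q k => g q k x) p)).
have Df : (\int[mu3]_x (D x)%:E < +oo)%E := integral_sum4_lty sD.
have mw := measurable_weight a0 n0.
have w0 x := weight_ge0 x a0 n0.
have mi : measurable_fun [set: mR3 R] (fun x : R3 R => (enorm x)^-1).
  by apply: measurable_inv; [exact: enorm_ge0|exact: measurable_enorm].
rewrite -ge0_integralZl//; last 2 first.
- by apply/measurable_EFinP; exact: measurable_funM.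
- by move=> x _; rewrite lee_fin; apply: divr_ge0; [exact: S0|exact: enorm_ge0].
apply/lee_addgt0Pr => e e0.
set M := fine (\int[mu3]_x (D x)%:E).
have M0 : 0 <= M by apply: fine_ge0; apply: integral_ge0 => x _; rewrite lee_fin.
have ME : (\int[mu3]_x (D x)%:E = M%:E)%E.
  by rewrite fineK// ge0_fin_numE//; apply: integral_ge0 => x _; rewrite lee_fin.
have c0 : 0 <= 4 / nu * M by apply: mulr_ge0 => //; apply: divr_ge0 => //; exact: ltW.
(* Below this value of d the error (4 / nu) d M is at most [e]; the added 1 keeps the denominator
   positive when [M] is 0. *)
have e'0 : 0 < e / (4 / nu * M + 1) by rewrite divr_gt0// ltr_wpDl.
have [N _ HN] := near_infty_natSinv_lt (PosNum e'0).
(* As [0^-1 = 0], irho does not converge to [(enorm x)^-1] at the origin, unlike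
   the smaller function below. *)
pose f n x := C * (enorm x / (enorm x ^+ 2 + (n + N).+1%:R^-1 ^+ 2)) * S x.
have dn0 n x : 0 < enorm x ^+ 2 + (n + N).+1%:R^-1 ^+ 2 :> R.
  by rewrite ltr_wpDl ?sqr_ge0// exprn_gt0// invr_gt0.
have f0 n x : 0 <= f n x.
  apply: mulr_ge0 => //; apply: mulr_ge0 => //; apply: divr_ge0; first exact: enorm_ge0.
  exact: ltW.
have mf n : measurable_fun [set: mR3 R] (f n).
  apply: measurable_funM => //; apply: measurable_funM => //.
  apply: measurable_funM; first exact: measurable_enorm.
  apply: measurable_inv; first by move=> x; exact: ltW.
  by apply: measurable_funD => //; apply: measurable_funX; exact: measurable_enorm.
under eq_integral do rewrite -EFinM.
apply: (@fatou_cvg_le _ _ mu3 f) => //.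
  move=> x; rewrite [X in _ --> X](_ : _ = C * (enorm x)^-1 * S x); last by rewrite mulrAC -mulrA.
  apply: cvgM; last exact: cvg_cst.
  apply: cvgM; first exact: cvg_cst.
  by have := cvg_regularized_inv (enorm_ge0 x); rewrite -(cvg_shiftn N).
move=> n; set d : R := (n + N).+1%:R^-1; have d0 : 0 < d by rewrite invr_gt0.
apply: (@le_trans _ _ (\int[mu3]_x (C * irho d x * S x)%:E)%E).
  apply: ge0_le_integral => //.
  - by move=> x _; rewrite lee_fin.
  - by apply/measurable_EFinP.
  - apply/measurable_EFinP; apply: measurable_funM => //; apply: measurable_funM => //.
    exact: measurable_irho.
  move=> x _; rewrite lee_fin; apply: ler_wpM2r => //; apply: ler_wpM2l => //.
  rewrite ler_pdivrMr// enorm_sqr -rho_sqr// /irho expr2 mulKf ?gt_eqF ?rho_gt0//.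
  rewrite -(ler_sqr (enorm_ge0 x)) ?nnegrE ?(ltW (rho_gt0 d0 x))//.
  by rewrite enorm_sqr rho_sqr// lerDl sqr_ge0.
apply: (le_trans (regularized_hardy (n + N) a0 n0 b0 C0 ug)).
rewrite [leRHS]addeAC; apply: leeD; last first.
  rewrite le_eqVlt; apply/orP; left; apply/eqP; congr (_ * _)%E.
  by apply: eq_integral => x _; rewrite mul1r.
rewrite [leLHS](_ : _ = \int[mu3]_x (weight alpha nu x * D x)%:E +
   (4 / nu * d)%:E * \int[mu3]_x (D x)%:E)%E; last first.
  have cd0 : 0 <= 4 / nu * d by rewrite !mulr_ge0 ?invr_ge0// ltW.
  rewrite -ge0_integralZl//; last 2 first.
  - exact/measurable_EFinP.
  - by move=> x _; rewrite lee_fin.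
  rewrite -ge0_integralD//.
  - by apply: eq_integral => x _; rewrite -EFinM -EFinD mulrDl.
  - by move=> x _; rewrite lee_fin; exact: mulr_ge0.
  - by apply/measurable_EFinP; exact: measurable_funM.
  - by move=> x _; rewrite -EFinM lee_fin; exact: mulr_ge0.
  - by apply/measurable_EFinP; exact: measurable_funM.
apply: leeD => //; rewrite ME -EFinM lee_fin.
have dN : d < e / (4 / nu * M + 1) by apply: HN => /=; exact: leq_addl.
rewrite mulrAC; apply: (@le_trans _ _ ((4 / nu * M + 1) * d)).
  by apply: ler_wpM2r; [exact: ltW|rewrite lerDl].
by rewrite mulrC -ler_pdivlMr ?ltW// ltr_wpDl.
Qed.

End Limit.

(** * From real components to spinors *)

Section Spinors.
Variable R : realType.
Local Notation mu3 := (@lebesgue3 R).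

Definition real_comp (p : 'I_4) (v : spinor R) : R :=
  match val p with
  | 0 => complex.Re (v 0 0) | 1 => complex.Im (v 0 0)
  | 2 => complex.Re (v 1 0) | _ => complex.Im (v 1 0)
  end.

Lemma hnorm_sqr (v : spinor R) : hnorm v ^+ 2 = sum4 (fun p => real_comp p v ^+ 2).
Proof.
rewrite /hnorm sqr_sqrtr; last by apply: sumr_ge0 => i _; rewrite addr_ge0 ?sqr_ge0.
have l1 : lift ord0 ord0 = 1 :> 'I_2 by apply/val_inj.
rewrite !big_ord_recl big_ord0 l1 /sum4 /real_comp /=; ring.
Qed.

Lemma real_comp_sigma_grad (dphi : 'I_3 -> R3 R -> spinor R) x p :
  real_comp p (sigma_grad dphi x) = dirac_op (fun q k => real_comp q (dphi k x)) p.
Proof.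
have E (i : 'I_2) : sigma_grad dphi x i 0 = \sum_(k < 3) \sum_(j < 2) pauli R k i j * dphi k x j 0.
  by rewrite /sigma_grad summxE; apply: eq_bigr => k _; rewrite mxE.
rewrite /real_comp /dirac_op /=.
have l1 : lift ord0 ord0 = 1 :> 'I_2 by apply/val_inj.
have m1 : lift ord0 ord0 = 1 :> 'I_3 by apply/val_inj.
have m2 : lift ord0 (lift ord0 ord0) = 2 :> 'I_3 by apply/val_inj.
rewrite !E !big_ord_recl !big_ord0 m2 m1 l1 /pauli /mx2 /= !mxE /=.
have o2 : ord0 = 0 :> 'I_2 by [].
have o3 : ord0 = 0 :> 'I_3 by [].
rewrite o2 o3 !(mul0r, mul1r, mulN1r, add0r, addr0).
move: (dphi 0 x 0 0) (dphi 0 x 1 0) (dphi 1 x 0 0) (dphi 1 x 1 0) (dphi 2 x 0 0) (dphi 2 x 1 0).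
move=> [? ?] [? ?] [? ?] [? ?] [? ?] [? ?]; case: (nat_of_ord p) => [|[|[|n]]] /=; ring.
Qed.

Lemma real_comp_sq_int (phi : R3 R -> spinor R) p : square_integrable phi ->
  sq_int (fun x => real_comp p (phi x)).
Proof.
move=> [mphi iphi].
have m q : measurable_fun [set: mR3 R] (fun x => real_comp q (phi x)).
  by rewrite /real_comp; case: (val q) => [|[|[|n]]]; [have [] := mphi 0|have [] := mphi 0
    |have [] := mphi 1|have [] := mphi 1].
split => //; apply: le_lt_trans iphi; apply: ge0_le_integral => //.
- by move=> x _; rewrite lee_fin sqr_ge0.
- by apply/measurable_EFinP; exact: measurable_funX.
- apply/measurable_EFinP; under eq_fun do rewrite hnorm_sqr.
  exact: (@measurable_sum4_sqr R (fun p x => real_comp p (phi x))).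
move=> x _; rewrite lee_fin hnorm_sqr /sum4.
have := sqr_ge0 (real_comp 0 (phi x)); have := sqr_ge0 (real_comp 1 (phi x)).
have := sqr_ge0 (real_comp 2 (phi x)); have := sqr_ge0 (real_comp 3 (phi x)).
have : [|| p == 0, p == 1, p == 2 | p == 3] by case: p => [[|[|[|[|]]]]].
by case/or4P => /eqP -> *; lra.
Qed.

Lemma regularity_real_comp (phi : R3 R -> spinor R) dphi :
  square_integrable phi -> L2_weak_gradient phi dphi ->
  regularity (fun p x => real_comp p (phi x)) (fun p k x => real_comp p (dphi k x)).
Proof.
move=> sphi wphi; split.
- by move=> p; exact: real_comp_sq_int.
- by move=> p k; apply: real_comp_sq_int; have [] := wphi k.
move=> p k; have [_ w] := wphi k; rewrite /real_comp.
by case: (val p) => [|[|[|n]]]; [have [] := w 0|have [] := w 0|have [] := w 1|have [] := w 1].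
Qed.

Lemma measurable_hnorm_sqr (phi : R3 R -> spinor R) g :
  regularity (fun p x => real_comp p (phi x)) g ->
  measurable_fun [set: mR3 R] (fun x => hnorm (phi x) ^+ 2).
Proof.
move=> [su _ _]; under eq_fun do rewrite hnorm_sqr.
by apply: (@measurable_sum4_sqr R (fun p x => real_comp p (phi x))) => p; have [] := su p.
Qed.

Lemma hnorm_sqr_sigma_grad (dphi : 'I_3 -> R3 R -> spinor R) x :
  hnorm (sigma_grad dphi x) ^+ 2 =
  sum4 (fun p => dirac_op (fun q k => real_comp q (dphi k x)) p ^+ 2).
Proof. by rewrite hnorm_sqr /sum4 !real_comp_sigma_grad. Qed.

Lemma measurable_hnorm_sqr_sigma_grad u (dphi : 'I_3 -> R3 R -> spinor R) :
  regularity u (fun p k x => real_comp p (dphi k x)) ->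
  measurable_fun [set: mR3 R] (fun x => hnorm (sigma_grad dphi x) ^+ 2).
Proof.
move=> [_ sg _]; under eq_fun do rewrite hnorm_sqr_sigma_grad.
apply: (@measurable_sum4_sqr R (fun p x => dirac_op (fun q k => real_comp q (dphi k x)) p)).
by move=> p; have [] := sq_int_dirac_op p sg.
Qed.

(** The majorant [V] covers all cases: (alpha + nu / |x|)^-1 for (a) and (b), |x| for (c). The L^2
    term is kept as a separate integral so that (c) can absorb it in an arbitrarily small error. *)
Lemma spinor_hardy (alpha nu beta C c : R) (V : R3 R -> R) (phi : R3 R -> spinor R) dphi :
  0 < alpha -> 0 < nu -> 0 <= beta -> 0 <= C ->
  C = 2 * beta - beta ^+ 2 * nu -> c = beta ^+ 2 * alpha ->
  measurable_fun [set: mR3 R] V -> (forall x, 0 <= V x) ->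
  (forall x, weight alpha nu x <= V x) ->
  square_integrable phi -> L2_weak_gradient phi dphi ->
  (C%:E * \int[mu3]_x (hnorm (phi x) ^+ 2 / enorm x)%:E <=
   \int[mu3]_x (hnorm (sigma_grad dphi x) ^+ 2 * V x)%:E +
     c%:E * \int[mu3]_x (hnorm (phi x) ^+ 2)%:E)%E.
Proof.
move=> a0 n0 b0 C0 CE -> mV V0 wV sphi wphi.
have reg := regularity_real_comp sphi wphi.
under eq_integral do rewrite hnorm_sqr.
under [X in (_ <= _ + _ * X)%E]eq_integral do rewrite hnorm_sqr.
rewrite CE in C0 *.
apply: (le_trans (weighted_hardy a0 n0 b0 C0 reg)); apply: leeD => //.
have mD := measurable_hnorm_sqr_sigma_grad reg.
under [leLHS]eq_integral do rewrite -hnorm_sqr_sigma_grad.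
apply: ge0_le_integral => //.
- by move=> x _; rewrite lee_fin; apply: mulr_ge0; [exact: weight_ge0|exact: sqr_ge0].
- by apply/measurable_EFinP; apply: measurable_funM => //; exact: measurable_weight.
- by apply/measurable_EFinP; exact: measurable_funM.
by move=> x _; rewrite lee_fin [leRHS]mulrC; apply: ler_wpM2r; [exact: sqr_ge0|exact: wV].
Qed.

End Spinors.

Lemma spinor_hardy_sum (R : realType) (alpha nu beta C c : R) (V : R3 R -> R)
    (phi : R3 R -> spinor R) dphi :
  0 < alpha -> 0 < nu -> 0 <= beta -> 0 <= C ->
  C = 2 * beta - beta ^+ 2 * nu -> c = beta ^+ 2 * alpha ->
  measurable_fun [set: mR3 R] V -> (forall x, 0 <= V x) ->
  (forall x, weight alpha nu x <= V x) ->
  square_integrable phi -> L2_weak_gradient phi dphi ->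
  (C%:E * \int[@lebesgue3 R]_x (hnorm (phi x) ^+ 2 / enorm x)%:E <=
   \int[@lebesgue3 R]_x (hnorm (sigma_grad dphi x) ^+ 2 * V x + c * hnorm (phi x) ^+ 2)%:E)%E.
Proof.
move=> a0 n0 b0 C0 CE cE mV V0 wV sphi wphi.
apply: (le_trans (spinor_hardy a0 n0 b0 C0 CE cE mV V0 wV sphi wphi)).
have c0 : 0 <= c by rewrite cE; apply: mulr_ge0; [exact: sqr_ge0|exact: ltW].
have mS := measurable_hnorm_sqr (regularity_real_comp sphi wphi).
have mD := measurable_hnorm_sqr_sigma_grad (regularity_real_comp sphi wphi).
rewrite -ge0_integralZl//; last 2 first.
- exact/measurable_EFinP.
- by move=> x _; rewrite lee_fin sqr_ge0.
rewrite -ge0_integralD//; last 4 first.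
- by move=> x _; rewrite lee_fin; apply: mulr_ge0; [exact: sqr_ge0|exact: V0].
- by apply/measurable_EFinP; exact: measurable_funM.
- by move=> x _; rewrite -EFinM lee_fin; apply: mulr_ge0 => //; exact: sqr_ge0.
- by apply/measurable_EFinP; exact: measurable_funM.
Qed.

(** Away from the origin the two sides are equal. At the origin the left side is 0, while the
    convention 0^-1 = 0 makes the right side 1 / alpha. *)
Lemma weight_le (R : realType) (alpha nu : R) (x : R3 R) : 0 < alpha -> 0 < nu ->
  weight alpha nu x <= (alpha + nu / enorm x)^-1.
Proof.
move=> a0 n0; have := enorm_ge0 x; rewrite /weight le_eqVlt => /predU1P[<-|r0].
  by rewrite mul0r invr_ge0 invr0 mulr0 addr0 ltW.
rewrite le_eqVlt; apply/orP; left; apply/eqP; field.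
by rewrite !gt_eqF// addr_gt0// mulr_gt0.
Qed.

Lemma measurable_inv_weight (R : realType) (alpha nu : R) : 0 < alpha -> 0 < nu ->
  measurable_fun [set: mR3 R] (fun x : R3 R => (alpha + nu / enorm x)^-1).
Proof.
move=> a0 n0.
apply: measurable_inv.
  move=> x; apply: addr_ge0; first exact: ltW.
  apply: divr_ge0; [exact: ltW|exact: enorm_ge0].
apply: measurable_funD => //; apply: measurable_funM => //.
by apply: measurable_inv; [exact: enorm_ge0|exact: measurable_enorm].
Qed.

Theorem mainTheorem1 (R : realType) (phi : R3 R -> spinor R)
    (dphi : 'I_3 -> R3 R -> spinor R) :
  H1 phi -> L2_weak_gradient phi dphi ->
  [/\ forall nu : R, 0 < nu < 1 ->
        (nu%:E * \int[@lebesgue3 R]_x (hnorm (phi x) ^+ 2 / enorm x)%:E <=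
         \int[@lebesgue3 R]_x
           (hnorm (sigma_grad dphi x) ^+ 2
              / (1 + nu / enorm x + Num.sqrt (1 - nu ^+ 2))
            + (1 - Num.sqrt (1 - nu ^+ 2)) * hnorm (phi x) ^+ 2)%:E)%E,
      (\int[@lebesgue3 R]_x (hnorm (phi x) ^+ 2 / enorm x)%:E <=
       \int[@lebesgue3 R]_x
         (hnorm (sigma_grad dphi x) ^+ 2 / (1 + 1 / enorm x)
          + hnorm (phi x) ^+ 2)%:E)%E
    & (\int[@lebesgue3 R]_x (hnorm (phi x) ^+ 2 / enorm x)%:E <=
       \int[@lebesgue3 R]_x
         (enorm x * hnorm (sigma_grad dphi x) ^+ 2)%:E)%E].
Proof.
move=> [sphi _] wphi.
have V0 (alpha nu : R) x : 0 < alpha -> 0 < nu -> 0 <= (alpha + nu / enorm x)^-1.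
  move=> a0 n0; rewrite invr_ge0 addr_ge0 ?(ltW a0)//.
  by apply: divr_ge0; [exact: ltW|exact: enorm_ge0].
split.
- move=> nu /andP[n0 n1]; set s := Num.sqrt _.
  have s0 : 0 <= s by exact: sqrtr_ge0.
  have s2 : s ^+ 2 = 1 - nu ^+ 2 by rewrite sqr_sqrtr// subr_ge0 expr_le1// ltW.
  have a0 : 0 < 1 + s by rewrite ltr_pwDl.
  (* With alpha = 1 + s and beta = nu / alpha, this factorization gives 2 beta - beta^2 nu = nu (2 -
     (1 - s)) / alpha = nu and beta^2 alpha = nu^2 / alpha = 1 - s. *)
  have n2 : nu ^+ 2 = (1 - s) * (1 + s) by rewrite -[LHS](subKr 1) -s2; ring.
  have CE : nu = 2 * (nu / (1 + s)) - (nu / (1 + s)) ^+ 2 * nu.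
    rewrite expr_div_n n2; field; exact: lt0r_neq0.
  have cE : 1 - s = (nu / (1 + s)) ^+ 2 * (1 + s).
    by rewrite expr_div_n n2; field; exact: lt0r_neq0.
  have b0 : 0 <= nu / (1 + s) by apply: divr_ge0; exact: ltW.
  have := spinor_hardy_sum a0 n0 b0 (ltW n0) CE cE (measurable_inv_weight a0 n0)
    (fun x => V0 _ _ x a0 n0) (fun x => weight_le x a0 n0) sphi wphi.
  move/le_trans; apply; rewrite le_eqVlt; apply/orP; left; apply/eqP.
  by apply: eq_integral => x _; rewrite [1 + s + _]addrAC.
- have h : (0 : R) <= 1 by [].
  have := @spinor_hardy_sum R 1 1 1 1 1 _ phi dphi ltr01 ltr01 ler01 ler01 _ _
    (measurable_inv_weight ltr01 ltr01) (fun x => V0 _ _ x ltr01 ltr01)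
    (fun x => weight_le x ltr01 ltr01) sphi wphi.
  rewrite mul1e => H; apply: le_trans (H _ _) _; [ring|ring|].
  rewrite le_eqVlt; apply/orP; left; apply/eqP.
  by apply: eq_integral => x _; rewrite !mul1r.
have [_ fphi] := sphi.
set I := (\int[_]_x _)%E in fphi.
have If : I \is a fin_num.
  by rewrite ge0_fin_numE//; apply: integral_ge0 => x _; rewrite lee_fin sqr_ge0.
apply/lee_addgt0Pr => e e0.
(* In (c) the parameter alpha = [a] is chosen so that the L^2 term a I is at most [e], which is
   possible because [phi] is in L^2. The weighted integral on the right may be infinite. *)
pose a := e / (fine I + 1).
have I0 : 0 <= fine I.
  by apply: fine_ge0; apply: integral_ge0 => x _; rewrite lee_fin sqr_ge0.
have a0 : 0 < a by rewrite divr_gt0// ltr_wpDl.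
have wle x : weight a 1 x <= enorm x.
  rewrite /weight ler_pdivrMr; last by rewrite ltr_wpDl// mulr_ge0 ?enorm_ge0// ltW.
  rewrite -{1}[enorm x]mulr1; apply: ler_wpM2l; first exact: enorm_ge0.
  by rewrite lerDr; apply: mulr_ge0; [exact: ltW|exact: enorm_ge0].
have := @spinor_hardy R a 1 1 1 a _ phi dphi a0 ltr01 ler01 ler01 _ _
  (@measurable_enorm R) (@enorm_ge0 R) wle sphi wphi.
rewrite mul1e => H; apply: le_trans (H _ _) _; [ring|ring|].
apply: leeD.
  rewrite le_eqVlt; apply/orP; left; apply/eqP.
  by apply: eq_integral => x _; rewrite mulrC.
rewrite -/I -(fineK If) -EFinM lee_fin /a mulrAC ler_pdivrMr ?ltr_wpDl//.
by apply: ler_wpM2l; [exact: ltW|rewrite lerDl].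
Qed.
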